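(* Let $(W,S)$ be a Coxeter system with $W$ finite, $L$ a weight function on $W$ with $L(s)>0$ for all $s\in S$, and assume that (P1)--(P15) hold for $W,L$. Let $\mathcal O=\{f/g\in\mathbb{C}(v)\mid f\in\mathbb{Z}[v,v^{-1}],\ g\in 1+v\mathbb{Z}[v]\}$ and let $R\subseteq\mathbb{C}(v)$ be a noetherian subring such that $\mathcal O\subseteq R$. Let $\Gamma$ be a left cell of $W$. Then $[\Gamma]_R$ is a projective $H_R$-module. Furthermore, if $\Gamma$ is contained in the two-sided cell $\boldsymbol c$ and $R$ is $\boldsymbol c$-adapted, then $[\Gamma]_R$ is indecomposable.
   Context: **Hecke algebra.** $l$ is the length function of $(W,S)$. A weight function is a map $L\colon W\to\mathbb{Z}$ with $L(ww')=L(w)+L(w')$ whenever $l(ww')=l(w)+l(w')$. Let $A=\mathbb{Z}[v,v^{-1}]$, $v$ an indeterminate, and $v_w=v^{L(w)}$. $H$ is the $A$-algebra with $A$-basis $\{T_w\mid w\in W\}$ and $T_sT_w=T_{sw}$ if $l(sw)=l(w)+1$, $T_sT_w=T_{sw}+(v_s-v_s^{-1})T_w$ if $l(sw)=l(w)-1$ ($s\in S$, $w\in W$). The bar involution is the ring involution of $H$ with $\bar v=v^{-1}$, $\overline{T_w}=T_{w^{-1}}^{-1}$. $\{c_w\}$ is the unique $A$-basis with $\overline{c_w}=c_w$ and $c_w=T_w+\sum_{y<w}p_{y,w}T_y$, $p_{y,w}\in v^{-1}\mathbb{Z}[v^{-1}]$ ($<$ the Bruhat--Chevalley order). Write $c_xc_y=\sum_z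 h_{x,y,z}c_z$ with $h_{x,y,z}\in A$. Let $h\mapsto h^\dagger$ be the $A$-algebra involution of $H$ with $T_s^\dagger=-T_s^{-1}$ for $s\in S$. **Cells.** $\leq_{\mathcal L}$ is the reflexive-transitive closure of the relation ''$h_{s,w,y}\neq 0$ for some $s\in S$'' (giving $y\leq_{\mathcal L}w$); $y\leq_{\mathcal R}w$ means $y^{-1}\leq_{\mathcal L}w^{-1}$; $\leq_{\mathcal{LR}}$ is the preorder generated by $\leq_{\mathcal L}$ and $\leq_{\mathcal R}$. The associated equivalence relations $\sim_{\mathcal L},\sim_{\mathcal R},\sim_{\mathcal{LR}}$ have as classes the left, right and two-sided cells. For a left cell $\Gamma$, $[\Gamma]_A$ is the free $A$-module with basis $\{c_y^\dagger\mid y\in\Gamma\}$ and $H$-action $c_x^\dagger\cdot c_y^\dagger=\sum_{z\in\Gamma}h_{x,y,z}c_z^\dagger$ ($x\in W,y\in\Gamma$). For a commutative ring $R\supseteq A$, $H_R=R\otimes_AH$ and $[\Gamma]_R=R\otimes_A[\Gamma]_A$, an $H_R$-module. **Properties (P1)--(P15).** For $z\in W$, $\mathbf a(z)\geq 0$ is the integer with $h_{x,y,z}\in v^{\mathbf a(z)}\mathbb{Z}[v^{-1}]$ for all $x,y$ and $h_{x,y,z}\notin v^{\mathbf a(z)-1}\mathbb{Z}[v^{-1}]$ for some $x,y$. $\gamma_{x,y,z^{-1}}\in\mathbb{Z}$ is the coefficient of $v^{\mathbf a(z)}$ in $h_{x,y,z}$. $\Delta(z)\geq 0$ and $0\ne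 n_z\in\mathbb{Z}$ are defined by $p_{1,z}=n_zv^{-\Delta(z)}+$ strictly smaller powers of $v$ (with $p_{1,1}=1$). $\mathcal D=\{z\in W\mid \mathbf a(z)=\Delta(z)\}$. The properties are: (P1) $\mathbf a(z)\leq\Delta(z)$ for all $z$. (P2) If $d\in\mathcal D$ and $\gamma_{x,y,d}\neq0$ then $x=y^{-1}$. (P3) For each $y$ there is a unique $d\in\mathcal D$ with $\gamma_{y^{-1},y,d}\neq 0$. (P4) $z'\leq_{\mathcal{LR}}z$ implies $\mathbf a(z')\geq\mathbf a(z)$. (P5) If $d\in\mathcal D$ and $\gamma_{y^{-1},y,d}\neq0$ then $\gamma_{y^{-1},y,d}=n_d=\pm1$. (P6) $d^2=1$ for $d\in\mathcal D$. (P7) $\gamma_{x,y,z}=\gamma_{y,z,x}$. (P8) If $\gamma_{x,y,z}\neq0$ then $x\sim_{\mathcal L}y^{-1}$, $y\sim_{\mathcal L}z^{-1}$, $z\sim_{\mathcal L}x^{-1}$. (P9) $z'\leq_{\mathcal L}z$ and $\mathbf a(z')=\mathbf a(z)$ imply $z'\sim_{\mathcal L}z$. (P10) Same as (P9) with $\mathcal R$ in place of $\mathcal L$. (P11) Same as (P9) with $\mathcal{LR}$ in place of $\mathcal L$. (P12) For $I\subset S$ and $y\in W_I=\langle I\rangle$, $\mathbf a(y)$ computed in $W_I$ (with $L|_{W_I}$) equals $\mathbf a(y)$ computed in $W$. (P13) Every left cell $\Gamma$ contains a unique $d\in\mathcal D$, and $\gamma_{x^{-1},x,d}\neq0$ for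 all $x\in\Gamma$. (P14) $z\sim_{\mathcal{LR}}z^{-1}$ for all $z$. (P15) Let $v'$ be a second indeterminate and $h'_{x,y,z}$ be obtained from $h_{x,y,z}$ by $v\mapsto v'$. If $\mathbf a(w)=\mathbf a(y)$ then $\sum_{y'}h'_{w,x',y'}h_{x,y',y}=\sum_{y'}h_{x,w,y'}h'_{y',x',y}$ for all $x,x'\in W$. **The ring $J$.** $J$ is the free $\mathbb{Z}$-module with basis $\{t_w\mid w\in W\}$ and multiplication $t_xt_y=\sum_{z}\gamma_{x,y,z}t_{z^{-1}}$; it is (given (P1)--(P15)) an associative ring with identity $1_J=\sum_{d\in\mathcal D}n_dt_d$. There is an $A$-algebra homomorphism $\phi\colon H\to A\otimes_{\mathbb{Z}}J$, $\phi(c_w^\dagger)=\sum_{z\in W,\,d\in\mathcal D,\,\mathbf a(z)=\mathbf a(d)}h_{w,d,z}\hat n_z t_z$, where $\hat n_z=n_d$ for the unique $d\in\mathcal D$ with $d\sim_{\mathcal L}z^{-1}$. Specializing $v\mapsto1$ and extending scalars gives a $\mathbb{C}$-algebra isomorphism $\phi_1\colon\mathbb{C}[W]\to J_{\mathbb{C}}=\mathbb{C}\otimes_{\mathbb{Z}}J$. For a $\mathbb{C}[W]$-module $E$, $E_\spadesuit$ denotes $E$ regarded as a $J_{\mathbb{C}}$-module via $\phi_1^{-1}$. **The numbers $f_E$.** $\mathrm{Irr}(W)$ is the set of simple $\mathbb{C}[W]$-modules up to isomorphism. Let $K=\mathbb{C}(v)$, $H_K=K\otimes_AH$ (split semisimple).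 There is a bijection $E\mapsto E_v$ from $\mathrm{Irr}(W)$ to the simple $H_K$-modules, characterized by $\mathrm{tr}(T_w,E_v)\in\mathbb{C}[v,v^{-1}]$ and $\mathrm{tr}(w,E)=\mathrm{tr}(T_w,E_v)|_{v=1}$ for all $w$. $\mathbf a_E\geq0$ is the integer such that $v^{\mathbf a_E}\mathrm{tr}(T_w,E_v)\in\mathbb{C}[v]$ for all $w$ and $v^{\mathbf a_E-1}\mathrm{tr}(T_w,E_v)\notin\mathbb{C}[v]$ for some $w$. Put $c_E=\frac1{\dim E}\sum_{w}\mathrm{tr}(T_w,E_v)\mathrm{tr}(T_{w^{-1}},E_v)$. Then $c_E=f_Ev^{-2\mathbf a_E}+$ combination of higher powers of $v$, where $f_E$ is a positive real number; this defines $f_E$. **$\boldsymbol c$-adapted rings.** For a two-sided cell $\boldsymbol c$, let $t_{\boldsymbol c}=\sum_{d\in\mathcal D\cap\boldsymbol c}n_dt_d$ and $\mathrm{Irr}(W,\boldsymbol c)=\{E\in\mathrm{Irr}(W)\mid t_{\boldsymbol c}E_\spadesuit\neq0\}$. A noetherian subring $R\subseteq\mathbb{C}(v)$ is called $\boldsymbol c$-adapted if $R\cap\bigl\{\sum_{E\in\mathrm{Irr}(W,\boldsymbol c)}\frac{n_E}{f_E}\mid n_E\in\mathbb{Z}\bigr\}\subseteq\mathbb{Z}$. *)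

(* Defs.v *)
From HB Require Import structures.
From mathcomp Require Import all_boot all_order all_algebra all_fingroup.
From mathcomp Require Import mxrepresentation.
From mathcomp Require Import boolp classical_sets reals.
From mathcomp.real_closed Require Import complex.

Set Implicit Arguments.
Unset Strict Implicit.
Unset Printing Implicit Defensive.

Import Order.TTheory GRing.Theory Num.Theory.
Local Open Scope ring_scope.

(** * Rings and modules *)

Definition is_basis (B : nzRingType) (M : zmodType) (sc : B -> M -> M)
    (I : finType) (b : I -> M) : Prop :=
  forall m : M, exists! a : {ffun I -> B}, m = \sum_i sc (a i) (b i).

(* The coordinates of m in a basis b of an lmodType (0 if there are none). *)
Definition coords (B : nzRingType) (M : lmodType B) (I : finType) (b : I -> M)
    (m : M) : {ffun I -> B} :=
  xget [ffun=> 0]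
    [set a : {ffun I -> B} | m = \sum_i a i *: b i]%classic.

(* Left ideals are the submodules of the regular module. *)
Definition noetherian (B : nzRingType) : Prop :=
  forall I : submodClosed B^o, exists s : seq B^o,
    {subset s <= I} /\
    forall x, x \in I ->
      exists a : 'I_(size s) -> B, x = \sum_i a i *: s`_i.

Definition projective (B : nzRingType) (M : lmodType B) : Prop :=
  forall (P Q : lmodType B) (g : {linear P -> Q}) (f : {linear M -> Q}),
    (forall q, exists p, g p = q) ->
    exists h : {linear M -> P}, forall m, g (h m) = f m.

Definition indecomposable (B : nzRingType) (M : lmodType B) : Prop :=
  (exists m : M, m != 0) /\
  forall U V : submodClosed M,
    (forall m, exists u w, [/\ u \in U, w \in V & m = u + w]) ->
    (forall m, m \in U -> m \in V -> m = 0) ->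
    (forall m, m \in U -> m = 0) \/ (forall m, m \in V -> m = 0).

(* A subring of a field, as a ring. *)
Section Subring.
Variables (F : fieldType) (R : subringClosed F).

Record subring : Type := Subring { subring_val : F; subring_valP : subring_val \in R }.

HB.instance Definition _ := [isSub for subring_val].
HB.instance Definition _ := [Choice of subring by <:].
HB.instance Definition _ := [SubChoice_isSubComNzRing of subring by <:].
End Subring.

Section SubringInclusion.
Variables (F : fieldType) (R R' : subringClosed F).
Hypothesis sRR' : {subset R <= R'}.

Definition subring_incl (x : subring R) : subring R' :=
  Sub (val x) (sRR' (valP x)).

Fact subring_incl_zmod_morphism : zmod_morphism subring_incl.
Proof. by move=> x y; apply: val_inj. Qed.

Fact subring_incl_monoid_morphism : monoid_morphism subring_incl.
Proof.
by split=> [|x y]; apply: val_inj.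
Qed.

HB.instance Definition _ := GRing.isZmodMorphism.Build
  (subring R) (subring R') subring_incl subring_incl_zmod_morphism.
HB.instance Definition _ := GRing.isMonoidMorphism.Build
  (subring R) (subring R') subring_incl subring_incl_monoid_morphism.
End SubringInclusion.

(** * Laurent polynomials inside the field of rational functions *)

Notation ratfun C := {fraction {poly C}}.

Section Laurent.
Variable C : fieldType.
Local Notation K := (ratfun C).

Definition rfconst (x : C) : K := FracField.tofrac x%:P.
Definition rfv : K := FracField.tofrac 'X.

Definition zeval (B : nzRingType) (q : B) (p : {poly int}) : B :=
  (map_poly intr p).[q].

(* Z[v, v^-1] *)
Definition laurent_pred : {pred K} :=
  fun x => `[< exists pn : {poly int} * nat,
                 x = zeval rfv pn.1 / rfv ^+ pn.2 >].

Lemma rfv_neq0 : rfv != 0.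
Proof. by rewrite /rfv tofrac_eq0 polyX_eq0. Qed.

Fact laurent_subring_closed : subring_closed laurent_pred.
Proof.
have zM (p q : {poly int}) : zeval rfv (p * q) = zeval rfv p * zeval rfv q.
  by rewrite /zeval rmorphM hornerM.
have zB (p q : {poly int}) : zeval rfv (p - q) = zeval rfv p - zeval rfv q.
  by rewrite /zeval rmorphB hornerD hornerN.
have zX n : zeval rfv 'X^n = rfv ^+ n.
  by rewrite /zeval rmorphXn /= map_polyX hornerXn.
have nz n : rfv ^+ n != 0 by rewrite expf_neq0 ?rfv_neq0.
split=> [|x y /asboolP[[p n] /= ->] /asboolP[[q m] /= ->]|
          x y /asboolP[[p n] /= ->] /asboolP[[q m] /= ->]].
- by apply/asboolP; exists (1, 0%N); rewrite /zeval rmorph1 hornerC expr0 divr1.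
- apply/asboolP; exists (p * 'X^m - q * 'X^n, (n + m)%N) => /=.
  rewrite zB !zM !zX exprD mulrBl invfM; congr (_ - _).
    by rewrite mulrACA divff // mulr1.
  by rewrite [_^-1 * _]mulrC mulrACA divff // mulr1.
- apply/asboolP; exists (p * q, (n + m)%N) => /=.
  by rewrite zM exprD invfM mulrACA.
Qed.

HB.instance Definition _ :=
  GRing.isSubringClosed.Build K laurent_pred laurent_subring_closed.

Local Notation laurent := (subring laurent_pred).

Fact vpow_subproof (k : int) : rfv ^ k \in laurent_pred.
Proof.
apply/asboolP; case: k => n.
  exists ('X^n, 0%N).
  by rewrite /zeval rmorphXn /= map_polyX hornerXn expr0 divr1 exprnP.
exists (1, n.+1).
by rewrite /zeval rmorph1 hornerC mul1r NegzE -exprnN.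
Qed.

Definition vpow (k : int) : laurent := Sub (rfv ^ k) (vpow_subproof k).

(* Some (p, n) with a = p(v) / v^n. *)
Definition lfrac (a : laurent) : {poly int} * nat :=
  xget (0, 0%N)
    [set pn : {poly int} * nat |
       val a = zeval rfv pn.1 / rfv ^+ pn.2]%classic.

(* The coefficient of v^k, independent of the choice in lfrac. *)
Definition lcoef (a : laurent) (k : int) : int :=
  if k + (lfrac a).2%:Z is Posz m then (lfrac a).1`_m else 0.

(* The substitution v := q, for a unit q. *)
Definition leval (B : unitRingType) (q : B) (a : laurent) : B :=
  zeval q (lfrac a).1 / q ^+ (lfrac a).2.

(* v^k Z[v^-1] *)
Definition in_vZ (k : int) (a : laurent) : Prop :=
  exists p : {poly int}, val a = rfv ^ k * zeval rfv^-1 p.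

(* {f / g | f in Z[v, v^-1], g in 1 + v Z[v]} *)
Definition calO : {pred K} :=
  fun x => `[< exists (f : laurent) (p : {poly int}),
                 x = val f / (1 + rfv * zeval rfv p) >].

Lemma laurent_sub_calO : {subset laurent_pred <= calO}.
Proof.
move=> x hx; apply/asboolP; exists (Sub x hx), 0.
by rewrite /zeval rmorph0 horner0 mulr0 addr0 divr1.
Qed.

End Laurent.

Notation laurent C := (subring (@laurent_pred C)).

(** * Coxeter groups; W is the whole of the finite group gT *)

Section Coxeter.
Variables (gT : finGroupType) (S : {set gT}).
Local Open Scope group_scope.

(* S consists of involutions, generates W, and the relations
   (s t)^{#[s * t]} = 1 present W: this is the universal property of the
   presentation, tested against all (possibly infinite) groups. *)
Definition coxeter_system : Prop :=
  [/\ {in S, forall s, #[s] = 2%N},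
      <<S>> = [set: gT] &
      forall (G : groupType) (f : gT -> G),
        {in S &, forall s t, (f s * f t) ^+ #[s * t] = 1} ->
        exists2 F : gT -> G, {morph F : x y / x * y} & {in S, F =1 f}].

(* S ^+ n is the set of products of n elements of S; if S generates W, then
   every element is a product of fewer than #|W| elements of S. *)
Definition len (w : gT) : nat :=
  find (fun n => w \in S ^+ n) (iota 0 #|gT|).

Definition weight_function (L : gT -> int) : Prop :=
  forall w w', len (w * w') = (len w + len w')%N ->
    L (w * w') = (L w + L w')%R.

Definition reflections : {set gT} := class_support S [set: gT].

Definition bruhat_le : rel gT :=
  connect [rel y w | (y^-1 * w \in reflections) && (len y < len w)%N].

Definition bruhat_lt (y w : gT) : bool := (y != w) && bruhat_le y w.

End Coxeter.

(** * The generic Hecke algebra and its Kazhdan-Lusztig basis *)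

Section Hecke.
Variables (C : fieldType) (gT : finGroupType) (S : {set gT}) (L : gT -> int).
Local Notation A := (laurent C).

Record hecke_algebra := HeckeAlgebra {
  hecke_sort :> algType A;
  hT : gT -> hecke_sort;
  hT_basis : is_basis *:%R hT;
  hT1 : hT 1%g = 1;
  hT_up : forall s w, s \in S -> len S (s * w)%g = (len S w).+1 ->
    hT s * hT w = hT (s * w)%g;
  hT_down : forall s w, s \in S -> len S w = (len S (s * w)%g).+1 ->
    hT s * hT w = hT (s * w)%g + (vpow C (L s) - vpow C (- L s)) *: hT w
}.

Record kl_basis (H : hecke_algebra) := KLBasis {
  kl_bar : {rmorphism H -> H};
  kl_barK : involutive kl_bar;
  kl_bar_v : kl_bar (vpow C 1)%:A = (vpow C (-1))%:A;
  kl_bar_T : forall w, kl_bar (hT H w) * hT H w^-1%g = 1 /\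
                       hT H w^-1%g * kl_bar (hT H w) = 1;
  kl_c :> gT -> H;
  kl_c_basis : is_basis *:%R kl_c;
  kl_bar_c : forall w, kl_bar (kl_c w) = kl_c w;
  kl_c_T : forall w, exists2 p : gT -> A, (forall y, in_vZ (-1) (p y)) &
    kl_c w = hT H w + \sum_(y | bruhat_lt S y w) p y *: hT H y
}.

Record dagger_involution (H : hecke_algebra) := DaggerInvolution {
  dag :> {lrmorphism H -> H};
  dagK : involutive dag;
  dag_T : forall s, s \in S ->
    dag (hT H s) * hT H s = -1 /\ hT H s * dag (hT H s) = -1
}.

Section KL.
Variables (H : hecke_algebra) (c : kl_basis H).
Local Open Scope classical_set_scope.
Local Open Scope ring_scope.

Definition klh (x y z : gT) : A := coords c (c x * c y) z.
Definition klp (y w : gT) : A := coords (hT H) (c w) y.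

(* leL y w is y <=_L w *)
Definition leL (y w : gT) : bool :=
  connect [rel w' y' | [exists s in S, klh s w' y' != 0]] w y.
Definition leR (y w : gT) : bool := leL y^-1%g w^-1%g.
Definition leLR (y w : gT) : bool :=
  connect [rel y' w' | leL y' w' || leR y' w'] y w.

Definition simL (y w : gT) : bool := leL y w && leL w y.
Definition simR (y w : gT) : bool := leR y w && leR w y.
Definition simLR (y w : gT) : bool := leLR y w && leLR w y.

Definition left_cell (Gamma : {set gT}) : Prop :=
  exists x, Gamma = finset (simL x).
Definition two_sided_cell (cc : {set gT}) : Prop :=
  exists x, cc = finset (simLR x).

Definition afun (z : gT) : nat :=
  xget 0%N [set n : nat | (forall x y, in_vZ n%:Z (klh x y z)) /\
                          (exists x y, ~ in_vZ (n%:Z - 1) (klh x y z))].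

(* The coefficient of v^{a(z^-1)} in h_{x,y,z^-1}. *)
Definition gam (x y z : gT) : int :=
  lcoef (klh x y z^-1%g) (afun z^-1%g)%:Z.

(* The pair (Delta(z), n_z). *)
Definition Delta_n (z : gT) : nat * int :=
  xget (0%N, 0) [set dn : nat * int |
    dn.2 != 0 /\
    in_vZ (- dn.1%:Z - 1) (klp 1%g z - vpow C (- dn.1%:Z) *~ dn.2)].
Definition Delta (z : gT) : nat := (Delta_n z).1.
Definition nz (z : gT) : int := (Delta_n z).2.

Definition calD : {set gT} := finset (fun z => afun z == Delta z).

End KL.
End Hecke.

(** * Lusztig's properties *)

Section Properties.
Variables (C : fieldType) (gT : finGroupType) (S : {set gT}) (L : gT -> int).
Variables (H : hecke_algebra C S L) (c : kl_basis H).

Local Notation a := (afun c).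
Local Notation D := (calD c).
Local Notation g := (gam c).
Local Notation n_ := (nz c).

Definition P1 : Prop := forall z, (a z <= Delta c z)%N.
Definition P2 : Prop :=
  forall d x y, d \in D -> g x y d != 0 -> x = y^-1%g.
Definition P3 : Prop :=
  forall y, exists! d, d \in D /\ g y^-1%g y d != 0.
Definition P4 : Prop :=
  forall z' z, leLR c z' z -> (a z <= a z')%N.
Definition P5 : Prop :=
  forall d y, d \in D -> g y^-1%g y d != 0 ->
    g y^-1%g y d = n_ d /\ (n_ d = 1 \/ n_ d = -1).
Definition P6 : Prop := forall d, d \in D -> (d ^+ 2 = 1)%g.
Definition P7 : Prop := forall x y z, g x y z = g y z x.
Definition P8 : Prop :=
  forall x y z, g x y z != 0 ->
    [/\ simL c x y^-1%g, simL c y z^-1%g & simL c z x^-1%g].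
Definition P9 : Prop :=
  forall z' z, leL c z' z -> a z' = a z -> simL c z' z.
Definition P10 : Prop :=
  forall z' z, leR c z' z -> a z' = a z -> simR c z' z.
Definition P11 : Prop :=
  forall z' z, leLR c z' z -> a z' = a z -> simLR c z' z.

(* The parabolic subgroup W_I is the group type of elements of <<I>>, with its
   own Hecke algebra and Kazhdan-Lusztig basis. *)
Definition P12 : Prop :=
  forall (I : {set gT}), I \subset S ->
  forall (HI : @hecke_algebra C (subg_of <<I>>%G)
                 (sgval @^-1: I) (fun w => L (sgval w)))
         (cI : kl_basis HI) (y : subg_of <<I>>%G),
    afun cI y = a (sgval y).

Definition P13 : Prop :=
  forall Gamma : {set gT}, left_cell c Gamma ->
    exists d, [/\ d \in D :&: Gamma,
                  (forall d', d' \in D :&: Gamma -> d' = d) &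
                  (forall x, x \in Gamma -> g x^-1%g x d != 0)].
Definition P14 : Prop := forall z, simLR c z z^-1%g.

(* An identity in Z[v, v^-1, v', v'^-1], seen inside C(v)(v'). *)
Definition P15 : Prop :=
  let h x y z : ratfun (ratfun C) := rfconst (val (klh c x y z)) in
  let h' x y z : ratfun (ratfun C) :=
    leval (rfv (ratfun C)) (klh c x y z) in
  forall x x' w y, a w = a y ->
    \sum_y' h' w x' y' * h x y' y = \sum_y' h x w y' * h' y' x' y.

Definition P1_15 : Prop :=
  [/\ [/\ P1, P2, P3, P4 & P5], [/\ P6, P7, P8, P9 & P10] &
      [/\ P11, P12, P13, P14 & P15]].

End Properties.

(** * Extension of scalars and left cell modules *)

Section Extension.
Variables (C : fieldType) (gT : finGroupType) (S : {set gT}) (L : gT -> int).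
Variable H : hecke_algebra C S L.

(* B (x)_A H along theta : A -> B; since H is free over A on the T_w, this is
   the B-algebra, with a semilinear ring morphism from H, that is free over B
   on the images of the T_w. *)
Record scalar_extension (B : comNzRingType)
    (theta : {rmorphism laurent C -> B}) := ScalarExtension {
  ext_sort :> algType B;
  ext_in : {rmorphism H -> ext_sort};
  ext_inZ : forall a h, ext_in (a *: h) = theta a *: ext_in h;
  ext_basis : is_basis *:%R (fun w => ext_in (hT H w))
}.

Variables (c : kl_basis H) (dg : dagger_involution H).

(* [Gamma]_B, as a module over B (x)_A H; B acts through the scalars. *)
Record cell_module (Gamma : {set gT}) (B : comNzRingType)
    (theta : {rmorphism laurent C -> B}) (HB : scalar_extension theta) :=
  CellModule {
  cell_sort :> lmodType HB;
  cell_c : {y : gT | y \in Gamma} -> cell_sort;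
  cell_basis : is_basis (fun (r : B) m => (r%:A : HB) *: m) cell_c;
  cell_act : forall x (y : {y : gT | y \in Gamma}),
    ext_in HB (dg (c x)) *: cell_c y =
    \sum_z ((theta (klh c x (val y) (val z)))%:A : HB) *: cell_c z
}.

End Extension.

(** * The ring J and the modules E_spade *)

Section Jring.
Variables (C : numClosedFieldType) (gT : finGroupType) (S : {set gT}).
Variables (L : gT -> int) (H : hecke_algebra C S L).
Variables (c : kl_basis H) (dg : dagger_involution H).

Local Notation a := (afun c).
Local Notation D := (calD c).

(* n_d for the unique d in D with d ~_L z^-1 *)
Definition nhat (z : gT) : int :=
  oapp (nz c) 0 [pick d | (d \in D) && simL c d z^-1%g].

(* phi : H -> A (x) J, where an element of A (x) J is given by its
   coordinates in the basis t_z. *)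
Definition phi_cdag (w : gT) : {ffun gT -> laurent C} :=
  [ffun z => \sum_(d in D | a z == a d) klh c w d z *~ nhat z].

Definition phi (x : H) : {ffun gT -> laurent C} :=
  let b w := dg (c w) in
  \sum_w [ffun z => coords b x w * phi_cdag w z].

(* C[W] and J_C, by coordinates in the bases w and t_w. *)
Definition CW := {ffun gT -> C^o}.
Definition JC := {ffun gT -> C^o}.

(* phi at v = 1; T_w specializes to w *)
Definition phi1 (u : CW) : JC :=
  [ffun z => \sum_w u w * leval (1 : C) (phi (hT H w) z)].

Definition phi1_inv : JC -> CW := fun j => ((linfun phi1)^-1)%VF j.

(* The multiplication of J_C *)
Definition Jmul (j k : JC) : JC :=
  [ffun z => \sum_x \sum_y j x * k y * (gam c x y z^-1%g)%:~R].

(* The operator by which j acts on E_spade. *)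
Definition spade n (rE : mx_representation C [set: gT] n) (j : JC) : 'M[C]_n :=
  \sum_w phi1_inv j w *: rE w.

Definition t_cell (cc : {set gT}) : JC :=
  [ffun d => if d \in D :&: cc then (nz c d)%:~R else 0].

(* Irr(W) *)
Definition IrrW : irrType C [set: gT] := DecSocleType (regular_repr C [set: gT]).

(* E belongs to Irr(W, cc) *)
Definition Irr_in (cc : {set gT}) (E : IrrW) : bool :=
  spade (irr_repr E) (t_cell cc) != 0.

End Jring.

(** * The simple H_K-modules E_v and the numbers f_E *)

(* A finite dimensional left module over the K-algebra B, in matrix form: B
   acts on column vectors. *)
Section MatrixModules.
Variables (K : fieldType) (B : algType K).

Definition mx_module_of n (rho : B -> 'M[K]_n) : Prop :=
  [/\ linear rho, rho 1 = 1%:M & {morph rho : x y / x * y >-> x *m y}].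

(* The subspaces of columns are the row spaces of transposed matrices. *)
Definition mx_simple_module n (rho : B -> 'M[K]_n) : Prop :=
  [/\ mx_module_of rho, (0 < n)%N &
      forall U : 'M[K]_n, (forall x, stablemx U (rho x)^T) ->
        U != 0 -> row_full U].

Definition mx_isomorphic m n (rho : B -> 'M[K]_m) (sig : B -> 'M[K]_n) : Prop :=
  exists2 P : 'M[K]_(m, n), row_free P && row_full P &
    forall x, rho x *m P = P *m sig x.
End MatrixModules.

Section SchurElements.
Variables (C : numClosedFieldType) (gT : finGroupType) (S : {set gT}).
Variables (L : gT -> int) (H : hecke_algebra C S L).
Local Notation K := (ratfun C).
Local Notation v := (rfv C).
Local Notation Irr := (IrrW C gT).
Variable HK : scalar_extension H (val : laurent C -> K).

(* The bijection E |-> E_v. *)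
Record generic_modules := GenericModules {
  gdim : Irr -> nat;
  gmod : forall E, HK -> 'M[K]_(gdim E);
  gmod_simple : forall E, mx_simple_module (gmod E);
  gmod_inj : forall E E', mx_isomorphic (gmod E) (gmod E') -> E = E';
  gmod_surj : forall n (rho : HK -> 'M[K]_n), mx_simple_module rho ->
    exists E, mx_isomorphic rho (gmod E);
  gmod_spec : forall E w, exists (p : {poly C}) (n : nat),
    \tr (gmod E (ext_in HK (hT H w))) = FracField.tofrac p / v ^+ n /\
    p.[1] = \tr (irr_repr E w)
}.

Variable Ev : generic_modules.

Definition chi_v (E : Irr) (w : gT) : K := \tr (gmod Ev E (ext_in HK (hT H w))).

Definition in_Cpoly (x : K) : Prop := exists p : {poly C}, x = FracField.tofrac p.

Definition a_E (E : Irr) : nat :=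
  xget 0%N [set n : nat |
    (forall w, in_Cpoly (v ^ n%:Z * chi_v E w)) /\
    (exists w, ~ in_Cpoly (v ^ (n%:Z - 1) * chi_v E w))]%classic.

Definition c_E (E : Irr) : K :=
  (irr_degree E)%:R^-1 * \sum_w chi_v E w * chi_v E w^-1%g.

(* c_E = f_E v^{-2 a_E} + combination of higher powers of v *)
Definition f_E (E : Irr) : C :=
  xget 0 [set f : C | exists p : {poly C},
    c_E E = v ^ (- (2 * a_E E)%:Z) * (rfconst f + v * FracField.tofrac p)]%classic.

Definition adapted (c : kl_basis H) (dg : dagger_involution H)
    (cc : {set gT}) (R : {pred K}) : Prop :=
  forall n : Irr -> int,
    let x := \sum_(E | Irr_in c dg cc E) (n E)%:~R / f_E E in
    rfconst x \in R -> exists m : int, x = m%:~R.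

End SchurElements.

(* Main.v *)
(** The a-function filters [H], and comparing the coefficients of [v'^(a y)] in
    (P15) shows that the action of [c_x] on the associated graded module commutes
    with the right multiplications by [J].  This gives an algebra homomorphism
    from [H] to [A (x) J] (Lusztig's, up to signs).  In the bases [c_x] and
    [t_z], rescaled by [v^(a z)], its matrix is the identity modulo [v Z[v]], so
    that it is invertible over every ring containing [O]: [H_R] is isomorphic to
    [J_R], and [[Gamma]_R] becomes the direct summand [J_R t_d] spanned by the [t_y], [y] in
    [Gamma], where [d] is the element of [D] in [Gamma].  Hence projectivity.

    A decomposition of [[Gamma]_R] writes [n_d t_d] as a sum [p + q] of two
    idempotents of [J_R].  The trace [tau (t_z) = n_z] if [z] is in [D], and [0]
    otherwise, makes [J] a symmetric algebra with dual bases [t_z], [t_(z^-1)].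
    The Schur element of [E_spade] is positive, as the representation of [J] on
    [E_spade] is a *-representation for a suitable inner product, and it equals
    [f_E], by reduction modulo [v].  Therefore [tau p] is the sum of the
    [rank_E p / f_E], with [E] in [Irr (W, c)]; since [R] is adapted it is a
    nonnegative integer, and it vanishes only if [p = 0].  As
    [tau p + tau q = 1], one of the two idempotents is zero. *)

Require Import Defs.
From HB Require Import structures.
From mathcomp Require Import all_boot all_order all_algebra all_fingroup.
From mathcomp Require Import boolp classical_sets reals.
From mathcomp.real_closed Require Import complex.
From mathcomp Require Import pgroup mxrepresentation.

Set Implicit Arguments.
Unset Strict Implicit.
Unset Printing Implicit Defensive.

Import Order.TTheory GRing.Theory Num.Theory.
Local Open Scope ring_scope.

(** * Laurent polynomials *)

(** The homomorphism [psi] that comes naturally from (P15) is not the [phi] of the statement: they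
    differ by the automorphism [t_z |-> jsign z t_z]. [E_spade] is therefore reached through
    [jtwist], and these signs have to cancel in [f_E]. The congruence with the identity modulo [v]
    has two sources: bar-invariance of [h_{x,y,z}] copies its leading coefficient to the lowest
    power [v^(- a z)], and the unit of [J] is the sum of the [n_d t_d]. An idempotent [p] has
    coefficients in [R], not in [C]. It is studied over [C(v)], where its trace in each extended
    [E_spade] is still a rank; as [tau] is a combination of these characters with coefficients in
    [C], [tau p] lies both in [R] and in the group that adaptedness controls. The given bijection
    between [E] and [E_v] does not mention [J]. The two are matched by showing that [E_spade],
    extended to [C(v)] and pulled back to [H_K], is simple and has the character of [E] at
    [v = 1]. *)

Section IntegerPolynomialEvaluation.
Variable B : comNzRingType.
Implicit Types (q : B) (p : {poly int}).

Fact zeval_is_zmod_morphism q : zmod_morphism (zeval q).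
Proof. by move=> p1 p2; rewrite /zeval rmorphB hornerD hornerN. Qed.

Fact zeval_is_monoid_morphism q : monoid_morphism (zeval q).
Proof.
by split=> [|p1 p2]; rewrite /zeval ?rmorph1 ?hornerC // rmorphM hornerM.
Qed.

HB.instance Definition _ q := GRing.isZmodMorphism.Build
  {poly int} B (zeval q) (zeval_is_zmod_morphism q).
HB.instance Definition _ q := GRing.isMonoidMorphism.Build
  {poly int} B (zeval q) (zeval_is_monoid_morphism q).

Lemma zevalC q (c : int) : zeval q c%:P = c%:~R.
Proof. by rewrite /zeval map_polyC hornerC. Qed.

Lemma zevalX q : zeval q 'X = q.
Proof. by rewrite /zeval map_polyX hornerX. Qed.

Lemma zevalXn q n : zeval q 'X^n = q ^+ n.
Proof. by rewrite rmorphXn /= zevalX. Qed.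

Lemma zevalE q p n : (size p <= n)%N ->
  zeval q p = \sum_(i < n) q ^+ i *~ p`_i.
Proof.
move=> le_pn; rewrite /zeval (@horner_coef_wide _ n).
  by apply: eq_bigr => i _; rewrite coef_map /= mulrzl.
exact: leq_trans (size_poly _ _) le_pn.
Qed.

End IntegerPolynomialEvaluation.

Lemma rmorph_zeval (B B' : comNzRingType) (f : {rmorphism B -> B'}) q p :
  f (zeval q p) = zeval (f q) p.
Proof.
rewrite !(@zevalE _ _ _ (size p)) // rmorph_sum; apply: eq_bigr => i _.
by rewrite rmorphMz rmorphXn.
Qed.

Lemma zeval_polyX (B : comNzRingType) p :
  zeval ('X : {poly B}) p = map_poly intr p.
Proof.
rewrite (@zevalE _ _ _ (size p)) // /map_poly poly_def.
by apply: eq_bigr => i _; rewrite scaler_int.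
Qed.

Section LaurentPolynomials.
Variable C : numClosedFieldType.
Local Notation K := (ratfun C).
Local Notation A := (laurent C).
Local Notation vp := (vpow C).

Lemma vpowD i j : vp (i + j) = vp i * vp j.
Proof. by apply: val_inj; rewrite /= expfzDr ?rfv_neq0. Qed.

Lemma vpow0 : vp 0 = 1.
Proof. exact: val_inj. Qed.

Lemma vpowVr i : vp i * vp (- i) = 1.
Proof. by rewrite -vpowD subrr vpow0. Qed.

Lemma vpowNr i : vp (- i) * vp i = 1.
Proof. by rewrite -vpowD addNr vpow0. Qed.

Lemma vpow_nat (n : nat) : vp n%:Z = vp 1 ^+ n.
Proof. by elim: n => [|n IH]; rewrite ?vpow0 // intS vpowD IH exprS. Qed.

Lemma val_zeval (p : {poly int}) : val (zeval (vp 1) p) = zeval (rfv C) p.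
Proof. exact: (@rmorph_zeval A K val). Qed.

Lemma zeval_rfv (p : {poly int}) :
  zeval (rfv C) p = FracField.tofrac (map_poly intr p).
Proof. by rewrite -zeval_polyX rmorph_zeval. Qed.

Lemma zeval_rfv_inj : injective (@zeval K (rfv C)).
Proof.
move=> p q; rewrite !zeval_rfv => /eqP; rewrite tofrac_eq => /eqP pq.
apply/polyP => i; apply: (@intr_inj C).
by move/polyP: pq => /(_ i); rewrite !coef_map.
Qed.

Lemma laurent_lfrac (a : A) :
  a = zeval (vp 1) (lfrac a).1 * vp (- (lfrac a).2%:Z).
Proof.
apply: val_inj; rewrite rmorphM /= val_zeval -exprnN.
rewrite /lfrac; case: xgetP => [pn _ //|]; case: a => x hx /=.
by case/asboolP: (hx) => pn e /(_ pn); case.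
Qed.

Lemma laurentP (a : A) :
  exists p n, a = zeval (vp 1) p * vp (- n%:Z).
Proof. by exists (lfrac a).1, (lfrac a).2; exact: laurent_lfrac. Qed.

(** Cross-multiplication, valid because evaluation at [v] is injective on integer polynomials. It
    makes [lcoef] and [leval] computable from any fraction, whatever [lfrac] has chosen. *)
Lemma lfrac_uniq p n :
  let a := zeval (vp 1) p * vp (- n%:Z) in
  p * 'X^((lfrac a).2) = (lfrac a).1 * 'X^n.
Proof.
move=> a; have := laurent_lfrac a; set p' := _.1; set n' := _.2.
rewrite {1}/a => e; apply: zeval_rfv_inj; rewrite -!val_zeval; congr (val _).
rewrite !rmorphM /= !zevalXn -!vpow_nat.
transitivity (zeval (vp 1) p * vp (- n%:Z) * vp n * vp n').
  by rewrite -(mulrA (zeval _ _)) vpowNr mulr1.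
by rewrite e mulrAC -(mulrA (zeval _ _)) vpowNr mulr1.
Qed.

Lemma lcoefE p n k :
  lcoef (zeval (vp 1) p * vp (- n%:Z)) k = if k + n%:Z is Posz m then p`_m else 0.
Proof.
have := lfrac_uniq p n; set a := _ * _ => /= e.
rewrite /lcoef; move: e; case: (lfrac a) => p' n' /= e.
have co m : (if (m < n')%N then 0 else p`_(m - n')) = if (m < n)%N then 0 else p'`_(m - n).
  by rewrite -!coefMXn e.
case e1: (k + n'%:Z) => [m'|m']; case e2: (k + n%:Z) => [m|m] //.
- have := co (m + n')%N; rewrite ltnNge leq_addl /= addnK => ->.
  have -> : (m + n' = m' + n)%N.
    by apply/eqP; rewrite -eqz_nat !PoszD -e1 -e2 addrAC.
  by rewrite ltnNge leq_addl addnK.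
- have := co (m' + n)%N; rewrite [in RHS]ltnNge leq_addl /= addnK => <-.
  suff -> : (m' + n < n')%N by [].
  by rewrite -ltz_nat PoszD -e1 addrAC e2 NegzE gtrDr oppr_lt0.
- have := co (m + n')%N; rewrite ltnNge leq_addl /= addnK => ->.
  suff -> : (m + n' < n)%N by [].
  by rewrite -ltz_nat PoszD -e2 addrAC e1 NegzE gtrDr oppr_lt0.
Qed.

(** Over one denominator, additive claims reduce to numerators; with [I := bool] this serves for the
    sum or difference of two elements. *)
Lemma laurent_common_denominator (I : finType) (a : I -> A) :
  exists n p, forall i, a i = zeval (vp 1) (p i) * vp (- n%:Z).
Proof.
pose N := \max_i (lfrac (a i)).2.
exists N, (fun i => (lfrac (a i)).1 * 'X^(N - (lfrac (a i)).2)) => i.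
rewrite {1}(laurent_lfrac (a i)) rmorphM /= zevalXn -vpow_nat -mulrA -vpowD.
congr (_ * vp _); have /subzn <- : ((lfrac (a i)).2 <= N)%N := leq_bigmax i.
by rewrite addrAC subrr add0r.
Qed.

Lemma lcoef_is_zmod_morphism k : zmod_morphism (fun a : A => lcoef a k).
Proof.
move=> a b; have [n [p hp]] := laurent_common_denominator (fun x : bool => if x then a else b).
rewrite (hp true) (hp false) -mulrBl -rmorphB /= !lcoefE.
by case: (k + n%:Z) => m; rewrite ?coefB ?subr0.
Qed.

Definition lcoefk (k : int) (a : A) := lcoef a k.

HB.instance Definition _ k := GRing.isZmodMorphism.Build
  A int (lcoefk k) (lcoef_is_zmod_morphism k).

Lemma lcoef0 k : lcoef (0 : A) k = 0. Proof. exact: (raddf0 (lcoefk k)). Qed.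
Lemma lcoefD k : {morph (fun a : A => lcoef a k) : a b / a + b}.
Proof. exact: (raddfD (lcoefk k)). Qed.
Lemma lcoefB k : {morph (fun a : A => lcoef a k) : a b / a - b}.
Proof. exact: (raddfB (lcoefk k)). Qed.
Lemma lcoef_sum k (I : Type) (r : seq I) (P : pred I) (F : I -> A) :
  lcoef (\sum_(i <- r | P i) F i) k = \sum_(i <- r | P i) lcoef (F i) k.
Proof. exact: (raddf_sum (lcoefk k)). Qed.
Lemma lcoefMz (a : A) (m : int) k : lcoef (a *~ m) k = lcoef a k * m.
Proof. by rewrite -[RHS]mulrzz; exact: (raddfMz (lcoefk k)). Qed.

Lemma lcoef_eq (a b : A) : (forall k, lcoef a k = lcoef b k) -> a = b.
Proof.
have [n [p hp]] := laurent_common_denominator (fun x : bool => if x then a else b).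
rewrite (hp true) (hp false) => e; congr (zeval _ _ * _); apply/polyP => m.
by have := e (m%:Z - n%:Z); rewrite !lcoefE subrK.
Qed.

Lemma lcoef_shift (a : A) i k : lcoef (a * vp i) k = lcoef a (k - i).
Proof.
have [p [n ->]] := laurentP a.
case: i => i; rewrite ?NegzE -mulrA -vpowD.
  rewrite (_ : zeval _ p * vp (- n%:Z + i%:Z) = zeval (vp 1) (p * 'X^i) * vp (- n%:Z)); last first.
    by rewrite rmorphM /= zevalXn -vpow_nat -mulrA -vpowD [i%:Z + _]addrC.
  rewrite !lcoefE (addrAC k); case: (k + n) => [m|m].
    rewrite coefMXn; case: ltnP => [lt_mi|le_im]; last by rewrite subzn.
    rewrite (_ : m%:Z - i%:Z = Negz (i - m).-1) // NegzE prednK ?subn_gt0 //.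
    by rewrite -subzn 1?ltnW // opprB.
  by rewrite NegzE -opprD.
by rewrite -opprD -PoszD !lcoefE opprK PoszD addrA addrAC.
Qed.

Lemma lcoef_vpow i k : lcoef (vp i) k = (k == i)%:R.
Proof.
have E : 1 = zeval (vp 1) 1 * vp (- 0%:Z) by rewrite rmorph1 oppr0 vpow0 mulr1.
rewrite -[vp i]mul1r lcoef_shift E lcoefE addr0 -(subr_eq0 k).
by case: (k - i) => m //; rewrite coef1 eqz_nat.
Qed.

Lemma vpowN_nat (n : nat) : vp (- n%:Z) = vp (- 1) ^+ n.
Proof.
elim: n => [|n IH]; first by rewrite oppr0 vpow0.
by rewrite exprS -IH -vpowD -opprD -intS.
Qed.

Lemma lcoef_zevalV p k j :
  lcoef (vp k * zeval (vp (- 1)) p) j = if k - j is Posz m then p`_m else 0.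
Proof.
rewrite (@zevalE _ _ p (size p)) // mulr_sumr lcoef_sum.
under eq_bigr => i _.
  rewrite mulrzAr -vpowN_nat -vpowD lcoefMz lcoef_vpow mulr_natl mulrb.
  rewrite (_ : (j == k - i%:Z) = (k - j == i%:Z)); last first.
    by rewrite eq_sym !subr_eq addrC.
  over.
case: (k - j) => m; last by rewrite big1.
under eq_bigr => i _ do rewrite eqz_nat.
case: (ltnP m (size p)) => [ltm|lem].
  rewrite (bigD1 (Ordinal ltm)) //= eqxx big1 ?addr0 // => i.
  by rewrite -val_eqE /= eq_sym => /negPf ->.
rewrite nth_default // big1 // => i _.
by rewrite gtn_eqF // (leq_trans (ltn_ord i)).
Qed.

Lemma in_vZ_zeval k (a : A) :
  in_vZ k a <-> exists p, a = vp k * zeval (vp (- 1)) p.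
Proof.
have valz p : val (zeval (vp (- 1)) p) = zeval (rfv C)^-1 p.
  by rewrite -[(rfv C)^-1](exprN1 (rfv C)); exact: (@rmorph_zeval A K val).
split=> -[p e]; exists p; first by apply: val_inj; rewrite e rmorphM /= valz.
by rewrite e rmorphM /= valz.
Qed.

Lemma in_vZP k (a : A) : in_vZ k a <-> forall j, k < j -> lcoef a j = 0.
Proof.
rewrite in_vZ_zeval; split=> [[p ->] j lt_kj|e].
  by rewrite lcoef_zevalV; move: lt_kj; rewrite -subr_lt0; case: (k - j).
have [p0 [n def_a]] := laurentP a.
have low j : j + n%:Z < 0 -> lcoef a j = 0.
  by rewrite def_a lcoefE; case: (j + n%:Z).
(* Coefficients of [a] vanish below [-n], so only indices [i <= k + n] can contribute, and [|k| + n]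
   bounds them by a natural number. *)
exists (\poly_(i < (`|k| + n).+1) lcoef a (k - i%:Z)); apply: lcoef_eq => j.
rewrite lcoef_zevalV; case Ekj: (k - j) => [m|m]; last first.
  by apply: e; rewrite -subr_lt0 Ekj.
have Ej: k - m%:Z = j by rewrite -Ekj opprB addrC subrK.
rewrite coef_poly Ej; case: ltnP => // le_m; apply: low.
rewrite -Ej addrAC subr_lt0; apply: (@le_lt_trans _ _ (`|k|%N + n)%:Z).
  by rewrite PoszD lerD2r abszE ler_norm.
by rewrite ltz_nat.
Qed.

Lemma in_vZ_le i j (a : A) : i <= j -> in_vZ i a -> in_vZ j a.
Proof.
by move=> le_ij /in_vZP h; apply/in_vZP => k lt_jk; apply/h/(le_lt_trans le_ij).
Qed.

Lemma in_vZ0 k : in_vZ k (0 : A).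
Proof. by apply/in_vZP => j _; rewrite lcoef0. Qed.

Lemma in_vZD k (a b : A) : in_vZ k a -> in_vZ k b -> in_vZ k (a + b).
Proof.
by move=> /in_vZP ha /in_vZP hb; apply/in_vZP => j lt_kj; rewrite lcoefD ha ?hb.
Qed.

Lemma in_vZN k (a : A) : in_vZ k a -> in_vZ k (- a).
Proof.
by move=> /in_vZP ha; apply/in_vZP => j lt_kj; rewrite -sub0r lcoefB lcoef0 ha.
Qed.

Lemma in_vZ_sum k (I : Type) (r : seq I) (P : pred I) (F : I -> A) :
  (forall i, P i -> in_vZ k (F i)) -> in_vZ k (\sum_(i <- r | P i) F i).
Proof.
by move=> h; elim/big_rec: _ => [|i x Pi IH]; [exact: in_vZ0 | apply: in_vZD; auto].
Qed.

Lemma in_vZM i j (a b : A) :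
  in_vZ i a -> in_vZ j b -> in_vZ (i + j) (a * b).
Proof.
move=> /in_vZ_zeval[p ->] /in_vZ_zeval[q ->]; apply/in_vZ_zeval; exists (p * q).
by rewrite mulrACA vpowD rmorphM.
Qed.

Definition lbar (a : A) : A :=
  zeval (vp (- 1)) (lfrac a).1 * vp (lfrac a).2%:Z.

Lemma lcoef_lbar (a : A) k : lcoef (lbar a) k = lcoef a (- k).
Proof.
rewrite {2}(laurent_lfrac a) /lbar mulrC lcoef_zevalV lcoefE.
by rewrite [- k + _]addrC.
Qed.

Lemma lbar_is_zmod_morphism : zmod_morphism lbar.
Proof.
by move=> a b; apply: lcoef_eq => k; rewrite lcoefB !lcoef_lbar lcoefB.
Qed.

HB.instance Definition _ := GRing.isZmodMorphism.Build A A lbar lbar_is_zmod_morphism.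

Lemma lbar_vpow i : lbar (vp i) = vp (- i).
Proof. by apply: lcoef_eq => k; rewrite lcoef_lbar !lcoef_vpow eqr_oppLR. Qed.

Lemma lbarE p n : lbar (zeval (vp 1) p * vp (- n%:Z)) = zeval (vp (- 1)) p * vp n%:Z.
Proof.
by apply: lcoef_eq => k; rewrite lcoef_lbar lcoefE mulrC lcoef_zevalV addrC.
Qed.

Lemma lbarM : {morph lbar : a b / a * b}.
Proof.
move=> a b; have [p [n ->]] := laurentP a; have [q [m ->]] := laurentP b.
rewrite mulrACA -rmorphM -vpowD -opprD -PoszD !lbarE rmorphM /= PoszD vpowD.
by rewrite mulrACA.
Qed.

Lemma lbar1 : lbar 1 = 1.
Proof. by rewrite -vpow0 lbar_vpow oppr0. Qed.

HB.instance Definition _ := GRing.isMonoidMorphism.Build A A lbar (conj lbar1 lbarM).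

(** The coefficients are symmetric about 0, and those of nonnegative degree vanish. This is the
    uniqueness principle behind the Kazhdan-Lusztig basis. *)
Lemma lbar_eq0_in_vZ (a : A) : lbar a = a -> in_vZ (-1) a -> a = 0.
Proof.
move=> ba /in_vZP h; apply: lcoef_eq => k; rewrite lcoef0.
case: (ltP (-1) k) => [/h // | le_k].
by rewrite -ba lcoef_lbar h // ltrNr opprK (le_lt_trans le_k).
Qed.

(** * Substituting a unit for [v], and reading off coefficients of [v] *)

Section Evaluation.
Variables (B : comUnitRingType) (q : B).
Hypothesis uq : q \is a GRing.unit.

Lemma levalE p n : leval q (zeval (vp 1) p * vp (- n%:Z)) = zeval q p / q ^+ n.
Proof.
have := lfrac_uniq p n => /=; rewrite /leval; case: (lfrac _) => p' n' /= e.
have := congr1 (zeval q) e; rewrite !rmorphM /= !zevalXn => {}e.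
apply: (mulIr (unitrX (n' + n)%N uq)).
rewrite exprD [LHS]mulrA [q ^+ n' * _]mulrC [RHS]mulrA !divrK ?unitrX //.
Qed.

Lemma leval_is_zmod_morphism : zmod_morphism (leval q : A -> B).
Proof.
move=> a b; have [n [p hp]] := laurent_common_denominator (fun x : bool => if x then a else b).
by rewrite (hp true) (hp false) -mulrBl -rmorphB /= !levalE rmorphB mulrBl.
Qed.

Lemma leval_vpow1 : leval q (vp 1) = q.
Proof.
have -> : vp 1 = zeval (vp 1) 'X * vp (- 0%:Z) by rewrite oppr0 vpow0 mulr1 zevalX.
by rewrite levalE zevalX divr1.
Qed.

Lemma leval_is_monoid_morphism : monoid_morphism (leval q : A -> B).
Proof.
split=> [|a b].
  have -> : 1 = zeval (vp 1) 1 * vp (- 0%:Z) by rewrite oppr0 vpow0 mulr1 rmorph1.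
  by rewrite levalE rmorph1 divr1.
have [p [n ->]] := laurentP a; have [p' [m ->]] := laurentP b.
rewrite mulrACA -rmorphM -vpowD -opprD -PoszD /= !levalE rmorphM /=.
by rewrite exprD invrM ?unitrX // [(q ^+ m)^-1 * _]mulrC mulrACA.
Qed.

End Evaluation.

(** The indeterminate of [F(v')] is transcendental over [F], so a relation splits into its
    coefficients. With [F = C(v)], this is how a power of [v'] is isolated in (P15). *)
Lemma leval_coef_eq0 (F : fieldType) (I : finType) (x : I -> F) (a : I -> A) :
  \sum_i rfconst (x i) * leval (rfv F) (a i) = 0 ->
  forall k, \sum_i x i * (lcoef (a i) k)%:~R = 0.
Proof.
have [n [p hp]] := laurent_common_denominator a.
have u : rfv F \is a GRing.unit by rewrite unitfE rfv_neq0.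
have zf r : zeval (rfv F) r = FracField.tofrac (map_poly intr r).
  by rewrite -zeval_polyX rmorph_zeval.
move=> e k; have e1 : \sum_i (x i)%:P * map_poly intr (p i) = 0.
  apply/eqP; rewrite -tofrac_eq0 rmorph_sum /=; apply/eqP.
  transitivity ((\sum_i rfconst (x i) * leval (rfv F) (a i)) * rfv F ^+ n); last by rewrite e mul0r.
  rewrite mulr_suml; apply: eq_bigr => i _; rewrite rmorphM /= hp levalE // zf.
  by rewrite -mulrA divrK ?unitrX.
under eq_bigr => i _ do rewrite hp lcoefE.
case: (k + n%:Z) => m; last by apply: big1 => i _; rewrite mulr0.
have := congr1 (fun r : {poly F} => r`_m) e1; rewrite coef0 coef_sum => h; rewrite -[RHS]h.
by apply: eq_bigr => i _; rewrite coefCM coef_map.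
Qed.

Lemma leval_coef_eq (F : fieldType) (I : finType) (x y : I -> F) (a b : I -> A) :
  \sum_i rfconst (x i) * leval (rfv F) (a i) =
  \sum_i rfconst (y i) * leval (rfv F) (b i) ->
  forall k, \sum_i x i * (lcoef (a i) k)%:~R = \sum_i y i * (lcoef (b i) k)%:~R.
Proof.
move=> e k; apply/eqP; rewrite -subr_eq0 -sumrN -big_split.
pose X (i : I + I) := match i with inl i => x i | inr i => - y i end.
pose Y (i : I + I) := match i with inl i => a i | inr i => b i end.
have := @leval_coef_eq0 F (I + I)%type X Y; rewrite !big_sumType /= e -big_split /=.
rewrite big1 => [/(_ erefl k)|i _]; last by rewrite /rfconst !rmorphN mulNr subrr.
rewrite big_sumType /= -big_split => h; rewrite -[X in _ == X]h.
by apply/eqP/eq_bigr => i _; rewrite mulNr.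
Qed.
End LaurentPolynomials.

(** * Length in a Coxeter group *)

Section CoxeterLength.
Variables (gT : finGroupType) (S : {set gT}).
Hypothesis coxS : coxeter_system S.
Local Open Scope group_scope.
Local Notation len := (len S).
Implicit Types s t u w x y z : gT.

Lemma coxeter_inv s : s \in S -> s^-1 = s.
Proof.
case: coxS => inv_S _ _ /inv_S os; apply/eqP; rewrite eq_invg_mul -expg2.
by rewrite -os expg_order.
Qed.

Lemma coxeterK s w : s \in S -> s * (s * w) = w.
Proof. by move=> /coxeter_inv sV; rewrite mulgA -{1}sV mulVg mul1g. Qed.

Let exists_word w : exists n, w \in S ^+ n.
Proof.
case: coxS => _ genS _; have := finset.in_setT w; rewrite -genS.
have [n ->] := gen_expgs S; elim: n w => [|n IH] w; first by exists 0%N.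
rewrite expgS => /mulsgP[x y /setU1P[-> | Sx] /IH[k Sy] ->].
  by exists k; rewrite mul1g.
by exists k.+1; rewrite expgS mem_mulg.
Qed.

(** Minimal word length without the search bound [#|W|] built into [len]; [lenE] identifies the
    two. *)
Let wl w := ex_minn (exists_word w).

Let wl_mem w : w \in S ^+ wl w.
Proof. by rewrite /wl; case: ex_minnP. Qed.

Let wl_min w n : w \in S ^+ n -> (wl w <= n)%N.
Proof. by rewrite /wl; case: ex_minnP => m _ h /h. Qed.

(* A shortest word passes through elements of every smaller length, so
   lengths are smaller than #|W|. *)
Let wl_lt w : (wl w < #|gT|)%N.
Proof.
have down k : (k <= wl w)%N -> exists u, wl u = (wl w - k)%N.
  elim: k => [|k IH] lek; first by exists w; rewrite subn0.
  have [u eu] := IH (ltnW lek); have := wl_mem u.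
  rewrite eu -subnSK // expgS => /mulsgP[s y Ss Sy def_u]; exists y.
  apply/eqP; rewrite eqn_leq wl_min //= -ltnS subnSK // -eu.
  by apply: wl_min; rewrite def_u expgS mem_mulg ?wl_mem.
have sub : {subset iota 0 (wl w).+1 <= [seq wl u | u <- enum gT]}.
  move=> k; rewrite mem_iota add0n ltnS => lek.
  have [u eu] := down (wl w - k)%N (leq_subr _ _).
  by apply/mapP; exists u; rewrite ?mem_enum // eu subKn.
by have := uniq_leq_size (iota_uniq _ _) sub; rewrite size_iota size_map -cardE.
Qed.

Let lenE w : len w = wl w.
Proof.
rewrite /Defs.len; set a := (fun n : nat => _).
have ha : has a (iota 0 #|gT|).
  by apply/hasP; exists (wl w); [rewrite mem_iota add0n wl_lt | exact: wl_mem].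
have lt := ha; rewrite has_find size_iota in lt.
apply/eqP; rewrite eqn_leq wl_min ?andbT; last first.
  by have := nth_find 0%N ha; rewrite {1}/a nth_iota.
rewrite leqNgt; apply/negP => /(before_find 0%N).
by rewrite {1}/a nth_iota ?wl_lt // add0n wl_mem.
Qed.

Lemma len_mem w : w \in S ^+ len w. Proof. by rewrite lenE. Qed.

Lemma len_min w n : w \in S ^+ n -> (len w <= n)%N.
Proof. by rewrite lenE; apply: wl_min. Qed.

Lemma len1 : len 1 = 0%N.
Proof. by apply/eqP; rewrite -leqn0 len_min // expg0 set11. Qed.

Lemma len_eq0 w : (len w == 0%N) = (w == 1).
Proof.
apply/eqP/eqP => [e|->]; last exact: len1.
by have := len_mem w; rewrite e expg0 => /set1P.
Qed.

Lemma lenM x y : (len (x * y) <= len x + len y)%N.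
Proof. by apply: len_min; rewrite expgD mem_mulg ?len_mem. Qed.

Lemma lenV w : len w^-1 = len w.
Proof.
have le u : (len u^-1 <= len u)%N.
  apply: len_min; move: (len u) (len_mem u) => n.
  elim: n u => [|n IH] u; first by rewrite expg0 => /set1P->; rewrite invg1 set11.
  rewrite expgS => /mulsgP[s y Ss /IH Sy ->].
  by rewrite invMg (coxeter_inv Ss) -expgS expgSr mem_mulg.
by apply/eqP; rewrite eqn_leq le -{1}[w]invgK le.
Qed.

(** The universal property of the presentation, applied to the group of permutations of [bool],
    provides the sign character: every generator goes to the transposition. *)
Lemma len_parity x y : odd (len (x * y)) = odd (len x) (+) odd (len y).
Proof.
case: coxS => _ _ /(_ {perm bool} (fun=> tperm true false)) [s t _ _|F FM FS].
  by rewrite tperm2 expg1n.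
have oddF w : odd_perm (F w) = odd (len w).
  move: (len w) (len_mem w) => n; elim: n w => [|n IH] w.
    rewrite expg0 => /set1P->; have -> : F 1 = 1; last exact: odd_perm1.
    by apply: (mulgI (F 1)); rewrite -FM !mulg1.
  rewrite expgS => /mulsgP[s u Ss /IH {}IH ->].
  by rewrite FM odd_permM IH FS // odd_tperm.
by rewrite -!oddF FM odd_permM.
Qed.

Lemma len_gen s : s \in S -> len s = 1%N.
Proof.
move=> Ss; have : (len s <= 1)%N by apply: len_min; rewrite expg1.
case: coxS => /(_ s Ss) os _ _.
by rewrite leq_eqVlt ltnS leqn0 len_eq0 => /predU1P[// | /eqP s1]; rewrite s1 order1 in os.
Qed.

Lemma len_gen_mul s w : s \in S ->
  len (s * w) = (len w).+1 \/ len w = (len (s * w)).+1.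
Proof.
move=> Ss; have le u : (len (s * u) <= (len u).+1)%N.
  by rewrite -add1n -(len_gen Ss) lenM.
have := len_parity s w; rewrite (len_gen Ss) => par.
have := le (s * w); rewrite (coxeterK w Ss) leq_eqVlt => /predU1P[|lt1]; first by right.
have := le w; rewrite leq_eqVlt => /predU1P[|lt2]; first by left.
have e : len (s * w) = len w by apply/eqP; rewrite eqn_leq -ltnS lt2 -ltnS lt1.
by move: par; rewrite e; case: (odd _).
Qed.

Lemma len_decomp w : w != 1 ->
  exists s u, [/\ s \in S, w = s * u & len w = (len u).+1].
Proof.
rewrite -len_eq0 => nz; have := len_mem w; case e: (len w) nz => [//|n] _.
rewrite expgS => /mulsgP[s u Ss Su def_w]; exists s, u; split=> //.
apply/eqP; rewrite eqSS eqn_leq len_min // andbT -ltnS -e.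
by rewrite def_w -add1n -(len_gen Ss) lenM.
Qed.

Lemma coxeter_ind (P : gT -> Prop) :
  P 1 -> (forall s u, s \in S -> len (s * u) = (len u).+1 -> P u -> P (s * u)) ->
  forall w, P w.
Proof.
move=> P1 PS w; have [n] := ubnP (len w); elim: n w => // n IH w lt_wn.
case: (eqVneq w 1) => [-> // | /len_decomp[s [u [Ss def_w lw]]]].
by rewrite def_w; apply: PS => //; rewrite -?def_w //; apply: IH; rewrite lw in lt_wn.
Qed.

End CoxeterLength.

(** * Hecke algebra and Kazhdan-Lusztig basis *)

Section Coordinates.
Variables (B : nzRingType) (M : lmodType B) (I : finType) (b : I -> M).
Hypothesis hb : is_basis *:%R b.

Lemma coordsE m : m = \sum_i coords b m i *: b i.
Proof.
rewrite /coords; case: xgetP => [a _ //|]; have [a [ha _]] := hb m.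
by move/(_ a); case.
Qed.

Lemma basis_eq (f g : I -> B) :
  \sum_i f i *: b i = \sum_i g i *: b i -> f =1 g.
Proof.
move=> e; have [a [_ ha]] := hb (\sum_i f i *: b i).
have h (k : I -> B) : \sum_i f i *: b i = \sum_i k i *: b i -> a = [ffun i => k i].
  by move=> ek; apply: ha; rewrite ek; apply: eq_bigr => i _; rewrite ffunE.
by move=> i; have := h _ e; rewrite (h _ erefl) => /ffunP/(_ i); rewrite !ffunE.
Qed.

Lemma coords_sum (f : I -> B) i : coords b (\sum_i f i *: b i) i = f i.
Proof. by apply: (basis_eq (f := coords b _)); rewrite -coordsE. Qed.

Lemma coords_inj m m' : (forall i, coords b m i = coords b m' i) -> m = m'.
Proof.
by move=> e; rewrite (coordsE m) (coordsE m'); apply: eq_bigr => i _; rewrite e.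
Qed.

Lemma coordsD m m' i : coords b (m + m') i = coords b m i + coords b m' i.
Proof.
apply: (basis_eq (f := coords b _) (g := fun i => coords b m i + coords b m' i)).
rewrite -coordsE {1}(coordsE m) {1}(coordsE m') -big_split.
by apply: eq_bigr => j _; rewrite scalerDl.
Qed.

Lemma coordsZ a m i : coords b (a *: m) i = a * coords b m i.
Proof.
apply: (basis_eq (f := coords b _) (g := fun i => a * coords b m i)).
rewrite -coordsE {1}(coordsE m) scaler_sumr.
by apply: eq_bigr => j _; rewrite scalerA.
Qed.

Lemma coords0 i : coords b 0 i = 0.
Proof. by rewrite -[X in coords b X](scale0r 0) coordsZ mul0r. Qed.

Lemma coordsN m i : coords b (- m) i = - coords b m i.
Proof. by rewrite -scaleN1r coordsZ mulN1r. Qed.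

Lemma coordsB m m' i : coords b (m - m') i = coords b m i - coords b m' i.
Proof. by rewrite coordsD coordsN. Qed.

Lemma coords_bigsum (J : Type) (r : seq J) (P : pred J) (F : J -> M) i :
  coords b (\sum_(j <- r | P j) F j) i = \sum_(j <- r | P j) coords b (F j) i.
Proof.
by apply: (big_morph (fun m => coords b m i)) => [m m'|]; rewrite ?coordsD ?coords0.
Qed.

Lemma coords_basis i j : coords b (b i) j = (i == j)%:R.
Proof.
have {1}-> : b i = \sum_j (i == j)%:R *: b j; last exact: coords_sum.
rewrite (bigD1 i) //= eqxx scale1r big1 ?addr0 // => k nik.
by rewrite eq_sym (negPf nik) scale0r.
Qed.

End Coordinates.

Section HeckeAlgebra.
Variables (C : numClosedFieldType) (gT : finGroupType) (S : {set gT}) (L : gT -> int).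
Hypothesis coxS : coxeter_system S.
Variable H : hecke_algebra C S L.
Local Notation A := (laurent C).
Local Notation T := (hT H).
Local Notation len := (len S).
Implicit Types s t u w x y z : gT.
Local Notation vp := (vpow C).
Local Notation hb := (@hT_basis _ _ _ _ H).
Local Notation xi s := (vp (L s) - vp (- L s)).

Lemma hT_gen_up s w : s \in S -> len (s * w)%g = (len w).+1 ->
  T s * T w = T (s * w)%g.
Proof. exact: hT_up. Qed.

Lemma hT_gen_down s w : s \in S -> len w = (len (s * w)%g).+1 ->
  T s * T w = T (s * w)%g + xi s *: T w.
Proof. exact: hT_down. Qed.

Lemma hT_sqr s : s \in S -> T s * T s = 1 + xi s *: T s.
Proof.
move=> Ss; have ss1 : (s * s = 1)%g by rewrite -{1}(coxeter_inv coxS Ss) mulVg.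
by rewrite hT_gen_down ?ss1 ?hT1 // len1 ?len_gen.
Qed.

Lemma hT_mulr_up w s : s \in S -> len (w * s)%g = (len w).+1 ->
  T w * T s = T (w * s)%g.
Proof.
move=> Ss; elim/(coxeter_ind coxS): w => [|t u St lt IH] l.
  by rewrite hT1 mul1r mul1g.
have lus : len (u * s)%g = (len u).+1.
  apply/eqP; rewrite eqn_leq -{1}addn1 -{1}(len_gen coxS Ss) lenM //=.
  rewrite -ltnS -lt -l -mulgA -[X in (_ <= X)%N]add1n -(len_gen coxS St).
  exact: lenM.
rewrite -(hT_gen_up St lt) -mulrA IH // -mulgA hT_gen_up // mulgA l lt lus //.
Qed.

Lemma hT_mulr_down w s : s \in S -> len w = (len (w * s)%g).+1 ->
  T w * T s = T (w * s)%g + xi s *: T w.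
Proof.
move=> Ss l; have wss : (w * s * s)%g = w.
  by rewrite -mulgA -{1}(coxeter_inv coxS Ss) mulVg mulg1.
have Tw : T w = T (w * s)%g * T s by rewrite hT_mulr_up ?wss.
by rewrite {1}Tw -mulrA hT_sqr // mulrDr mulr1 -scalerAr -Tw.
Qed.

(** The [T_s] generate [H], so stability under left multiplication is tested on them. This passes
    from the one-step definition of [leL] to products with arbitrary elements. *)
Lemma hecke_left_mul (N : H -> Prop) :
  (forall h h', N h -> N h' -> N (h + h')) -> (forall a h, N h -> N (a *: h)) ->
  (forall s h, s \in S -> N h -> N (T s * h)) ->
  forall g h, N h -> N (g * h).
Proof.
move=> ND NZ NS g h Nh; have N0 : N 0 by rewrite -(scale0r h); apply: NZ.
have NT w : N (T w * h).
  elim/(coxeter_ind coxS): w => [|s u Ss lsu IH]; first by rewrite hT1 mul1r.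
  by rewrite -(hT_gen_up Ss lsu) -mulrA; apply: NS.
rewrite (coordsE hb g) mulr_suml.
by elim/big_rec: _ => // w x _ Nx; apply: ND => //; rewrite -scalerAl; apply: NZ.
Qed.

(* Locked, since linear_sum and friends would otherwise unfold the sum. *)
Definition hecke_anti : H -> H :=
  locked (fun h : H => \sum_w coords T h w *: T w^-1%g).
Local Notation iota := hecke_anti.

Lemma hecke_anti_is_linear : linear iota.
Proof.
move=> a h h'; rewrite /iota -lock scaler_sumr -big_split; apply: eq_bigr => w _ /=.
by rewrite (coordsD hb) (coordsZ hb) scalerDl scalerA.
Qed.

HB.instance Definition _ :=
  GRing.isLinear.Build A H H _ iota hecke_anti_is_linear.

Lemma hecke_antiT w : iota (T w) = T w^-1%g.
Proof.
rewrite /iota -lock (bigD1 w) //= (coords_basis hb) eqxx scale1r big1 ?addr0 // => u nwu.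
by rewrite (coords_basis hb) eq_sym (negPf nwu) scale0r.
Qed.

Lemma hecke_antiM g h : iota (g * h) = iota h * iota g.
Proof.
have TsT s w : s \in S -> iota (T s * T w) = iota (T w) * T s.
  move=> Ss; have Vsw : (s * w)^-1%g = (w^-1 * s)%g.
    by rewrite invMg (coxeter_inv coxS Ss).
  rewrite hecke_antiT; have [l|l] := len_gen_mul coxS w Ss.
    by rewrite hT_gen_up // hecke_antiT hT_mulr_up // -Vsw ?lenV // lenV.
  rewrite hT_gen_down // raddfD /= linearZ /= !hecke_antiT hT_mulr_down // -Vsw //.
  by rewrite !lenV.
have Ts s f : s \in S -> iota (T s * f) = iota f * T s.
  move=> Ss; rewrite (coordsE hb f) mulr_sumr !linear_sum mulr_suml.
  by apply: eq_bigr => w _; rewrite -scalerAr !linearZ /= TsT // scalerAl.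
have Tw w f : iota (T w * f) = iota f * iota (T w).
  elim/(coxeter_ind coxS): w f => [|s u Ss lsu IH] f.
    by rewrite hecke_antiT invg1 hT1 mul1r mulr1.
  by rewrite -(hT_gen_up Ss lsu) -mulrA !(Ts s _ Ss) IH mulrA.
rewrite {1}(coordsE hb g) mulr_suml !linear_sum.
rewrite [X in iota h * iota X](coordsE hb g) linear_sum mulr_sumr.
by apply: eq_bigr => w _; rewrite -scalerAl !linearZ /= Tw scalerAr.
Qed.

(** * Bar involution, uniqueness of the Kazhdan-Lusztig basis, and left and right preorders *)

Section KLBasis.
Variable c : kl_basis H.
Local Notation bar := (kl_bar c).
Local Notation hc := (@kl_c_basis _ _ _ _ _ c).
Local Notation klh := (klh c).
Local Notation klp := (klp c).

Lemma kl_bar_scalar (a : A) : bar a%:A = (lbar a)%:A.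
Proof.
have inM (x y : A) : (x * y)%:A = x%:A * y%:A :> H.
  by rewrite -scalerAl mul1r scalerA.
have in1 : 1%:A = 1 :> H by rewrite scale1r.
have barv n : bar (vp n%:Z)%:A = (vp (- n%:Z))%:A.
  elim: n => [|n IH]; first by rewrite oppr0 vpow0 in1 rmorph1.
  by rewrite intS opprD !vpowD !inM rmorphM IH (kl_bar_v c).
have barVv n : bar (vp (- n%:Z))%:A = (vp n%:Z)%:A.
  have e : (vp n%:Z)%:A * bar (vp n%:Z)%:A = 1 by rewrite barv -inM vpowVr in1.
  transitivity ((vp n%:Z)%:A * bar (vp n%:Z)%:A * bar (vp (- n%:Z))%:A).
    by rewrite e mul1r.
  by rewrite -mulrA -rmorphM -inM vpowVr in1 rmorph1 mulr1.
have [p [n ->]] := laurentP a.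
rewrite lbarE !inM rmorphM barVv; congr (_ * _).
rewrite !(@zevalE _ _ p (size p)) // !scaler_suml rmorph_sum.
have inMz (x : A) (k : int) : (x *~ k)%:A = x%:A *~ k :> H.
  exact: (raddfMz (in_alg H)).
by apply: eq_bigr => i _; rewrite !inMz rmorphMz -vpow_nat barv vpowN_nat.
Qed.

Lemma kl_barZ a h : bar (a *: h) = lbar a *: bar h.
Proof. by rewrite -mulr_algl rmorphM /= kl_bar_scalar mulr_algl. Qed.

(** Applied to [T_w] in either order, the two maps give the inverse of [T_w]; both composites are
    semilinear for [lbar]. *)
Lemma kl_bar_anti h : bar (iota h) = iota (bar h).
Proof.
rewrite (coordsE hb h) !(linear_sum, rmorph_sum) /=; apply: eq_bigr => w _.
rewrite linearZ /= !kl_barZ linearZ /= hecke_antiT; congr (_ *: _).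
have i1 : iota 1 = 1 by have := hecke_antiT 1%g; rewrite invg1 hT1.
have [+ _] := kl_bar_T c w => /(congr1 iota).
rewrite hecke_antiM !hecke_antiT invgK i1 => e.
have [e' _] := kl_bar_T c w^-1%g; rewrite invgK in e'.
by rewrite -[LHS]mulr1 -e mulrA e' mul1r.
Qed.

Lemma bruhat_lt_len y w : bruhat_lt S y w -> (len y < len w)%N.
Proof.
case/andP=> nyw /connectP[p]; case: p => [_ def_w|z p]; first by rewrite def_w eqxx in nyw.
move=> /= /andP[/andP[_ lyz] e] ->; apply: leq_trans lyz _.
elim: p z e => //= u p IH z /andP[/andP[_ /ltnW lzu] /IH]; exact: leq_trans.
Qed.

Lemma klp_sub y w : in_vZ (-1) (klp y w - (w == y)%:R).
Proof.
have [p hp e] := kl_c_T c w.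
rewrite /Defs.klp e (coordsD hb) (coords_basis hb) addrC addKr (coords_bigsum hb).
apply: in_vZ_sum => x _; rewrite (coordsZ hb) (coords_basis hb) mulr_natr.
by case: eqP => _; [exact: hp | exact: in_vZ0].
Qed.

Lemma klp_len y w : klp y w != 0 -> y = w \/ (len y < len w)%N.
Proof.
have [p hp e] := kl_c_T c w.
rewrite /Defs.klp e (coordsD hb) (coords_basis hb) (coords_bigsum hb).
case: (eqVneq w y) => [-> | _]; first by left.
rewrite add0r => nz; right; move: nz; apply: contraNT => lyw.
rewrite big1 // => x /bruhat_lt_len lxw; rewrite (coordsZ hb) (coords_basis hb).
by case: eqP => [exy|]; rewrite ?mulr0 //; rewrite -exy lxw in lyw.
Qed.

Lemma in_vZ_perturb (x y : A) (k : bool) :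
  in_vZ (-1) x -> in_vZ (-1) (y - k%:R) -> in_vZ (-1) (x * y).
Proof.
move=> hx hy; rewrite -[y](subrK k%:R) mulrDr; apply: in_vZD.
  by apply: in_vZ_le (in_vZM hx hy).
by case: k {hy}; rewrite ?mulr1 ?mulr0 //; apply: in_vZ0.
Qed.

(** The matrix from [c] to [T] is unitriangular with off-diagonal entries in [v^-1 Z[v^-1]];
    induction on length gives the same shape for its inverse. *)
Lemma coords_kl_hT w y : in_vZ (-1) (coords c (T w) y - (w == y)%:R).
Proof.
have [n] := ubnP (len w); elim: n w y => // n IH w y lwn.
have [p hp e] := kl_c_T c w.
have -> : T w = c w - \sum_(y | bruhat_lt S y w) p y *: T y by rewrite e addrK.
rewrite (coordsB hc) (coords_basis hc) addrC addKr (coords_bigsum hc).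
apply/in_vZN/in_vZ_sum => x /bruhat_lt_len lxw; rewrite (coordsZ hc).
by apply: in_vZ_perturb (hp x) (IH x y _); rewrite (leq_trans lxw).
Qed.

Lemma coords_kl_bar h z : coords c (bar h) z = lbar (coords c h z).
Proof.
rewrite {1}(coordsE hc h) rmorph_sum /=.
under eq_bigr => w _ do rewrite kl_barZ kl_bar_c.
by rewrite (coords_sum hc).
Qed.

(** The coordinates in the basis [c] are bar-invariant and, by [coords_kl_hT], still lie in [v^-1
    Z[v^-1]]. Applied to a difference, this is the uniqueness of [c_w], which yields
    [hecke_anti_kl]. *)
Lemma kl_bar_fixed_eq0 h :
  bar h = h -> (forall y, in_vZ (-1) (coords T h y)) -> h = 0.
Proof.
move=> bh hT; apply: (coords_inj hc) => z; rewrite (coords0 hc).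
apply: lbar_eq0_in_vZ; first by rewrite -coords_kl_bar bh.
rewrite (coordsE hb h) (coords_bigsum hc); apply: in_vZ_sum => w _.
by rewrite (coordsZ hc); apply: in_vZ_perturb (hT w) (coords_kl_hT w z).
Qed.

Lemma hecke_anti_kl w : iota (c w) = c w^-1%g.
Proof.
apply/eqP; rewrite -subr_eq0; apply/eqP/kl_bar_fixed_eq0 => [|y].
  by rewrite rmorphB /= kl_bar_anti !kl_bar_c.
rewrite (coordsB hb); have -> : coords T (iota (c w)) y = klp y^-1%g w.
  rewrite /iota -lock (reindex_inj invg_inj) /=.
  by under eq_bigr => u _ do rewrite invgK; rewrite (coords_sum hb).
have := in_vZD (klp_sub y^-1%g w) (in_vZN (klp_sub y w^-1%g)).
by rewrite -eq_invg_sym opprB addrA subrK.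
Qed.

Lemma klh_inv x y z : klh x y z = klh y^-1%g x^-1%g z^-1%g.
Proof.
rewrite /Defs.klh -!hecke_anti_kl -hecke_antiM.
have -> : iota (c x * c y) = \sum_u coords c (c x * c y) u^-1%g *: c u.
  rewrite {1}(coordsE hc (c x * c y)) linear_sum (reindex_inj invg_inj).
  by apply: eq_bigr => u _; rewrite linearZ /= hecke_anti_kl invgK.
by rewrite (coords_sum hc) invgK.
Qed.

Lemma klh_bar x y z : lbar (klh x y z) = klh x y z.
Proof. by rewrite /Defs.klh -coords_kl_bar rmorphM /= !kl_bar_c. Qed.

Lemma kl_c1 : c 1%g = 1.
Proof.
have [p hp ->] := kl_c_T c 1%g; rewrite hT1 big1 ?addr0 // => y /bruhat_lt_len.
by rewrite (len1 coxS).
Qed.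

Lemma kl_c_gen s : s \in S -> exists a, c s = T s + a%:A.
Proof.
move=> Ss; have [p hp ->] := kl_c_T c s.
exists (\sum_(y | bruhat_lt S y s) p y); rewrite scaler_suml; congr (_ + _).
apply: eq_bigr => y /bruhat_lt_len; rewrite (len_gen coxS Ss) ltnS leqn0 (len_eq0 coxS).
by move/eqP->; rewrite hT1.
Qed.

Lemma leL_trans y x z : leL c x y -> leL c y z -> leL c x z.
Proof. by rewrite /leL => h1 h2; apply: connect_trans h2 h1. Qed.

(** The preorder is defined with [c_s] only, but [T_s] and [c_s] differ by a scalar, so the span of
    the [c_z] with [z <=_L y] is a left ideal. *)
Lemma klh_leL x y z : klh x y z != 0 -> leL c z y.
Proof.
pose N (h : H) := forall z, coords c h z != 0 -> leL c z y.
suff : N (c x * c y) by apply.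
apply: (hecke_left_mul (N := N)) => [h h' Nh Nh' u|a h Nh u|s h Ss Nh u|u].
- rewrite (coordsD hc); apply: contraNT => nle.
  by rewrite (eqP (contraNT (Nh u) nle)) (eqP (contraNT (Nh' u) nle)) addr0.
- rewrite (coordsZ hc); apply: contraNT => nle.
  by rewrite (eqP (contraNT (Nh u) nle)) mulr0.
- have [a ea] := kl_c_gen Ss; apply: contraNT => nle.
  have -> : T s = c s - a%:A by rewrite ea addrK.
  rewrite mulrBl mulr_algl (coordsB hc) (coordsZ hc) (eqP (contraNT (Nh u) nle)).
  rewrite mulr0 subr0 (coordsE hc h) mulr_sumr (coords_bigsum hc) big1 // => w _.
  rewrite -scalerAr (coordsZ hc).
  have [-> | h1] := eqVneq (coords c h w) 0; first by rewrite mul0r.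
  have [-> | h2] := eqVneq (coords c (c s * c w) u) 0; first by rewrite mulr0.
  case/negP: nle; apply: leL_trans (Nh w h1).
  by apply: connect1; apply/existsP; exists s; rewrite Ss.
- rewrite (coords_basis hc); case: (y =P u) => [<- _|_]; last by rewrite eqxx.
  exact: connect0.
Qed.

Lemma klh_leR x y z : klh x y z != 0 -> leR c z x.
Proof. by rewrite klh_inv; apply: klh_leL. Qed.

Section Dagger.
Variable dg : dagger_involution H.

(** On a generator [bar] gives the inverse of [T_s] and the dagger gives minus that inverse; the
    composite is multiplicative and sends [T_s] to [- T_s]. *)
Lemma dag_bar_hT w : dg (bar (T w)) = (-1) ^+ len w *: T w.
Proof.
have gen s : s \in S -> dg (bar (T s)) = - T s.
  move=> Ss; have [e1 e2] := kl_bar_T c s; rewrite (coxeter_inv coxS Ss) in e1 e2.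
  have [e3 _] := dag_T dg Ss.
  have -> : bar (T s) = - dg (T s).
    by rewrite -[bar _]mul1r -[1](opprK 1) -e3 !mulNr -mulrA e2 mulr1.
  by rewrite rmorphN /= dagK.
elim/(coxeter_ind coxS): w => [|s u Ss lsu IH].
  by rewrite hT1 !rmorph1 (len1 coxS) expr0 scale1r.
rewrite lsu -(hT_gen_up Ss lsu) !rmorphM /= IH gen //.
by rewrite mulNr -scalerAr exprS mulN1r scaleNr.
Qed.

Lemma dag_kl w : dg (c w) = \sum_y (lbar (klp y w) * (-1) ^+ len y) *: T y.
Proof.
rewrite -(kl_bar_c c) {1}(coordsE hb (c w)) !rmorph_sum; apply: eq_bigr => y _.
by rewrite /= kl_barZ linearZ /= dag_bar_hT scalerA.
Qed.

End Dagger.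
End KLBasis.
End HeckeAlgebra.

(** * The a-function and the coefficients of J *)

Section AsymptoticRing.
Variables (C : numClosedFieldType) (gT : finGroupType) (S : {set gT}) (L : gT -> int).
Hypothesis coxS : coxeter_system S.
Variables (H : hecke_algebra C S L) (c : kl_basis H).
Hypothesis hP : P1_15 c.
Implicit Types s t u w x y z d : gT.
Local Notation A := (laurent C).
Local Notation vp := (vpow C).
Local Notation hc := (@kl_c_basis _ _ _ _ _ c).
Local Notation klh := (klh c).
Local Notation a := (afun c).
Local Notation gam := (gam c).
Local Notation D := (calD c).
Local Notation n_ := (nz c).

Lemma klh_prod x y : c x * c y = \sum_z klh x y z *: c z.
Proof. exact: (coordsE hc). Qed.

Lemma klh1 y z : klh 1%g y z = (y == z)%:R.
Proof. by rewrite /Defs.klh kl_c1 // mul1r (coords_basis hc). Qed.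

(** [afun] is a chosen value with a default, so a suitable integer must be exhibited: finitely many
    structure constants have a common bound, and the least natural bound is sharp. *)
Lemma klh_in_vZ x y z : in_vZ (a z)%:Z (klh x y z).
Proof.
have bound (b : A) : exists n : nat, in_vZ n%:Z b.
  have [p [n ->]] := laurentP b; exists (size p); apply/in_vZP => j ltj.
  rewrite lcoefE; case e: (j + n%:Z) => [m|//]; rewrite nth_default //.
  rewrite -lez_nat -e; apply: le_trans (ltW ltj) _; by rewrite lerDl.
have [N hN] : exists N : nat, forall x y, in_vZ N%:Z (klh x y z).
  have [f hf] := choice (fun xy : gT * gT => bound (klh xy.1 xy.2 z)).
  exists (\max_xy f xy)%N => u w; apply: in_vZ_le (hf (u, w)).
  by rewrite lez_nat (leq_bigmax (u, w)).
have ex : exists n : nat, `[< forall x y, in_vZ n%:Z (klh x y z) >].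
  by exists N; apply/asboolP.
rewrite /afun; case: xgetP => [n _ [h _] // |]; case: (ex_minnP ex) => n /asboolP hn nmin.
move/(_ n); case; split=> //; apply: contrapT => nex.
have hn1 u w : in_vZ (n%:Z - 1) (klh u w z).
  by apply: contrapT => h; apply: nex; exists u, w.
case: n => [|n] in hn nmin nex hn1 *.
  (* The bound 0 cannot be lowered, because [h_{1,z,z} = 1]. *)
  have := hn1 1%g z; rewrite klh1 eqxx => /in_vZP/(_ 0 isT).
  by rewrite -[1%:R](vpow0 C) lcoef_vpow eqxx.
suff : (n.+1 <= n)%N by rewrite ltnn.
by apply: nmin; apply/asboolP => u w; have := hn1 u w; rewrite intS addrC addKr.
Qed.

(** Bar-invariance turns the upper bound [a z] on degrees into the lower bound [- a z], and the
    coefficient at the bottom equals the one at the top, which is [gam]. *)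
Lemma klh_low x y z : exists2 p : {poly int},
  klh x y z = vp (- (a z)%:Z) * zeval (vp 1) p & p`_0 = gam x y z^-1%g.
Proof.
have [p e] := (in_vZ_zeval _ _).1 (klh_in_vZ x y z); exists p.
  rewrite -klh_bar // e rmorphM /= lbar_vpow rmorph_zeval /= lbar_vpow.
  by rewrite opprK.
by rewrite /Defs.gam invgK e lcoef_zevalV subrr.
Qed.

Let hP4 : P4 c. Proof. by case: hP => -[]. Qed.
Let hP7 : P7 c. Proof. by case: hP => _ []. Qed.

Lemma afun_leL z z' : leL c z' z -> (a z <= a z')%N.
Proof. by move=> h; apply: hP4; apply: connect1; rewrite /= h. Qed.

Lemma afun_leR z z' : leR c z' z -> (a z <= a z')%N.
Proof. by move=> h; apply: hP4; apply: connect1; rewrite /= h orbT. Qed.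

Lemma afun_simLR z z' : simLR c z' z -> a z = a z'.
Proof. by case/andP=> h1 h2; apply/eqP; rewrite eqn_leq !hP4. Qed.

Lemma simL_simLR z z' : simL c z z' -> simLR c z z'.
Proof. by case/andP=> h1 h2; apply/andP; split; apply: connect1; rewrite /= ?h1 ?h2. Qed.

Lemma afun_simL z z' : simL c z' z -> a z = a z'.
Proof. by move/simL_simLR/afun_simLR. Qed.

Lemma afun_inv z : a z^-1%g = a z.
Proof. by case: hP => _ _ [_ _ _ h _]; have /afun_simLR-> := h z. Qed.

Lemma simL_sym x y : simL c x y = simL c y x.
Proof. exact: andbC. Qed.

Lemma simL_refl x : simL c x x.
Proof. by rewrite /simL /leL connect0. Qed.

Lemma simL_trans x y z : simL c x y -> simL c y z -> simL c x z.
Proof.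
move=> /andP[h1 h2] /andP[h3 h4].
by rewrite /simL (leL_trans h1 h3) (leL_trans h4 h2).
Qed.

Lemma simLR_trans x y z : simLR c x y -> simLR c y z -> simLR c x z.
Proof.
move=> /andP[h1 h2] /andP[h3 h4].
by apply/andP; split; [exact: connect_trans h1 h3 | exact: connect_trans h4 h2].
Qed.

Lemma simLR_sym x y : simLR c x y = simLR c y x.
Proof. exact: andbC. Qed.

Lemma klh_afunl x y z : klh x y z != 0 -> (a y <= a z)%N.
Proof. by move/(klh_leL coxS)/afun_leL. Qed.

Lemma klh_afunr x y z : klh x y z != 0 -> (a x <= a z)%N.
Proof. by move/(klh_leR coxS)/afun_leR. Qed.

Lemma gam_simL x y z : gam x y z != 0 ->
  [/\ simL c x y^-1%g, simL c y z^-1%g & simL c z x^-1%g].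
Proof. by case: hP => _ [_ _ h _ _] _; apply: h. Qed.

Lemma gam_afun x y z : gam x y z != 0 -> a x = a z /\ a y = a z.
Proof.
move/gam_simL => [/afun_simL h1 /afun_simL h2 _].
by move: h1 h2; rewrite !afun_inv => <- ->.
Qed.

Lemma gam_neq_afun x y z : (a x == a z) && (a y == a z) = false -> gam x y z = 0.
Proof.
apply: contraFeq => /gam_afun[-> ->]; by rewrite !eqxx.
Qed.

Lemma gam_inv x y z : gam x y z = gam y^-1%g x^-1%g z^-1%g.
Proof. by rewrite /Defs.gam klh_inv // afun_inv !invgK. Qed.

Lemma gam_rot x y z : gam x y z = gam y z x. Proof. exact: hP7. Qed.

(* Coefficient of v'^(a y) in (P15). *)
Lemma klh_gam x w y u : a w = a y ->
  \sum_z klh x z y *~ gam w u z^-1%g = \sum_z klh x w z *~ gam z u y^-1%g.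
Proof.
move=> awy; have [_ _ [_ _ _ _ h]] := hP.
have e : \sum_z rfconst (val (klh x z y)) * leval (rfv (ratfun C)) (klh w u z) =
         \sum_z rfconst (val (klh x w z)) * leval (rfv (ratfun C)) (klh z u y).
  etransitivity; last exact: (h x u w y awy).
  by apply: eq_bigr => z _; exact: mulrC.
have {h e} e := leval_coef_eq e (a y)%:Z.
have valMz (b : A) (k : int) : val (b *~ k) = val b * k%:~R.
  by rewrite mulrzr; exact: (raddfMz (val : A -> ratfun C)).
apply: val_inj; rewrite !raddf_sum /=.
under [LHS]eq_bigr => z _ do rewrite valMz.
under [RHS]eq_bigr => z _ do rewrite valMz /Defs.gam invgK.
rewrite -e; apply: eq_bigr => z _; rewrite /Defs.gam invgK.
(* The coefficient at [a y] is the one recorded by [gam w u z^-1] only if [a z = a y]. When both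
   factors are nonzero, [a w <= a z <= a y = a w] forces this. *)
have [-> | nz1] := eqVneq (klh x z y) 0; first by rewrite !mul0r.
have [-> | nz2] := eqVneq (klh w u z) 0; first by rewrite !lcoef0.
suff -> : a z = a y by [].
by apply/eqP; rewrite eqn_leq (klh_afunl nz1) -awy (klh_afunr nz2).
Qed.

(** Associativity of [J]: the coefficient of [v^(a z)] in [klh_gam]. If [a y] and [a z] differ,
    every term on both sides vanishes. *)
Lemma gamA x y w z :
  \sum_u gam x y u^-1%g * gam u w z^-1%g = \sum_u gam y w u^-1%g * gam x u z^-1%g.
Proof.
have [eq_a | ne_a] := eqVneq (a y) (a z); last first.
  rewrite !big1 // => u _; apply/eqP; rewrite mulf_eq0; apply: contraNT ne_a;
    rewrite negb_or => /andP[/gam_afun[h1 h2] /gam_afun[h3 h4]].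
  - by rewrite h1 afun_inv h4 afun_inv.
  - by rewrite h2 afun_inv h3 afun_inv.
have := congr1 (fun b => lcoef b (a z)%:Z) (klh_gam x w eq_a).
rewrite lcoef_sum [RHS]lcoef_sum => e; transitivity (\sum_u lcoef (klh x y u) (a z)%:Z * gam u w z^-1%g).
  apply: eq_bigr => u _; have [-> | /gam_afun[h _]] := eqVneq (gam u w z^-1%g) 0.
    by rewrite !mulr0.
  by rewrite /Defs.gam invgK h afun_inv.
transitivity (\sum_u lcoef (klh x y u *~ gam u w z^-1%g) (a z)%:Z).
  by apply: eq_bigr => u _; rewrite lcoefMz.
rewrite -e; apply: eq_bigr => u _; rewrite lcoefMz mulrC.
by rewrite /Defs.gam !invgK.
Qed.

Lemma calD_inv d : d \in D -> d^-1%g = d.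
Proof.
case: hP => _ [h _ _ _ _] _ /h dd; apply/eqP.
by rewrite eq_invg_mul -expg2 dd.
Qed.

Lemma simL_calD_ex x : exists2 d, d \in D & simL c d x.
Proof.
case: hP => _ _ [_ _ h _ _].
have [|d [+ _ _]] := h (finset (simL c x)); first by exists x.
by rewrite !inE => /andP[Dd xd]; exists d; rewrite 1?simL_sym // inE.
Qed.

Lemma simL_calD d y : d \in D -> simL c d y ->
  gam y^-1%g y d = n_ d /\ (n_ d = 1 \/ n_ d = -1).
Proof.
move=> Dd dy; case: hP => -[_ _ _ _ P5] _ [_ _ P13 _ _].
have [|d0 [_ u h]] := P13 (finset (simL c d)); first by exists d.
have e : d = d0 by apply: u; rewrite !inE simL_refl andbT; move: Dd; rewrite inE.
by apply: P5 => //; rewrite e; apply: h; rewrite inE.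
Qed.

Lemma simL_calD_uniq d d' y :
  d \in D -> d' \in D -> simL c d y -> simL c d' y -> d = d'.
Proof.
move=> Dd Dd' dy d'y; case: hP => _ _ [_ _ P13 _ _].
have [|d0 [_ u _]] := P13 (finset (simL c y)); first by exists y.
by rewrite (u d) 1?(u d') // finset.in_setI inE simL_sym ?Dd ?Dd'.
Qed.

Lemma nz_sqr d : d \in D -> n_ d * n_ d = 1.
Proof. by move=> Dd; case: (simL_calD Dd (simL_refl d)) => _ [->|->]. Qed.

Lemma gam_calD x y d : d \in D ->
  gam x y d = if (x == y^-1%g) && simL c d y then n_ d else 0.
Proof.
move=> Dd; case: ifP => [/andP[/eqP-> dy]|]; first by case: (simL_calD Dd dy).
apply: contraFeq => nz0; case: hP => -[_ P2 _ _ _] _ _.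
rewrite -(P2 _ _ _ Dd nz0) eqxx simL_sym.
by case: (gam_simL nz0) => _; rewrite (calD_inv Dd).
Qed.

Lemma gam_calDr x d z : d \in D ->
  gam x d z^-1%g = if (x == z) && simL c d x then n_ d else 0.
Proof. by move=> Dd; rewrite -gam_rot gam_calD // eqg_inv eq_sym. Qed.

Lemma gam_calDl d x z : d \in D ->
  gam d x z^-1%g = if (x == z) && simL c d x^-1%g then n_ d else 0.
Proof.
move=> Dd; rewrite gam_rot gam_calD // invgK.
by case: eqP => [->|].
Qed.

(** A left cell contains exactly one element of [D], so only one term [n_d^2 = 1] survives. Both
    unit laws of [J] follow. *)
Lemma sum_nz_simL x (b : bool) :
  \sum_(d in D) n_ d * (if b && simL c d x then n_ d else 0) = b%:R.
Proof.
case: b => /=; last by apply: big1 => d _; rewrite mulr0.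
have [d0 Dd0 d0x] := simL_calD_ex x.
rewrite (bigD1 d0) //= d0x (nz_sqr Dd0) big1 ?addr0 // => d /andP[Dd nd].
case: ifP => [dx|_]; last by rewrite mulr0.
by rewrite (simL_calD_uniq Dd Dd0 dx d0x) eqxx in nd.
Qed.

Lemma sum_gam_calDr x z : \sum_(d in D) n_ d * gam x d z^-1%g = (x == z)%:R.
Proof.
by rewrite -(sum_nz_simL x); apply: eq_bigr => d Dd; rewrite (gam_calDr _ _ Dd).
Qed.

Lemma sum_gam_calDl x z : \sum_(d in D) n_ d * gam d x z^-1%g = (x == z)%:R.
Proof.
rewrite -(sum_nz_simL x^-1%g); apply: eq_bigr => d Dd.
by rewrite (gam_calDl _ _ Dd).
Qed.

(* The action of c_x on the graded module of the a-filtration of H.  It commutes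
   with the right multiplications by J (klh_gam), so it is the left
   multiplication by its value psi x at the identity of J. *)
Definition gract x w z : A := if a w == a z then klh x w z else 0.

Definition psi x z : A := \sum_(d in D) gract x d z *~ n_ d.

Lemma klhA x y w z :
  \sum_u klh x y u * klh u w z = \sum_u klh y w u * klh x u z.
Proof.
have e : c x * c y * c w = c x * (c y * c w) by rewrite mulrA.
rewrite (klh_prod x y) (klh_prod y w) mulr_suml mulr_sumr in e.
have {e} := congr1 (fun h => coords c h z) e; rewrite !(coords_bigsum hc).
under eq_bigr => u _ do rewrite -scalerAl (coordsZ hc).
by under [in RHS]eq_bigr => u _ do rewrite -scalerAr (coordsZ hc).
Qed.

(** An intermediate [u] satisfies [a w <= a u <= a z]. When the ends agree, it lies in the same
    graded piece, and associativity of [H] restricts to that piece. *)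
Lemma gractA x y w z :
  \sum_u klh x y u * gract u w z = \sum_u gract y w u * gract x u z.
Proof.
rewrite /gract; have [eq_a | ne_a] := eqVneq (a w) (a z); last first.
  rewrite !big1 // => u _; last by rewrite mulr0.
  have [e | _] := eqVneq (a w) (a u); last by rewrite mul0r.
  by rewrite -e (negPf ne_a) mulr0.
rewrite klhA; apply: eq_bigr => u _.
have [-> | nz1] := eqVneq (klh y w u) 0; first by rewrite if_same !mul0r.
have [-> | nz2] := eqVneq (klh x u z) 0; first by rewrite if_same !mulr0.
suff -> : a u = a z by rewrite eq_a eqxx.
by apply/eqP; rewrite eqn_leq (klh_afunl nz2) -eq_a (klh_afunl nz1).
Qed.

Lemma psi_gam x w z : \sum_u psi x u *~ gam u w z^-1%g = gract x w z.
Proof.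
rewrite /psi; under eq_bigr => u _ do rewrite mulrz_suml.
rewrite exchange_big /=; have [eq_a | ne_a] := eqVneq (a w) (a z); last first.
  rewrite /gract (negPf ne_a) big1 // => d _; rewrite big1 // => u _.
  by rewrite gam_neq_afun ?mulr0z // afun_inv (negPf ne_a) andbF.
(* By [klh_gam], acting by [c_x] on [t_d] and then multiplying by [t_w] is acting on [t_d t_w];
   summing [n_d t_d] restores [t_w]. Blocks with [a d] different from [a z] contribute zero to both
   sides. *)
transitivity (\sum_(d in D) \sum_u klh x u z *~ (n_ d * gam d w u^-1%g)).
  apply: eq_bigr => d Dd; have [eq_d | ne_d] := eqVneq (a d) (a z); last first.
    rewrite !big1 // => u _.
      rewrite gam_neq_afun ?mulr0 ?mulr0z // afun_inv; apply/negbTE.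
      by apply: contra ne_d => /andP[/eqP-> /eqP <-]; rewrite eq_a.
    rewrite /gract; case: eqP => [e|_]; last by rewrite !mul0rz.
    by rewrite gam_neq_afun ?mulr0z // afun_inv -e (negPf ne_d).
  under [RHS]eq_bigr => u _ do rewrite mulrC mulrzA.
  rewrite -mulrz_suml klh_gam // mulrz_suml; apply: eq_bigr => u _.
  have [-> | /gam_afun[h _]] := eqVneq (gam u w z^-1%g) 0; first by rewrite !mulr0z mul0rz.
  by rewrite /gract eq_d h afun_inv eqxx mulrzAC.
rewrite exchange_big /=.
under eq_bigr => u _ do rewrite -mulrz_sumr sum_gam_calDl.
rewrite (bigD1 w) //= eqxx big1 ?addr0; first by rewrite /gract eq_a eqxx.
by move=> u nu; rewrite eq_sym (negPf nu) mulr0z.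
Qed.

(** Evaluate the composite of the operators of [c_x] and [c_y] at the unit of [J]: [gractA] gives
    one side, and [psi_gam] applied to the outer operator gives the other. *)
Lemma psi_mul x y z :
  \sum_u klh x y u * psi u z = \sum_u \sum_w psi x u * psi y w *~ gam u w z^-1%g.
Proof.
transitivity (\sum_w psi y w * gract x w z).
  rewrite /psi; under eq_bigr => u _ do rewrite mulr_sumr.
  rewrite exchange_big /=; under [RHS]eq_bigr => w _ do rewrite mulr_suml.
  rewrite [RHS]exchange_big; apply: eq_bigr => d _ /=.
  under eq_bigr => u _ do rewrite mulrzAr.
  under [RHS]eq_bigr => u _ do rewrite mulrzAl.
  by rewrite -!mulrz_suml gractA.
rewrite exchange_big; apply: eq_bigr => w _; rewrite -psi_gam mulr_sumr.
by apply: eq_bigr => u _; rewrite mulrzAr mulrC.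
Qed.

Lemma psi1 z : psi 1%g z = if z \in D then (n_ z)%:~R else 0.
Proof.
rewrite /psi /gract; under eq_bigr => d _ do rewrite klh1.
case: ifP => Dz.
  rewrite (bigD1 z) //= !eqxx big1 ?addr0 // => d /andP[_ nd].
  by rewrite (negPf nd) if_same mul0rz.
rewrite big1 // => d Dd; case: (d =P z) => [e|_]; first by rewrite -e Dd in Dz.
by rewrite if_same mul0rz.
Qed.

(** By [klh_low], the constant term after rescaling by [v^(a z)] is the coefficient of [t_z] in
    [t_x] times the unit of [J]. The restriction to [a d = a z] loses nothing, since [gam] vanishes
    otherwise. *)
Lemma psi_low x z : exists2 p : {poly int},
  psi x z = vp (- (a z)%:Z) * zeval (vp 1) p & p`_0 = (x == z)%:R.
Proof.
have /choice[q hq] : forall d, exists p : {poly int},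
    klh x d z = vp (- (a z)%:Z) * zeval (vp 1) p /\ p`_0 = gam x d z^-1%g.
  by move=> d; have [p e p0] := klh_low x d z; exists p.
exists (\sum_(d in D | a d == a z) q d * (n_ d)%:P).
  rewrite rmorph_sum mulr_sumr /psi big_mkcondr; apply: eq_bigr => d _.
  rewrite /gract; case: eqP => _; last by rewrite mul0rz.
  by rewrite rmorphM /= zevalC mulrzr mulrzAr (hq d).1.
rewrite -sum_gam_calDr coef_sum big_mkcondr; apply: eq_bigr => d _.
rewrite coefMC (hq d).2 mulrC; case: eqP => // ne_d.
by rewrite gam_neq_afun ?mulr0 // !afun_inv [a d == _](negbTE _) ?andbF //; apply/eqP.
Qed.

Lemma gract_simL x y z : gract x y z != 0 -> simL c y z.
Proof.
rewrite /gract; have [e|_] := eqVneq (a y) (a z); last by rewrite eqxx.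
move=> /(klh_leL coxS) zy; rewrite simL_sym.
by case: hP => _ [_ _ _ h _] _; apply: h zy _.
Qed.

Lemma nhatE d z : d \in D -> simL c d z -> nhat c z^-1%g = n_ d.
Proof.
move=> Dd dz; rewrite /nhat invgK; case: pickP => [d' /andP[Dd' d'z] | /(_ d)].
  by rewrite (simL_calD_uniq Dd' Dd d'z dz).
by rewrite Dd dz.
Qed.

Lemma nhat_sqr z : nhat c z * nhat c z = 1.
Proof.
have [d Dd dz] := simL_calD_ex z^-1%g.
by rewrite -(invgK z) (nhatE Dd dz) nz_sqr.
Qed.

(* The homomorphism phi of the statement is psi twisted by the ring automorphism
   t_z |-> jsign z t_z of J. *)
Definition jsign z : int := nhat c z * nhat c z^-1%g.

Lemma jsign_sqr z : jsign z * jsign z = 1.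
Proof. by rewrite /jsign mulrACA !nhat_sqr. Qed.

Lemma jsign_inv z : jsign z^-1%g = jsign z.
Proof. by rewrite /jsign invgK mulrC. Qed.

Lemma nhat_simL x y : simL c x y -> nhat c x^-1%g = nhat c y^-1%g.
Proof.
move=> xy; have [d Dd dx] := simL_calD_ex x.
by rewrite (nhatE Dd dx) (nhatE Dd (simL_trans dx xy)).
Qed.

(** [nhat] of the inverse is constant on left cells, so (P8) gives [nhat x = nhat z],
    [nhat x^-1 = nhat y] and [nhat y^-1 = nhat z^-1]; the two middle factors cancel as a square. *)
Lemma jsign_gam x y z : gam x y z^-1%g != 0 -> jsign x * jsign y = jsign z.
Proof.
case/gam_simL => /nhat_simL; rewrite !invgK => h1 /nhat_simL h2 /nhat_simL h3.
rewrite !invgK in h3.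
by rewrite /jsign h1 h2 -h3 -mulrA (mulrA (nhat c y)) nhat_sqr mul1r.
Qed.

(** A nonzero term forces [d] and [z] into one left cell, hence [n_d = nhat z^-1], and
    [n_d * jsign z = nhat z]. *)
Lemma phi_cdagE w z : phi_cdag c w z = psi w z *~ jsign z.
Proof.
rewrite ffunE /psi mulrz_suml big_mkcondr /=; apply: eq_bigr => d Dd.
rewrite eq_sym /gract; case: eqP => [e|_]; last by rewrite !mul0rz.
have [-> | nz0] := eqVneq (klh w d z) 0; first by rewrite !mul0rz.
have := @gract_simL w d z; rewrite /gract e eqxx => /(_ nz0) dz.
by rewrite /jsign (nhatE Dd dz) -mulrzA mulrCA nz_sqr // mulr1.
Qed.

End AsymptoticRing.

(** * The ring J over a ring of scalars *)

(** The determinant has constant term 1, so it evaluates to some [1 + q r(q)], invertible by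
    hypothesis; the adjugate then supplies the inverse. *)
Lemma zeval_matrix_inverse (B : comNzRingType) (q : B) (I : finType)
    (P : I -> I -> {poly int}) :
  (forall r : {poly int}, exists b, (1 + q * zeval q r) * b = 1) ->
  (forall x y, (P x y)`_0 = (x == y)%:R) ->
  exists X : I -> I -> B,
    (forall x z, \sum_y X x y * zeval q (P y z) = (x == z)%:R) /\
    (forall x z, \sum_y zeval q (P x y) * X y z = (x == z)%:R).
Proof.
move=> hq P0; pose M : 'M[{poly int}]_#|I| := \matrix_(i, j) P (enum_val i) (enum_val j).
have [r er] : exists r, \det M = 1 + 'X * r.
  have M0 : map_mx (horner_eval 0) M = 1%:M.
    apply/matrixP => i j; rewrite !mxE /= /horner_eval horner_coef0 P0.
    by rewrite (inj_eq enum_val_inj).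
  have : root (\det M - 1) 0.
    rewrite /root hornerD hornerN hornerC -/(horner_eval 0 (\det M)).
    by rewrite -det_map_mx M0 det1 subrr.
  case/factor_theorem => r; rewrite subr0 => e.
  by exists r; rewrite mulrC -e addrC subrK.
pose N := map_mx (zeval q) M.
have [b hb] := hq r.
have detN : \det N * b = 1 by rewrite det_map_mx er rmorphD rmorph1 rmorphM /= zevalX.
pose X := b *: \adj N.
have XN : X *m N = 1%:M.
  by rewrite -scalemxAl mul_adj_mx scale_scalar_mx mulrC detN.
have NX : N *m X = 1%:M.
  by rewrite -scalemxAr mul_mx_adj scale_scalar_mx mulrC detN.
have sumI (F : I -> B) : \sum_y F y = \sum_(j < #|I|) F (enum_val j).
  by rewrite (reindex _ (onW_bij _ (enum_val_bij I))).
exists (fun x y => X (enum_rank x) (enum_rank y)); split=> x z.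
  have := congr1 (fun m : 'M_#|I| => m (enum_rank x) (enum_rank z)) XN.
  rewrite !mxE (inj_eq enum_rank_inj) => <-; rewrite sumI.
  by apply: eq_bigr => j _; rewrite !mxE enum_valK enum_rankK.
have := congr1 (fun m : 'M_#|I| => m (enum_rank x) (enum_rank z)) NX.
rewrite !mxE (inj_eq enum_rank_inj) => <-; rewrite sumI.
by apply: eq_bigr => j _; rewrite !mxE enum_valK enum_rankK.
Qed.

Section AsymptoticRingScalars.
Variables (C : numClosedFieldType) (gT : finGroupType) (S : {set gT}) (L : gT -> int).
Hypothesis coxS : coxeter_system S.
Variables (H : hecke_algebra C S L) (c : kl_basis H).
Hypothesis hP : P1_15 c.
Implicit Types s t u w x y z d : gT.
Local Notation gam := (gam c).
Local Notation D := (calD c).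
Local Notation n_ := (nz c).

Section Multiplication.
Variable B : comNzRingType.
Local Notation J := {ffun gT -> B^o}.
Implicit Types i j k : J.

Definition jmul j k : J :=
  [ffun z => \sum_x \sum_y (j x * k y) *~ gam x y z^-1%g].

Definition jbas x : J := [ffun z => (x == z)%:R].

Definition jone : J := [ffun z => if z \in D then (n_ z)%:~R else 0].

Fact jmul_is_linear j : linear (jmul j).
Proof.
move=> a k k'; apply/ffunP => z; rewrite !ffunE scaler_sumr -big_split.
apply: eq_bigr => x _ /=; rewrite scaler_sumr -big_split; apply: eq_bigr => y _ /=.
rewrite !ffunE mulrDr mulrzDl; congr (_ + _).
by rewrite (mulrCA (j x) a (k y)) -mulrzAr.
Qed.

HB.instance Definition _ j := GRing.isLinear.Build B J J _ (jmul j) (jmul_is_linear j).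

Definition jmulr k j := jmul j k.

Fact jmulr_is_linear k : linear (jmulr k).
Proof.
move=> a j j'; apply/ffunP => z; rewrite /jmulr !ffunE scaler_sumr -big_split.
apply: eq_bigr => x _ /=; rewrite scaler_sumr -big_split; apply: eq_bigr => y _ /=.
rewrite !ffunE mulrDl mulrzDl; congr (_ + _).
by rewrite -(mulrA a (j x) (k y)) -mulrzAr.
Qed.

HB.instance Definition _ k := GRing.isLinear.Build B J J _ (jmulr k) (jmulr_is_linear k).

Lemma jmulZl a j k : jmul (a *: j) k = a *: jmul j k.
Proof. exact: (linearZ_LR (jmulr k)). Qed.

Lemma jmulZr a j k : jmul j (a *: k) = a *: jmul j k.
Proof. exact: linearZ_LR. Qed.

Lemma jmul_suml (I : Type) (r : seq I) (P : pred I) (F : I -> J) k :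
  jmul (\sum_(x <- r | P x) F x) k = \sum_(x <- r | P x) jmul (F x) k.
Proof. exact: (raddf_sum (jmulr k)). Qed.

Lemma jmul_sumr (I : Type) (r : seq I) (P : pred I) (F : I -> J) j :
  jmul j (\sum_(x <- r | P x) F x) = \sum_(x <- r | P x) jmul j (F x).
Proof. exact: raddf_sum. Qed.

Let scale_regular (a b : B) : a *: (b : B^o) = a * b. Proof. by []. Qed.

Lemma jbasE j : j = \sum_x j x *: jbas x.
Proof.
apply/ffunP => z; rewrite sum_ffunE (bigD1 z) //= big1 => [|x nx].
  by rewrite addr0 !ffunE eqxx scale_regular mulr1.
by rewrite !ffunE (negPf nx) scale_regular mulr0.
Qed.

Lemma jmul_basl x k z : jmul (jbas x) k z = \sum_y k y *~ gam x y z^-1%g.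
Proof.
rewrite ffunE (bigD1 x) //= [X in _ + X]big1 ?addr0 => [|u nu].
  by apply: eq_bigr => y _; rewrite ffunE eqxx mul1r.
by apply: big1 => w _; rewrite !ffunE eq_sym (negPf nu) mul0r mul0rz.
Qed.

Lemma jmul_basr j y z : jmul j (jbas y) z = \sum_x j x *~ gam x y z^-1%g.
Proof.
rewrite ffunE; apply: eq_bigr => x _; rewrite (bigD1 y) //= ffunE eqxx mulr1.
rewrite big1 ?addr0 // => u nu.
by rewrite !ffunE eq_sym (negPf nu) mulr0 mul0rz.
Qed.

Lemma jmulA i j k : jmul (jmul i j) k = jmul i (jmul j k).
Proof.
apply/ffunP => z; rewrite [LHS]ffunE [RHS]ffunE.
transitivity (\sum_w \sum_x \sum_y \sum_u
    (i x * j y * k w) *~ (gam x y u^-1%g * gam u w z^-1%g)).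
  rewrite exchange_big; apply: eq_bigr => w _ /=.
  rewrite [RHS]exchange_big; under [RHS]eq_bigr => y _ do rewrite exchange_big.
  rewrite [RHS]exchange_big; apply: eq_bigr => u _ /=.
  rewrite ffunE mulr_suml mulrz_suml [RHS]exchange_big; apply: eq_bigr => x _ /=.
  rewrite mulr_suml mulrz_suml; apply: eq_bigr => y _.
  by rewrite mulrzAl -mulrzA.
rewrite exchange_big; apply: eq_bigr => x _ /=.
transitivity (\sum_w \sum_y \sum_u
    (i x * j y * k w) *~ (gam y w u^-1%g * gam x u z^-1%g)).
  apply: eq_bigr => w _; apply: eq_bigr => y _.
  by rewrite -!mulrz_sumr gamA.
rewrite exchange_big; under eq_bigr => y _ do rewrite exchange_big.
rewrite exchange_big; apply: eq_bigr => u _ /=.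
rewrite ffunE mulr_sumr mulrz_suml; apply: eq_bigr => y _ /=.
rewrite mulr_sumr mulrz_suml; apply: eq_bigr => w _.
by rewrite mulrzAr -mulrzA mulrA.
Qed.

Lemma jmul1j k : jmul jone k = k.
Proof.
apply/ffunP => z; rewrite ffunE exchange_big (bigD1 z) //= [X in _ + X]big1 ?addr0 => [|y ny].
  under eq_bigr => x _ do rewrite ffunE.
  rewrite (bigID (mem D)) /= addrC big1 ?add0r => [|x /negPf->]; last first.
    by rewrite mul0r mul0rz.
  under eq_bigr => x Dx do rewrite Dx mulrzl -mulrzA.
  by rewrite -mulrz_sumr sum_gam_calDl // eqxx.
under eq_bigr => x _ do rewrite ffunE.
rewrite (bigID (mem D)) /= addrC big1 ?add0r => [|x /negPf->]; last first.
  by rewrite mul0r mul0rz.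
under eq_bigr => x Dx do rewrite Dx mulrzl -mulrzA.
by rewrite -mulrz_sumr sum_gam_calDl // (negPf ny).
Qed.

Lemma jmulj1 k : jmul k jone = k.
Proof.
apply/ffunP => z; rewrite ffunE (bigD1 z) //= [X in _ + X]big1 ?addr0 => [|y ny].
  under eq_bigr => x _ do rewrite ffunE.
  rewrite (bigID (mem D)) /= addrC big1 ?add0r => [|x /negPf->]; last first.
    by rewrite mulr0 mul0rz.
  under eq_bigr => x Dx do rewrite Dx mulrzr -mulrzA.
  by rewrite -mulrz_sumr sum_gam_calDr // eqxx.
under eq_bigr => x _ do rewrite ffunE.
rewrite (bigID (mem D)) /= addrC big1 ?add0r => [|x /negPf->]; last first.
  by rewrite mulr0 mul0rz.
under eq_bigr => x Dx do rewrite Dx mulrzr -mulrzA.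
by rewrite -mulrz_sumr sum_gam_calDr // (negPf ny).
Qed.

Definition jtwist j : J := [ffun z => j z *~ jsign c z].

Lemma jtwistK : involutive jtwist.
Proof.
by move=> j; apply/ffunP => z; rewrite !ffunE -mulrzA (jsign_sqr hP).
Qed.

Lemma jtwistM i j : jmul (jtwist i) (jtwist j) = jtwist (jmul i j).
Proof.
apply/ffunP => z; rewrite !ffunE mulrz_suml; apply: eq_bigr => x _.
rewrite mulrz_suml; apply: eq_bigr => y _; rewrite !ffunE.
have [->|nz0] := eqVneq (gam x y z^-1%g) 0; first by rewrite !mulr0z mul0rz.
rewrite -(jsign_gam hP nz0) mulrzAl mulrzAr -!mulrzA; congr (_ *~ _);
rewrite mulrA [LHS]mulrC; congr (_ * _); exact: mulrC.
Qed.

Lemma jtwistZ (b : B) j : jtwist (b *: j) = b *: jtwist j.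
Proof. by apply/ffunP => z; rewrite !ffunE scalerMzr. Qed.

Lemma jtwist_sum (I : Type) (r : seq I) (P : pred I) (F : I -> J) :
  jtwist (\sum_(i <- r | P i) F i) = \sum_(i <- r | P i) jtwist (F i).
Proof.
apply: (big_morph jtwist) => [j k|]; apply/ffunP => z; rewrite !ffunE ?mul0rz //.
by rewrite mulrzDl.
Qed.

End Multiplication.
End AsymptoticRingScalars.

(** * The homomorphism from H to J *)

Section LusztigHomomorphism.
Variables (C : numClosedFieldType) (gT : finGroupType) (S : {set gT}) (L : gT -> int).
Hypothesis coxS : coxeter_system S.
Variables (H : hecke_algebra C S L) (c : kl_basis H).
Hypothesis hP : P1_15 c.
Variable dg : dagger_involution H.
Implicit Types s t u w x y z d : gT.
Local Notation A := (laurent C).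
Local Notation vp := (vpow C).
Local Notation T := (hT H).
Local Notation hb := (@hT_basis _ _ _ _ H).
Local Notation hc := (@kl_c_basis _ _ _ _ _ c).
Local Notation klh := (klh c).
Local Notation a := (afun c).
Local Notation gam := (gam c).
Local Notation psi := (psi c).
Local Notation jmul := (jmul c).
Local Notation jmulr := (jmulr c).
Local Notation J B := {ffun gT -> B^o}.

Definition psi_dag (h : H) : J A := [ffun z => \sum_w coords c (dg h) w * psi w z].

Lemma psi_dagD g h : psi_dag (g + h) = psi_dag g + psi_dag h.
Proof.
apply/ffunP => z; rewrite !ffunE -big_split; apply: eq_bigr => w _ /=.
by rewrite rmorphD /= (coordsD hc) mulrDl.
Qed.

Lemma psi_dagZ (b : A) h : psi_dag (b *: h) = b *: psi_dag h.
Proof.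
apply/ffunP => z; rewrite !ffunE scaler_sumr; apply: eq_bigr => w _ /=.
by rewrite linearZ /= (coordsZ hc) -mulrA.
Qed.

Lemma psi_dag_kl w z : psi_dag (dg (c w)) z = psi w z.
Proof.
rewrite ffunE dagK (bigD1 w) //= (coords_basis hc) eqxx mul1r big1 ?addr0 // => u nu.
by rewrite (coords_basis hc) eq_sym (negPf nu) mul0r.
Qed.

Lemma coords_dag_kl h w : coords (fun w => dg (c w)) h w = coords c (dg h) w.
Proof.
suff hb' : is_basis *:%R (fun w => dg (c w) : H).
  rewrite -{1}[h](dagK dg) {1}(coordsE hc (dg h)) linear_sum /=.
  by under eq_bigr => u _ do rewrite linearZ /=; rewrite (coords_sum hb').
move=> m; have [k [hk uk]] := hc (dg m); exists k; split.
  rewrite -{1}[m](dagK dg) hk linear_sum /=.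
  by apply: eq_bigr => u _; rewrite linearZ.
move=> k' hk'; apply: uk; rewrite hk' linear_sum /=.
by apply: eq_bigr => u _; rewrite linearZ /= dagK.
Qed.

Lemma phiE h z : phi c dg h z = psi_dag h z *~ jsign c z.
Proof.
rewrite /phi sum_ffunE [psi_dag h z]ffunE mulrz_suml; apply: eq_bigr => w _.
by rewrite ffunE coords_dag_kl phi_cdagE // mulrzAr.
Qed.

Lemma coords_klM g h z :
  coords c (g * h) z = \sum_x \sum_y coords c g x * coords c h y * klh x y z.
Proof.
rewrite {1}(coordsE hc g) mulr_suml (coords_bigsum hc); apply: eq_bigr => x _.
rewrite {1}(coordsE hc h) -scalerAl mulr_sumr (coordsZ hc) (coords_bigsum hc).
rewrite mulr_sumr; apply: eq_bigr => y _.
by rewrite -scalerAr (coordsZ hc) mulrA.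
Qed.

Lemma psi_dagM g h : psi_dag (g * h) = jmul (psi_dag g) (psi_dag h).
Proof.
apply/ffunP => z; rewrite [LHS]ffunE rmorphM /=.
transitivity (\sum_x \sum_y coords c (dg g) x * coords c (dg h) y *
    (\sum_w klh x y w * psi w z)).
  under eq_bigr => w _ do rewrite coords_klM mulr_suml.
  rewrite exchange_big; apply: eq_bigr => x _ /=.
  under eq_bigr => w _ do rewrite mulr_suml.
  rewrite exchange_big; apply: eq_bigr => y _ /=.
  by rewrite mulr_sumr; apply: eq_bigr => w _; rewrite mulrA.
have -> : jmul (psi_dag g) (psi_dag h) z = \sum_x \sum_y
    coords c (dg g) x * coords c (dg h) y *
    (\sum_u \sum_w psi x u * psi y w *~ gam u w z^-1%g).
  rewrite ffunE; under eq_bigr => u _ do under eq_bigr => w _ do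
    rewrite !ffunE mulr_suml mulrz_suml.
  under eq_bigr => u _ do rewrite exchange_big.
  rewrite exchange_big; apply: eq_bigr => x _ /=.
  under eq_bigr => u _ do under eq_bigr => w _ do rewrite mulr_sumr mulrz_suml.
  under eq_bigr => u _ do rewrite exchange_big.
  rewrite exchange_big; apply: eq_bigr => y _ /=.
  rewrite mulr_sumr; apply: eq_bigr => u _; rewrite [RHS]mulr_sumr.
  apply: eq_bigr => w _.
  by rewrite mulrACA mulrzAr.
by apply: eq_bigr => x _; apply: eq_bigr => y _; rewrite psi_mul.
Qed.

Lemma psi_dag1 : psi_dag 1 = jone c A.
Proof.
have -> : 1 = dg (c 1%g) :> H by rewrite kl_c1 // rmorph1.
by apply/ffunP => z; rewrite psi_dag_kl psi1 // ffunE.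
Qed.

Section Scalars.
Variables (B : comNzRingType) (theta : {rmorphism A -> B}) (HB : scalar_extension H theta).
Local Notation extT := (fun w => ext_in HB (T w)).
Local Notation he := (@ext_basis _ _ _ _ _ _ _ HB).

Definition psi_ext (h : HB) : J B :=
  [ffun z => \sum_w coords extT h w * theta (psi_dag (T w) z)].

Fact psi_ext_is_linear : linear psi_ext.
Proof.
move=> b g h; apply/ffunP => z; rewrite !ffunE scaler_sumr -big_split.
apply: eq_bigr => w _ /=.
by rewrite (coordsD he) (coordsZ he) mulrDl -mulrA.
Qed.

HB.instance Definition _ := GRing.isLinear.Build B HB (J B) _ psi_ext psi_ext_is_linear.

Lemma psi_ext_in h z : psi_ext (ext_in HB h) z = theta (psi_dag h z).
Proof.
have e : ext_in HB h = \sum_w theta (coords T h w) *: extT w.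
  by rewrite {1}(coordsE hb h) rmorph_sum; apply: eq_bigr => w _; rewrite /= ext_inZ.
rewrite ffunE e; under eq_bigr => w _ do rewrite (coords_sum he) -rmorphM.
rewrite -rmorph_sum; congr (theta _).
rewrite [in RHS](coordsE hb h) (big_morph psi_dag psi_dagD (id1 := 0)); last first.
  by rewrite -(scale0r 0) psi_dagZ scale0r.
by rewrite sum_ffunE; apply: eq_bigr => w _; rewrite psi_dagZ !ffunE.
Qed.

Lemma psi_ext1 : psi_ext 1 = jone c B.
Proof.
apply/ffunP => z; rewrite -(rmorph1 (ext_in HB)) psi_ext_in psi_dag1 !ffunE.
by case: ifP; rewrite ?rmorph_int ?rmorph0.
Qed.

Lemma psi_extM g h : psi_ext (g * h) = jmul (psi_ext g) (psi_ext h).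
Proof.
rewrite (coordsE he g) mulr_suml !linear_sum jmul_suml; apply: eq_bigr => x _ /=.
rewrite linearZ /= jmulZl -scalerAl linearZ /=; congr (_ *: _).
rewrite (coordsE he h) mulr_sumr !linear_sum; apply: eq_bigr => y _ /=.
rewrite linearZ /= jmulZr -scalerAr linearZ /=; congr (_ *: _); apply/ffunP => z.
rewrite -rmorphM psi_ext_in psi_dagM !ffunE rmorph_sum; apply: eq_bigr => u _ /=.
rewrite rmorph_sum; apply: eq_bigr => w _ /=.
by rewrite !psi_ext_in rmorphMz rmorphM.
Qed.

Lemma ext_dag_span h : exists k : gT -> B, h = \sum_w k w *: ext_in HB (dg (c w)).
Proof.
exists (fun w => \sum_u coords extT h u * theta (coords c (dg (T u)) w)).
rewrite {1}(coordsE he h).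
under [RHS]eq_bigr => w _ do rewrite scaler_suml.
rewrite [RHS]exchange_big; apply: eq_bigr => u _ /=.
under eq_bigr => w _ do rewrite -scalerA.
rewrite -scaler_sumr; congr (_ *: _).
rewrite -{1}[T u](dagK dg) {1}(coordsE hc (dg (T u))) !rmorph_sum.
by apply: eq_bigr => w _ /=; rewrite linearZ /= ext_inZ.
Qed.

Hypothesis unit_theta : forall r : {poly int},
  exists b, (1 + theta (vp 1) * zeval (theta (vp 1)) r) * b = 1.

(** From the spanning family [c_w^dag] to the rescaled basis [v^(- a z) t_z], the matrix is that of
    [psi_low]. One inverse identity gives injectivity, the other the explicit right inverse [f]. *)
Lemma psi_ext_bijective : exists2 f : J B -> HB, cancel f psi_ext & cancel psi_ext f.
Proof.
have /choice[p hp] : forall xz : gT * gT, exists p : {poly int},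
    psi xz.1 xz.2 = vp (- (a xz.2)%:Z) * zeval (vp 1) p /\ p`_0 = (xz.1 == xz.2)%:R.
  by move=> [x z]; have [p e p0] := psi_low coxS hP x z; exists p.
have [X [XN NX]] := zeval_matrix_inverse (P := fun x z => p (x, z)) unit_theta
  (fun x z => (hp (x, z)).2).
have thpsi x z : theta (psi x z) = theta (vp (- (a z)%:Z)) * zeval (theta (vp 1)) (p (x, z)).
  by rewrite (hp (x, z)).1 rmorphM rmorph_zeval.
have thV z : theta (vp (a z)%:Z) * theta (vp (- (a z)%:Z)) = 1.
  by rewrite -rmorphM vpowVr rmorph1.
have inj h : psi_ext h = 0 -> h = 0.
  have [k ->] := ext_dag_span h => /ffunP e0.
  suff k0 x : k x = 0 by rewrite big1 // => w _; rewrite k0 scale0r.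
  have e1 z : \sum_w k w * zeval (theta (vp 1)) (p (w, z)) = 0.
    have := e0 z; rewrite linear_sum sum_ffunE ffunE => /(congr1 ( *%R (theta (vp (a z)%:Z)))).
    rewrite mulr0 mulr_sumr => e; rewrite -[RHS]e; apply: eq_bigr => w _.
    rewrite linearZ ffunE /= psi_ext_in psi_dag_kl thpsi -[_ *: _]/(_ * _).
    by rewrite mulrCA (mulrA (theta _)) thV mul1r.
  transitivity (\sum_w k w * (w == x)%:R).
    rewrite (bigD1 x) //= eqxx mulr1 big1 ?addr0 // => w nw.
    by rewrite (negPf nw) mulr0.
  under eq_bigr => w _ do rewrite -NX mulr_sumr.
  rewrite exchange_big big1 // => z _ /=.
  by under eq_bigr => w _ do rewrite mulrA; rewrite -mulr_suml e1 mul0r.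
pose f (j : J B) := \sum_z j z *:
  \sum_x (theta (vp (a z)%:Z) * X z x) *: ext_in HB (dg (c x)).
have fK : cancel f psi_ext.
  move=> j; rewrite [RHS]jbasE linear_sum; apply: eq_bigr => z _.
  rewrite linearZ /=; congr (_ *: _); rewrite linear_sum; apply/ffunP => y.
  rewrite sum_ffunE ffunE.
  transitivity (theta (vp (a z)%:Z) * theta (vp (- (a y)%:Z)) * (z == y)%:R).
    rewrite -XN mulr_sumr; apply: eq_bigr => x _.
    rewrite linearZ ffunE /= psi_ext_in psi_dag_kl thpsi -[_ *: _]/(_ * _).
    by rewrite mulrACA.
  by case: eqP => [->|_]; rewrite ?mulr0 // mulr1 thV.
exists f => // h; apply/eqP; rewrite -subr_eq0; apply/eqP/inj.
by rewrite linearB /= fK subrr.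
Qed.

End Scalars.
End LusztigHomomorphism.

(** * Left cell modules *)

Lemma submodB (R : nzRingType) (M : lmodType R) (U : submodClosed M) (x y : M) :
  x \in U -> y \in U -> x - y \in U.
Proof. by move=> Ux Uy; rewrite -scaleN1r; apply: rpredD => //; apply: rpredZ. Qed.

Section CellModule.
Variables (C : numClosedFieldType) (gT : finGroupType) (S : {set gT}) (L : gT -> int).
Hypothesis coxS : coxeter_system S.
Variables (H : hecke_algebra C S L) (c : kl_basis H).
Hypothesis hP : P1_15 c.
Variable dg : dagger_involution H.
Variables (B : comNzRingType) (theta : {rmorphism laurent C -> B}).
Variable HB : scalar_extension H theta.
Hypothesis unit_theta : forall r : {poly int},
  exists b, (1 + theta (vpow C 1) * zeval (theta (vpow C 1)) r) * b = 1.
Variables (Gamma : {set gT}) (M : cell_module c dg Gamma HB).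
Hypothesis cellGamma : left_cell c Gamma.
Implicit Types w x y z : gT.
Local Notation J := {ffun gT -> B^o}.
Implicit Types (j k p : J) (m : M).
Local Notation jmul := (jmul c).
Local Notation Psi := (psi_ext c dg (HB := HB)).
Local Notation jone := (jone c B).

Lemma left_cell_simL x y : x \in Gamma -> simL c x y = (y \in Gamma).
Proof.
case: cellGamma => x0 ->; rewrite !inE => h; apply/idP/idP => h'.
  exact: simL_trans h h'.
by apply: simL_trans h'; rewrite simL_sym.
Qed.

(** Restriction of coordinates to [Gamma], a surjection from [J_B] onto the cell module. With
    [cell_sec], extension by zero, it exhibits the module as a direct summand of [J_B] once both are
    shown compatible with [psi_ext]. *)
Definition cell_emb j : M := \sum_y ((j (val y))%:A : HB) *: cell_c M y.

Definition cell_sec m : J :=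
  let b := xget [ffun=> 0] [set b : {ffun {y : gT | y \in Gamma} -> B} |
    m = \sum_y ((b y)%:A : HB) *: cell_c M y]%classic in
  [ffun x => oapp b 0 (insub x)].

Lemma cell_emb_inj j k : cell_emb j = cell_emb k -> {in Gamma, j =1 k}.
Proof.
move=> e x Gx; have [b [_ ub]] := @cell_basis _ _ _ _ _ _ _ _ _ _ _ M (cell_emb j).
have h (i : J) : cell_emb j = cell_emb i -> b = [ffun y => i (val y)].
  by move=> ei; apply: ub; rewrite ei; apply: eq_bigr => y _; rewrite ffunE.
have := h _ e; rewrite (h j erefl) => /ffunP/(_ (Sub x Gx)).
by rewrite !ffunE SubK.
Qed.

Lemma cell_secK m : cell_emb (cell_sec m) = m.
Proof.
rewrite /cell_emb /cell_sec; case: xgetP => [b _ e | ]; last first.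
  have [b [hb _]] := @cell_basis _ _ _ _ _ _ _ _ _ _ _ M m.
  by move/(_ b); case.
by rewrite [RHS]e; apply: eq_bigr => y _; rewrite ffunE valK.
Qed.

Lemma cell_sec_notin m x : x \notin Gamma -> cell_sec m x = 0.
Proof. by move=> Gx; rewrite ffunE insubN. Qed.

Lemma cell_embD j k : cell_emb (j + k) = cell_emb j + cell_emb k.
Proof.
by rewrite -big_split; apply: eq_bigr => y _; rewrite !ffunE !scalerDl.
Qed.

Lemma cell_embZ r j : cell_emb (r *: j) = (r%:A : HB) *: cell_emb j.
Proof.
rewrite scaler_sumr; apply: eq_bigr => y _.
by rewrite ffunE scalerA -scalerAl mul1r scalerA.
Qed.

Lemma cell_emb0 : cell_emb 0 = 0.
Proof. by rewrite -(scale0r 0) cell_embZ !scale0r. Qed.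

Lemma cell_emb_sum (I : Type) (r : seq I) (P : pred I) (F : I -> J) :
  cell_emb (\sum_(i <- r | P i) F i) = \sum_(i <- r | P i) cell_emb (F i).
Proof. exact: (big_morph _ cell_embD cell_emb0). Qed.

Lemma cell_emb_supp j k : {in Gamma, j =1 k} -> cell_emb j = cell_emb k.
Proof. by move=> e; apply: eq_bigr => y _; rewrite e ?(valP y). Qed.

Lemma cell_secD m m' : cell_sec (m + m') = cell_sec m + cell_sec m'.
Proof.
apply/ffunP => x; have [Gx|Gx] := boolP (x \in Gamma).
  by apply: cell_emb_inj Gx; rewrite cell_embD !cell_secK.
by rewrite [RHS]ffunE !cell_sec_notin // addr0.
Qed.

Lemma cell_sec_emb j x : cell_sec (cell_emb j) x = if x \in Gamma then j x else 0.
Proof.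
case: ifP => Gx; last by rewrite cell_sec_notin ?Gx.
by apply: cell_emb_inj Gx; rewrite cell_secK.
Qed.

Lemma psi_ext_dag_kl w z : Psi (ext_in HB (dg (c w))) z = theta (psi c w z).
Proof. by rewrite psi_ext_in psi_dag_kl. Qed.

(** Left multiplication by the image of [c_w^dag] is [gract c w]. Inside [Gamma] the function [a] is
    constant, so [gract] is [klh]; nothing enters [Gamma] from outside, by [gract_simL]. *)
Lemma cell_emb_act h j : cell_emb (jmul (Psi h) j) = h *: cell_emb j.
Proof.
have bas w x : cell_emb (jmul (Psi (ext_in HB (dg (c w)))) (jbas B x)) =
               ext_in HB (dg (c w)) *: cell_emb (jbas B x).
  have coef z : jmul (Psi (ext_in HB (dg (c w)))) (jbas B x) z = theta (gract c w x z).
    rewrite jmul_basr -psi_gam // rmorph_sum; apply: eq_bigr => u _.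
    by rewrite psi_ext_dag_kl /= rmorphMz.
  have [Gx|Gx] := boolP (x \in Gamma).
    have -> : cell_emb (jbas B x) = cell_c M (Sub x Gx).
      rewrite /cell_emb (bigD1 (Sub x Gx)) //= ffunE eqxx !scale1r big1 ?addr0 // => y ny.
      rewrite ffunE; case: eqP => [e|_]; last by rewrite !scale0r.
      by case/eqP: ny; apply: val_inj; rewrite SubK.
    rewrite cell_act; apply: eq_bigr => z _; rewrite coef SubK /gract.
    have : simL c x (val z) by rewrite left_cell_simL ?(valP z).
    by move/(afun_simL hP)->; rewrite eqxx.
  rewrite (cell_emb_supp (k := 0)) => [|z Gz].
    rewrite (cell_emb_supp (k := 0)) => [|z Gz]; first by rewrite cell_emb0 scaler0.
    by rewrite !ffunE; case: eqP => // e; rewrite e Gz in Gx.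
  rewrite coef ffunE; have [-> | /(gract_simL coxS hP)] := eqVneq (gract c w x z) 0.
    by rewrite rmorph0.
  by rewrite simL_sym left_cell_simL // (negPf Gx).
have act1 w : cell_emb (jmul (Psi (ext_in HB (dg (c w)))) j) =
              ext_in HB (dg (c w)) *: cell_emb j.
  rewrite {1}(jbasE j) linear_sum cell_emb_sum {2}(jbasE j) cell_emb_sum scaler_sumr.
  apply: eq_bigr => x _; rewrite linearZ /= !cell_embZ bas !scalerA.
  by rewrite mulr_algl mulr_algr.
have [k ->] := ext_dag_span c dg h.
rewrite linear_sum jmul_suml cell_emb_sum scaler_suml; apply: eq_bigr => w _.
by rewrite linearZ /= jmulZl cell_embZ act1 scalerA mulr_algl.
Qed.

(** By (P8) the [t_y] with [y] in [Gamma] span a left ideal of [J], so the product has no coordinate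
    outside [Gamma]. *)
Lemma cell_sec_act h m : cell_sec (h *: m) = jmul (Psi h) (cell_sec m).
Proof.
apply/ffunP => x; rewrite -{1}(cell_secK m) -cell_emb_act cell_sec_emb.
case: ifP => // Gx; rewrite ffunE; apply/esym; apply: big1 => u _.
apply: big1 => w _; have [-> | /(gam_simL hP)[_ + _]] := eqVneq (gam c u w x^-1%g) 0.
  by rewrite mulr0z.
rewrite invgK => wx; rewrite cell_sec_notin ?mulr0 ?mul0rz //.
by apply: contraFN Gx => Gw; rewrite -(left_cell_simL _ Gw).
Qed.

Let Phi_ex := psi_ext_bijective coxS hP dg HB unit_theta.

(** The image of the unit generates [M], with [m = Phi (cell_sec m) *: cell_emb jone]. Choosing one
    preimage [p0] of its image under [f] and using the same coefficients yields the lift. *)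
Lemma cell_projective : projective M.
Proof.
have [Phi PhiK PsiK] := Phi_ex; move=> P Q g f gsurj.
have [p0 gp0] := gsurj (f (cell_emb jone)).
have PhiP i j h : Phi (jmul (Psi h) i + j) = h * Phi i + Phi j.
  by apply: (can_inj PsiK); rewrite PhiK [RHS]linearD /= psi_extM // !PhiK.
pose h0 m : P := Phi (cell_sec m) *: p0.
have h0_linear : linear h0.
  by move=> h m m'; rewrite /h0 cell_secD cell_sec_act PhiP scalerDl scalerA.
pose h1 := GRing.isLinear.Build HB M P _ h0 h0_linear.
pose h2 : {linear M -> P} := HB.pack h0 h1.
exists h2 => m; rewrite -[h2 m]/(Phi (cell_sec m) *: p0) linearZ /= gp0.
by rewrite -linearZ /= -cell_emb_act PhiK jmulj1 // cell_secK.
Qed.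

(** [p] and [q] are the sections of the components [u0], [w0] of the generator. For [m] in [U] the
    component along [w0] lies in both [U] and [V], so [m = Phi (cell_sec m) *: u0]; taking [m = u0]
    gives idempotency, and [u0 = 0] kills [U]. *)
Lemma cell_direct_sum (U V : submodClosed M) :
  (forall m, exists u v : M, [/\ u \in U, v \in V & m = u + v]) ->
  (forall m, m \in U -> m \in V -> m = 0) ->
  exists p q : J, [/\ p + q = cell_sec (cell_emb jone),
    jmul p p = p /\ jmul q q = q,
    forall x, x \notin Gamma -> p x = 0 /\ q x = 0,
    p = 0 -> (forall m, m \in U -> m = 0) &
    q = 0 -> (forall m, m \in V -> m = 0)].
Proof.
move=> UV UV0; have [Phi PhiK PsiK] := Phi_ex.
have [u0 [w0 [Uu Vw e1]]] := UV (cell_emb jone).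
have mE m : m = Phi (cell_sec m) *: u0 + Phi (cell_sec m) *: w0.
  by rewrite -scalerDr -e1 -cell_emb_act PhiK jmulj1 // cell_secK.
have UE m : m \in U -> m = Phi (cell_sec m) *: u0.
  move=> Um; rewrite {1}(mE m); have -> : Phi (cell_sec m) *: w0 = 0; last by rewrite addr0.
  apply: UV0; last exact: rpredZ.
  rewrite (_ : _ *: w0 = m - Phi (cell_sec m) *: u0); first by apply: submodB => //; apply: rpredZ.
  by rewrite {2}(mE m) addrC addKr.
have VE m : m \in V -> m = Phi (cell_sec m) *: w0.
  move=> Vm; rewrite {1}(mE m); have -> : Phi (cell_sec m) *: u0 = 0; last by rewrite add0r.
  apply: UV0; first exact: rpredZ.
  rewrite (_ : _ *: u0 = m - Phi (cell_sec m) *: w0); first by apply: submodB => //; apply: rpredZ.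
  by rewrite {2}(mE m) addrK.
exists (cell_sec u0), (cell_sec w0); split.
- by rewrite -cell_secD e1.
- by split; [rewrite -{1}(PhiK (cell_sec u0)) -cell_sec_act -UE
           | rewrite -{1}(PhiK (cell_sec w0)) -cell_sec_act -VE].
- by move=> x Gx; rewrite !cell_sec_notin.
- by move=> p0 m /UE ->; rewrite -(cell_secK u0) p0 cell_emb0 scaler0.
- by move=> q0 m /VE ->; rewrite -(cell_secK w0) q0 cell_emb0 scaler0.
Qed.

End CellModule.

(** * Specialization at v = 1 *)

Lemma trace_basis (B : comNzRingType) (M : algType B) (I : finType) (b c : I -> M) :
  is_basis *:%R b -> is_basis *:%R c -> forall h : M,
  \sum_i coords c (h * c i) i = \sum_i coords b (h * b i) i.
Proof.
move=> hb hc h.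
have cE m i : coords c m i = \sum_t coords b m t * coords c (b t) i.
  rewrite {1}(coordsE hb m) (coords_bigsum hc).
  by apply: eq_bigr => t _; rewrite (coordsZ hc).
have bE m t : coords b (h * m) t = \sum_s coords b m s * coords b (h * b s) t.
  rewrite {1}(coordsE hb m) mulr_sumr (coords_bigsum hb).
  by apply: eq_bigr => s _; rewrite -scalerAr (coordsZ hb).
have dE t s : \sum_i coords c (b t) i * coords b (c i) s = (t == s)%:R.
  rewrite -(coords_basis hb) [in RHS](coordsE hc (b t)) (coords_bigsum hb).
  by apply: eq_bigr => i _; rewrite (coordsZ hb).
under eq_bigr => i _ do rewrite cE.
rewrite exchange_big; apply: eq_bigr => t _ /=.
under eq_bigr => i _ do rewrite bE mulr_suml.
rewrite exchange_big (bigD1 t) //= [X in _ + X]big1 ?addr0 => [|s ns].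
  under eq_bigr => i _ do rewrite mulrAC [_ * coords c _ _]mulrC.
  by rewrite -mulr_suml dE eqxx mul1r.
under eq_bigr => i _ do rewrite mulrAC [_ * coords c _ _]mulrC.
by rewrite -mulr_suml dE eq_sym (negPf ns) mul0r.
Qed.

Section SpecializationAtOne.
Variables (C : numClosedFieldType) (gT : finGroupType) (S : {set gT}) (L : gT -> int).
Hypothesis coxS : coxeter_system S.
Variables (H : hecke_algebra C S L) (c : kl_basis H).
Hypothesis hP : P1_15 c.
Variable dg : dagger_involution H.
Implicit Types s t u w x y z d : gT.
Local Notation A := (laurent C).
Local Notation vp := (vpow C).
Local Notation T := (hT H).
Local Notation hb := (@hT_basis _ _ _ _ H).
Local Notation hc := (@kl_c_basis _ _ _ _ _ c).
Local Notation gam := (gam c).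
Local Notation jmul := (jmul c).
Local Notation JC := (JC C gT).
Local Notation jbas := (jbas C).
Local Notation jtwist := (jtwist c).

Definition leval1 : A -> C := leval (1 : C).

HB.instance Definition _ := GRing.isZmodMorphism.Build A C leval1
  (leval_is_zmod_morphism (unitr1 C)).
HB.instance Definition _ := GRing.isMonoidMorphism.Build A C leval1
  (leval_is_monoid_morphism C (unitr1 C)).

Lemma leval1_vpow i : leval1 (vp i) = 1.
Proof.
have pos (n : nat) : leval1 (vp n%:Z) = 1.
  by rewrite vpow_nat rmorphXn /= /leval1 leval_vpow1 ?unitr1 // expr1n.
case: i => n; first exact: pos.
rewrite NegzE -[LHS]mulr1 -[X in _ * X](pos n.+1) -rmorphM /=.
by rewrite vpowNr rmorph1.
Qed.

(** Image of [T_w] under [psi] at [v = 1]. There [v_s - v_s^-1] vanishes, so these elements multiply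
    as in [W]. *)
Definition jgroup w : JC := [ffun z => leval1 (psi_dag c dg (T w) z)].

Lemma jgroup_gen s w : s \in S -> jmul (jgroup s) (jgroup w) = jgroup (s * w)%g.
Proof.
move=> Ss; have -> : jmul (jgroup s) (jgroup w) =
    [ffun z => leval1 (psi_dag c dg (T s * T w) z)].
  apply/ffunP => z; rewrite psi_dagM // !ffunE rmorph_sum; apply: eq_bigr => x _.
  rewrite rmorph_sum; apply: eq_bigr => y _ /=.
  by rewrite !ffunE rmorphMz rmorphM.
apply/ffunP => z; rewrite ffunE [RHS]ffunE.
have [l|l] := len_gen_mul coxS w Ss; first by rewrite hT_gen_up.
have fD (j k : {ffun gT -> A^o}) : (j + k) z = j z + k z by rewrite ffunE.
have fZ (b : A) (j : {ffun gT -> A^o}) : (b *: j) z = b * j z by rewrite ffunE.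
rewrite (hT_gen_down H Ss l) psi_dagD psi_dagZ fD fZ rmorphD.
by rewrite rmorphM rmorphB /= !leval1_vpow subrr mul0r addr0.
Qed.

Lemma jgroup1 : jgroup 1%g = jone c C.
Proof.
apply/ffunP => z; rewrite ffunE hT1 psi_dag1 // !ffunE.
by case: ifP; rewrite ?rmorph_int ?rmorph0.
Qed.

Lemma jgroupM x y : jmul (jgroup x) (jgroup y) = jgroup (x * y)%g.
Proof.
elim/(coxeter_ind coxS): x y => [|s u Ss _ IH] y; first by rewrite jgroup1 (jmul1j hP) mul1g.
by rewrite -(jgroup_gen u Ss) (jmulA coxS hP) IH (jgroup_gen _ Ss) mulgA.
Qed.

(** At [v = 1] the generator [T_s] is its own inverse, so [T_s^dag] becomes [- T_s]: the regular
    representation twisted by the sign. *)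
Lemma leval1_dag_hT w h y :
  leval1 (coords T (dg (T w) * h) y) =
  (-1) ^+ len S w * leval1 (coords T h (w^-1 * y)%g).
Proof.
have Ts s g x : s \in S -> leval1 (coords T (T s * g) x) = leval1 (coords T g (s * x)%g).
  move=> Ss; have ss z : (s * (s * z))%g = z by apply: (coxeterK coxS).
  rewrite {1}(coordsE hb g) mulr_sumr (coords_bigsum hb) rmorph_sum.
  transitivity (\sum_u leval1 (coords T g u) * (u == (s * x)%g)%:R).
    apply: eq_bigr => u _ /=; rewrite -scalerAr (coordsZ hb) rmorphM; congr (_ * _).
    have -> : (u == (s * x)%g) = ((s * u)%g == x).
      by apply/eqP/eqP => [->|<-]; rewrite ss.
    have [l|l] := len_gen_mul coxS u Ss.
      by rewrite hT_gen_up // (coords_basis hb) rmorph_nat.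
    rewrite hT_gen_down // (coordsD hb) (coordsZ hb) rmorphD rmorphM rmorphB /=.
    by rewrite !leval1_vpow subrr mul0r addr0 (coords_basis hb) rmorph_nat.
  rewrite (bigD1 (s * x)%g) //= eqxx mulr1 big1 ?addr0 // => u nu.
  by rewrite (negPf nu) mulr0.
have dTs s g x : s \in S -> leval1 (coords T (dg (T s) * g) x) =
    - leval1 (coords T g (s * x)%g).
  move=> Ss; have [_ e] := dag_T dg Ss.
  rewrite -[x in LHS](coxeterK coxS x Ss) -Ts // mulrA e mulN1r (coordsN hb).
  by rewrite rmorphN.
elim/(coxeter_ind coxS): w h y => [|s u Ss lsu IH] h y.
  by rewrite hT1 rmorph1 mul1r len1 // expr0 mul1r invg1 mul1g.
rewrite -(hT_gen_up H Ss lsu) rmorphM /= -mulrA dTs // IH lsu exprS mulN1r mulNr.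
by rewrite invMg (coxeter_inv coxS Ss) mulgA.
Qed.

(* In the basis c_y the matrix of the left multiplication by T_w^dag is
   triangular for the a-filtration, with diagonal blocks given by J; at v = 1,
   in the basis T_y, it is a signed permutation matrix. *)
Lemma jgroup_trace w :
  \sum_y jmul (jgroup w) (jbas y) y = if w == 1%g then #|gT|%:R else 0.
Proof.
have -> : \sum_y jmul (jgroup w) (jbas y) y =
    leval1 (\sum_y coords c (dg (T w) * c y) y).
  rewrite rmorph_sum; apply: eq_bigr => y _ /=.
  have -> : coords c (dg (T w) * c y) y =
      \sum_x coords c (dg (T w)) x * gract c x y y.
    rewrite {1}(coordsE hc (dg (T w))) mulr_suml (coords_bigsum hc).
    by apply: eq_bigr => x _; rewrite -scalerAl (coordsZ hc) /gract eqxx.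
  under eq_bigr => x _ do rewrite -psi_gam // mulr_sumr.
  rewrite exchange_big rmorph_sum jmul_basr; apply: eq_bigr => u _ /=.
  rewrite !ffunE -raddfMz /= mulrz_suml; congr (leval1 _).
  by apply: eq_bigr => x _; rewrite mulrzAr.
rewrite (trace_basis hb hc) rmorph_sum /=.
under eq_bigr => y _ do rewrite leval1_dag_hT (coords_basis hb) rmorph_nat.
case: eqP => [->|nw].
  rewrite len1 // invg1; under eq_bigr => y _ do rewrite mul1g eqxx mulr1.
  by rewrite expr0 sumr_const.
apply: big1 => y _; case: eqP => [e|]; last by rewrite mulr0.
case: nw; apply: (mulIg y); rewrite mul1g.
by rewrite {1}e mulKVg.
Qed.

Lemma phi1E (u : CW C gT) : phi1 c dg u = \sum_w u w *: jtwist (jgroup w).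
Proof.
apply/ffunP => z; rewrite sum_ffunE ffunE; apply: eq_bigr => w _.
rewrite (phiE coxS hP) -[leval 1 _]/(leval1 _) rmorphMz.
by rewrite [RHS]ffunE [X in _ *: X]ffunE [jgroup w z]ffunE.
Qed.

Fact phi1_is_linear : linear (phi1 c dg).
Proof.
move=> b u u'; rewrite !phi1E scaler_sumr -big_split; apply: eq_bigr => w _ /=.
by rewrite !ffunE scalerDl scalerA.
Qed.

HB.instance Definition _ :=
  GRing.isLinear.Build C (CW C gT) JC _ (phi1 c dg) phi1_is_linear.

(** Translate a relation by [x^-1] and take the trace of left multiplication: by [jgroup_trace] only
    the term [#|W| * u x] remains, and the characteristic is 0. *)
Lemma phi1_inj (u : CW C gT) : phi1 c dg u = 0 -> u = 0.
Proof.
rewrite phi1E => e; have {}e : \sum_w u w *: jgroup w = 0.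
  rewrite -[LHS](jtwistK hP) jtwist_sum; under eq_bigr => w _ do rewrite jtwistZ.
  by rewrite e; apply/ffunP => z; rewrite !ffunE mul0rz.
apply/ffunP => x; rewrite [RHS]ffunE.
have := congr1 (jmul (jgroup x^-1%g)) e; rewrite linear0 linear_sum /=.
under eq_bigr => w _ do rewrite linearZ /= jgroupM.
move=> /(congr1 (fun j => \sum_y jmul j (jbas y) y)).
have tr0 : \sum_y jmul 0 (jbas y) y = 0 :> C.
  apply: big1 => y _; rewrite jmul_basr; apply: big1 => z _.
  by rewrite ffunE mul0rz.
rewrite /= tr0; under eq_bigr => y _ do rewrite jmul_suml sum_ffunE.
rewrite exchange_big /=.
have trE w : \sum_y jmul (u w *: jgroup (x^-1 * w)%g) (jbas y) y =
    u w * (if w == x then #|gT|%:R else 0).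
  have -> : (w == x) = (x^-1 * w == 1)%g by rewrite -eq_mulVg1 eq_sym.
  rewrite -jgroup_trace mulr_sumr; apply: eq_bigr => y _.
  by rewrite jmulZl ffunE.
under eq_bigr => w _ do rewrite trE.
rewrite (bigD1 x) //= eqxx big1 => [|w /negPf->]; last by rewrite mulr0.
rewrite addr0 => /eqP; rewrite mulf_eq0 pnatr_eq0 => /orP[/eqP // | /eqP c0].
by have := fintype0 x c0.
Qed.

Lemma phi1_invK : cancel (phi1_inv c dg) (phi1 c dg).
Proof.
move=> j; have k0 : (lker (linfun (phi1 c dg)) == 0)%VS.
  apply/lker0P => u v; rewrite !lfunE /= => /eqP; rewrite -subr_eq0 -linearB /=.
  by move=> /eqP/phi1_inj/eqP; rewrite subr_eq0 => /eqP.
by rewrite /phi1_inv -[LHS](lfunE (phi1 c dg)) /= lker0_lfunVK.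
Qed.

Lemma phi1K : cancel (phi1 c dg) (phi1_inv c dg).
Proof.
move=> u; apply/eqP; rewrite -subr_eq0; apply/eqP/phi1_inj.
by rewrite linearB /= phi1_invK subrr.
Qed.

Section Spade.
Variables (n : nat) (rE : mx_representation C [set: gT] n).
Local Notation rho := (spade c dg rE).

Lemma spade_phi1 (f : CW C gT) : rho (phi1 c dg f) = \sum_w f w *: rE w.
Proof. by rewrite /spade phi1K. Qed.

Fact spade_is_linear : linear rho.
Proof.
move=> b i j; rewrite -(phi1_invK i) -(phi1_invK j) -linearP !spade_phi1.
rewrite scaler_sumr -big_split; apply: eq_bigr => w _ /=.
by rewrite !ffunE scalerDl scalerA.
Qed.

HB.instance Definition _ := GRing.isLinear.Build C JC _ _ rho spade_is_linear.

Lemma spadeZ (b : C) j : rho (b *: j) = b *: rho j.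
Proof. exact: linearZ_LR. Qed.

Lemma spade_sum (I : Type) (r : seq I) (P : pred I) (F : I -> JC) :
  rho (\sum_(i <- r | P i) F i) = \sum_(i <- r | P i) rho (F i).
Proof. exact: raddf_sum. Qed.

Lemma spade_jgroup w : rho (jtwist (jgroup w)) = rE w.
Proof.
have -> : jtwist (jgroup w) = phi1 c dg (jbas w).
  rewrite phi1E (bigD1 w) //= ffunE eqxx scale1r big1 ?addr0 // => u nu.
  by rewrite ffunE eq_sym (negPf nu) scale0r.
rewrite spade_phi1 (bigD1 w) //= ffunE eqxx scale1r big1 ?addr0 // => u nu.
by rewrite ffunE eq_sym (negPf nu) scale0r.
Qed.

Lemma spadeM i j : rho (jmul i j) = rho i *m rho j.
Proof.
rewrite -(phi1_invK i) phi1E jmul_suml linear_sum [X in X *m _]linear_sum mulmx_suml.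
apply: eq_bigr => x _ /=.
rewrite jmulZl linearZ [X in X *m _]linearZ /= spade_jgroup -scalemxAl.
congr (_ *: _); rewrite -(phi1_invK j) phi1E jmul_sumr linear_sum [X in _ *m X]linear_sum mulmx_sumr.
apply: eq_bigr => y _ /=.
rewrite jmulZr linearZ [X in _ *m X]linearZ /= -scalemxAr; congr (_ *: _).
have -> : jmul (jtwist (jgroup x)) (jtwist (jgroup y)) = jtwist (jgroup (x * y)%g).
  by rewrite (jtwistM hP (jgroup x) (jgroup y)) jgroupM.
rewrite [LHS]spade_jgroup [X in _ *m X]spade_jgroup.
by rewrite repr_mxM ?finset.in_setT.
Qed.

Lemma spade1 : rho (jone c C) = 1%:M.
Proof.
rewrite -(repr_mx1 rE) -spade_jgroup; congr (spade _ _ _ _); apply/ffunP => z.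
rewrite jgroup1 !ffunE; case: ifP => Dz; last by rewrite mul0rz.
by rewrite /jsign (calD_inv hP Dz) nhat_sqr.
Qed.

End Spade.
End SpecializationAtOne.

(** * Representations of W and of J *)

Section IrreducibleRepresentations.
Variables (C : numClosedFieldType) (gT : finGroupType).
Local Notation Irr := (IrrW C gT).
Local Notation rE E := (irr_repr (E : Irr)).

Let pcharG : ([pchar C]^'.-group [set: gT])%g.
Proof. by apply/pgroupP => p _; rewrite inE /= pchar_num. Qed.

Lemma irrW_abs_irr (E : Irr) : mx_absolutely_irreducible (rE E).
Proof. exact: group_closure_closed_field (socle_irr E). Qed.

Lemma irrW_span (E : Irr) :
  exists a_, forall X : 'M[C]_(irr_degree E), X = \sum_x a_ x X *: rE E x.
Proof.
have /mx_abs_irrP[_ [a_ ha]] := irrW_abs_irr E; exists a_ => X.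
by rewrite {1}[X]ha; apply: eq_bigl => x; rewrite finset.in_setT.
Qed.

Lemma irrW_degree_neq0 (E : Irr) : (irr_degree E)%:R != 0 :> C.
Proof. by rewrite pnatr_eq0 -lt0n irr_degree_gt0. Qed.

Lemma irrW_scalar (E : Irr) (X : 'M[C]_(irr_degree E)) :
  (forall x, X *m rE E x = rE E x *m X) -> exists b, X = b%:M.
Proof.
move=> h; apply/is_scalar_mxP.
by apply: (mx_abs_irr_cent_scalar (irrW_abs_irr E)); apply/centgmxP => x _.
Qed.

Lemma irrW_Schur (E E' : Irr) (Y : 'M[C]_(irr_degree E, irr_degree E')) :
  E != E' -> (forall x, rE E x *m Y = Y *m rE E' x) -> Y = 0.
Proof.
move=> nEE' h; apply/eqP; apply: contraNT nEE' => nzY; apply/eqP.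
have [n0 irrE] := (mx_irrP _).1 (socle_irr E).
have [n0' irrE'] := (mx_irrP _).1 (socle_irr E').
have ker0 : kermx Y = 0.
  apply/eqP; apply: contraNT nzY => nzk; have : row_full (kermx Y).
    apply: irrE => //; apply/mxmoduleP => x _; apply/sub_kermxP.
    by rewrite -mulmxA h mulmxA mulmx_ker mul0mx.
  rewrite -sub1mx => /sub_kermxP; rewrite mul1mx => ->; exact: eqxx.
have freeY : row_free Y by rewrite -kermx_eq0 ker0.
have fullY : row_full Y.
  have : row_full <<Y>>%MS.
    apply: irrE'; last first.
      by rewrite -mxrank_eq0 mxrank_gen mxrank_eq0.
    apply/mxmoduleP => x _; rewrite (eqmxMr _ (genmxE Y)) -h genmxE; exact: submxMl.
  by rewrite /row_full genmxE.
have eqn : irr_degree E = irr_degree E' by rewrite -(eqP freeY) (eqP fullY).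
have sim : mx_rsim (rE E) (rE E').
  by exists Y => // x _; apply: h.
by rewrite -(irr_reprK_pchar pcharG E) -(irr_reprK_pchar pcharG E') (irr_comp_rsim_pchar _ pcharG sim).
Qed.

(** By semisimplicity 1 is the sum of the Wedderburn idempotents, and each simple component acts
    faithfully on its own simple module. *)
Lemma irrW_faithful (u : gT -> C) :
  (forall E : Irr, \sum_w u w *: rE E w = 0) -> forall x, u x = 0.
Proof.
move=> h x; pose aG := regular_repr C [set: gT].
pose X := \sum_w u w *: aG w.
have XR : (X \in group_ring C [set: gT])%MS.
  by apply/envelop_mxP; exists u; apply: eq_bigl => w; rewrite finset.in_setT.
have opX (E : Irr) : gring_op (rE E) X = 0.
  rewrite -(h E) linear_sum; apply: eq_bigr => w _.
  by rewrite linearZ /= gring_opG ?finset.in_setT.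
have X0 : X = 0.
  rewrite -[X]mulmx1 -(Wedderburn_sum_id_pchar (DecSocleType aG) pcharG) mulmx_sumr.
  apply: big1 => E _; set e := Wedderburn_id _.
  have eR : (e \in Wedderburn_subring E)%MS := Wedderburn_id_mem E.
  have irrE := socle_irr E.
  have inj := @regular_op_inj_pchar _ _ _ (DecSocleType aG) pcharG _ (rE E) irrE.
  rewrite irr_reprK_pchar // in inj; apply: inj.
  - rewrite inE; have /andP[id1 _] := Wedderburn_ideal E.
    by apply: submx_trans id1; apply: mem_mulsmx.
  - by rewrite inE linear0 sub0mx.
  - rewrite gring_opM; last first.
      by rewrite -(Wedderburn_sum_pchar (DecSocleType aG) pcharG) (submx_trans eR) // (sumsmx_sup E).
    by rewrite opX mul0mx linear0.
have := congr1 (gring_proj x) X0; rewrite linear0 linear_sum (bigD1 x) //=.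
rewrite linearZ /= gring_projE ?finset.in_setT // eqxx big1 => [|w nw]; last first.
  by rewrite linearZ /= gring_projE ?finset.in_setT // eq_sym (negPf nw) scaler0.
by rewrite addr0 => /matrixP/(_ 0 0); rewrite !mxE eqxx mulr1.
Qed.

End IrreducibleRepresentations.

(** * Schur orthogonality and positivity for the symmetric algebra [J_C] *)

Section SchurElementsOfJ.
Variables (C : numClosedFieldType) (gT : finGroupType) (S : {set gT}) (L : gT -> int).
Hypothesis coxS : coxeter_system S.
Variables (H : hecke_algebra C S L) (c : kl_basis H).
Hypothesis hP : P1_15 c.
Variable dg : dagger_involution H.
Implicit Types s t u w x y z d : gT.
Local Notation gam := (gam c).
Local Notation D := (calD c).
Local Notation jmul := (jmul c).
Local Notation jone := (jone c C).
Local Notation JC := (JC C gT).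
Local Notation jbas := (jbas C).
Local Notation Irr := (IrrW C gT).
Local Notation rE E := (irr_repr (E : Irr)).
Local Notation rho E := (spade c dg (irr_repr E)).
Implicit Types (E : Irr) (j : JC).

Definition jrep E z : 'M[C]_(irr_degree E) := rho E (jbas z).

Lemma rhoE E j : rho E j = \sum_z j z *: jrep E z.
Proof.
rewrite {1}(jbasE j) (spade_sum coxS hP); apply: eq_bigr => z _.
by rewrite (spadeZ coxS hP).
Qed.

Lemma jrepM E x y : jrep E x *m jrep E y = \sum_z (gam x y z^-1%g)%:~R *: jrep E z.
Proof.
rewrite -(spadeM coxS hP) rhoE; apply: eq_bigr => z _; congr (_ *: _).
rewrite jmul_basr (bigD1 x) //= ffunE eqxx big1 ?addr0 // => u nu.
by rewrite ffunE eq_sym (negPf nu) mul0rz.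
Qed.

Lemma jrep1 E : \sum_z jone z *: jrep E z = 1%:M.
Proof. by rewrite -rhoE (spade1 coxS hP). Qed.

Lemma rho_repr E x : rE E x = rho E (jtwist c (jgroup c dg x)).
Proof. by rewrite (spade_jgroup coxS hP). Qed.

Lemma jrep_commute E E' (Y : 'M[C]_(irr_degree E, irr_degree E')) :
  (forall x, jrep E x *m Y = Y *m jrep E' x) -> forall x, rE E x *m Y = Y *m rE E' x.
Proof.
move=> h x; rewrite !rho_repr !rhoE mulmx_suml mulmx_sumr; apply: eq_bigr => z _.
by rewrite -scalemxAl -scalemxAr h.
Qed.

(** The cyclic symmetry of [gam] says that [t_w] and [t_{w^-1}] are dual bases, so [t_x] can be
    moved across the sum. *)
Lemma jrep_casimir E E' (X : 'M[C]_(irr_degree E, irr_degree E')) x :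
  let Y := \sum_w jrep E w *m X *m jrep E' w^-1%g in
  jrep E x *m Y = Y *m jrep E' x.
Proof.
rewrite /= mulmx_sumr mulmx_suml.
transitivity (\sum_w \sum_z (gam x w z^-1%g)%:~R *: (jrep E z *m X *m jrep E' w^-1%g)).
  apply: eq_bigr => w _; rewrite !mulmxA jrepM !mulmx_suml; apply: eq_bigr => z _.
  by rewrite -!scalemxAl.
rewrite exchange_big; apply: eq_bigr => z _ /=.
rewrite -mulmxA jrepM mulmx_sumr [RHS](reindex_inj invg_inj); apply: eq_bigr => w _ /=.
by rewrite -scalemxAr invgK (gam_rot hP z^-1%g).
Qed.

(* The Casimir element of the symmetric algebra J_C for the dual bases t_w and
   t_{w^-1}, applied to the character of E. *)
Definition jcentral E E' : 'M[C]_(irr_degree E') :=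
  \sum_w \tr (jrep E w) *: jrep E' w^-1%g.

Lemma jcentral_eq0 E E' : E != E' -> jcentral E E' = 0.
Proof.
move=> nEE'; apply/matrixP => k b; rewrite summxE [RHS]mxE.
(* Each entry is a sum of entries of Casimir sums built on matrix units; each such sum intertwines
   two non-isomorphic simple modules. *)
transitivity (\sum_i (\sum_w jrep E w *m delta_mx i k *m jrep E' w^-1%g) i b).
  under [RHS]eq_bigr => i _ do rewrite summxE.
  rewrite exchange_big; apply: eq_bigr => w _ /=.
  rewrite mxE /mxtrace mulr_suml; apply: eq_bigr => i _.
  rewrite -mulmxA mxE (bigD1 i) //= big1 => [|l nl].
    rewrite addr0; congr (_ * _); rewrite mxE (bigD1 k) //= big1 => [|l nl].
      by rewrite addr0 mxE !eqxx mul1r.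
    by rewrite mxE (negPf nl) andbF mul0r.
  rewrite mxE big1 ?mulr0 // => m _.
  by rewrite mxE (negPf nl) mul0r.
apply: big1 => i _.
rewrite (irrW_Schur nEE' (jrep_commute (fun x => jrep_casimir (delta_mx i k) x))).
by rewrite mxE.
Qed.

(** The Schur element of [E_spade] for [tau], shaped like [c_E] with [t_w] in place of [T_w]. *)
Definition jschur E : C :=
  (irr_degree E)%:R^-1 * \sum_w \tr (jrep E w) * \tr (jrep E w^-1%g).

Lemma mxtrace_jrepM E x y :
  \tr (jrep E x *m jrep E y) = \sum_w (gam x y w^-1%g)%:~R * \tr (jrep E w).
Proof.
by rewrite jrepM raddf_sum; apply: eq_bigr => w _; rewrite /= mxtraceZ.
Qed.

Lemma mxtrace_jcentral E E' :
  \tr (jcentral E E') = \sum_w \tr (jrep E w) * \tr (jrep E' w^-1%g).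
Proof. by rewrite raddf_sum; apply: eq_bigr => w _; rewrite /= mxtraceZ. Qed.

(** Cyclicity of [gam] and symmetry of the trace make the matrix commute with every [t_x]; it is a
    scalar, determined by its trace. *)
Lemma jcentral_diag E : jcentral E E = (jschur E)%:M.
Proof.
have [|b eb] := irrW_scalar (X := jcentral E E).
  move=> x; apply/esym; apply: jrep_commute x => x.
  transitivity (\sum_z \tr (jrep E z^-1%g *m jrep E x) *: jrep E z).
    rewrite mulmx_sumr; under eq_bigr => w _ do rewrite -scalemxAr jrepM scaler_sumr.
    rewrite exchange_big; apply: eq_bigr => z _ /=.
    rewrite mxtrace_jrepM scaler_suml; apply: eq_bigr => w _.
    by rewrite scalerA mulrC -(gam_rot hP z^-1%g).
  transitivity (\sum_z \tr (jrep E x *m jrep E z^-1%g) *: jrep E z).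
    by apply: eq_bigr => z _; rewrite mxtrace_mulC.
  rewrite mulmx_suml; under [RHS]eq_bigr => w _ do rewrite -scalemxAl jrepM scaler_sumr.
  rewrite [RHS]exchange_big; apply: eq_bigr => z _ /=.
  rewrite mxtrace_jrepM scaler_suml; apply: eq_bigr => w _.
  by rewrite scalerA mulrC -(gam_rot hP w^-1%g).
rewrite eb; congr (_%:M); have := congr1 mxtrace eb.
rewrite mxtrace_jcentral mxtrace_scalar /jschur => ->.
by rewrite -[b *+ _]mulr_natl mulKf ?irrW_degree_neq0.
Qed.

Section Positivity.
Variable E : Irr.
Local Notation adj X := (map_mx Num.conj X^T).

Let adjM (m n p : nat) (X : 'M[C]_(m, n)) (Y : 'M[C]_(n, p)) :
  adj (X *m Y) = adj Y *m adj X.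
Proof. by rewrite trmx_mul map_mxM. Qed.

Let adj_sum (m n : nat) (I : finType) (F : I -> 'M[C]_(m, n)) :
  adj (\sum_i F i) = \sum_i adj (F i).
Proof. by rewrite !raddf_sum. Qed.

Let adjZ (m n : nat) (b : C) (X : 'M[C]_(m, n)) : adj (b *: X) = Num.conj b *: adj X.
Proof. by rewrite linearZ /= map_mxZ. Qed.

Let P := \sum_w adj (jrep E w) *m jrep E w.

(* P is the Gram matrix of an inner product for which t_x is adjoint to
   t_{x^-1}, because gam x y z = gam y^-1 x^-1 z^-1. *)
Let P_adj x : adj (jrep E x) *m P = P *m jrep E x^-1%g.
Proof.
rewrite mulmx_sumr mulmx_suml.
transitivity (\sum_w \sum_z (gam w x z^-1%g)%:~R *: (adj (jrep E z) *m jrep E w)).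
  apply: eq_bigr => w _; rewrite mulmxA -adjM jrepM.
  rewrite adj_sum mulmx_suml; apply: eq_bigr => z _.
  by rewrite adjZ rmorph_int -scalemxAl.
rewrite exchange_big; apply: eq_bigr => z _ /=.
rewrite -mulmxA jrepM mulmx_sumr; apply: eq_bigr => w _.
rewrite -scalemxAr (gam_inv coxS hP z) !invgK.
by rewrite -(gam_rot hP w) .
Qed.

(** If [v *m P = 0], then [v P v^*] is a vanishing sum of squared norms, so every [v (t_w)^*] is
    zero; but the unit of [J] acts as the identity. *)
Let P_unit : P \in unitmx.
Proof.
rewrite -row_free_unit -kermx_eq0; apply/eqP/row_matrixP => i; rewrite row0.
set v := row i _; have vP : v *m P = 0 by rewrite -row_mul mulmx_ker row0.
have v0 w : v *m adj (jrep E w) = 0.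
  have : \sum_w (v *m adj (jrep E w)) *m adj (v *m adj (jrep E w)) = 0.
    transitivity (v *m P *m adj v); last by rewrite vP mul0mx.
    rewrite mulmx_sumr mulmx_suml; apply: eq_bigr => x _.
    rewrite adjM -!mulmxA; congr (_ *m (_ *m (_ *m _))).
    by apply/matrixP => k l; rewrite !mxE conjCK.
  move=> /matrixP/(_ 0 0); rewrite summxE mxE => /eqP.
  have E1 (u : 'rV[C]_(irr_degree E)) : (u *m adj u) 0 0 = \sum_k `|u 0 k| ^+ 2.
    by rewrite mxE; apply: eq_bigr => k _; rewrite !mxE normCK.
  rewrite psumr_eq0 => [/allP/(_ w)|x _]; last first.
    by rewrite E1 sumr_ge0 // => k _; rewrite exprn_ge0.
  rewrite mem_index_enum => /(_ isT); rewrite E1 psumr_eq0 => [/allP h|k _]; last first.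
    by rewrite exprn_ge0.
  apply/rowP => k; rewrite [RHS]mxE; apply/eqP.
  by have := h k; rewrite mem_index_enum => /(_ isT); rewrite expf_eq0 /= normr_eq0.
have -> : v = v *m adj (\sum_z jone z *: jrep E z).
  by rewrite jrep1 trmx1 map_mx1 mulmx1.
rewrite adj_sum mulmx_sumr big1 // => z _.
by rewrite adjZ -scalemxAr v0 scaler0.
Qed.

Lemma mxtrace_jrepV x : \tr (jrep E x^-1%g) = Num.conj (\tr (jrep E x)).
Proof.
have -> : jrep E x^-1%g = invmx P *m (adj (jrep E x) *m P).
  by rewrite P_adj mulKmx.
rewrite mxtrace_mulC mulmxK // /mxtrace rmorph_sum; apply: eq_bigr => i _.
by rewrite !mxE.
Qed.

(** The sum is one of squared absolute values. If all of them vanished, so would the trace of the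
    unit, which is the dimension. *)
Lemma jschur_gt0 : 0 < jschur E.
Proof.
rewrite /jschur mulr_gt0 //; first by rewrite invr_gt0 ltr0n irr_degree_gt0.
under eq_bigr => w _ do rewrite mxtrace_jrepV -normCK.
rewrite lt_def sumr_ge0 ?andbT => [|w _]; last by rewrite exprn_ge0.
rewrite psumr_eq0 => [|w _]; last by rewrite exprn_ge0.
apply: contra (irrW_degree_neq0 E) => /allP h.
rewrite -(mxtrace1 C (irr_degree E)) -(jrep1 E) raddf_sum big1 // => z _ /=.
have := h z; rewrite mem_index_enum => /(_ isT); rewrite expf_eq0 /= normr_eq0.
by rewrite mxtraceZ => /eqP->; rewrite mulr0.
Qed.

End Positivity.

Lemma rho_faithful j : (forall E, rho E j = 0) -> j = 0.
Proof.
move=> h; rewrite -(phi1_invK coxS hP dg j).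
have -> : phi1_inv c dg j = 0.
  by apply/ffunP => x; rewrite [RHS]ffunE; apply: (irrW_faithful (u := phi1_inv c dg j)).
by apply/ffunP => z; rewrite !ffunE big1 // => w _; rewrite ffunE mul0r.
Qed.

Lemma jone_inv z : jone z^-1%g = jone z.
Proof.
rewrite !ffunE; have [Dz|nDz] := boolP (z \in D); first by rewrite (calD_inv hP Dz) Dz.
by case: ifP => // Dz; rewrite -(invgK z) (calD_inv hP Dz) Dz in nDz.
Qed.

(** Expansion of [tau] in characters. The element with coefficients [sum_E chi_E(t_{w^-1}) / s_E]
    acts as 1 on every simple module by orthogonality, hence is the unit of [J]. *)
Lemma sum_jschur z : \sum_E (jschur E)^-1 * \tr (jrep E z) = jone z.
Proof.
pose e : JC := [ffun z => \sum_E (jschur E)^-1 * \tr (jrep E z^-1%g)].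
have e1 : e = jone.
  apply/eqP; rewrite -subr_eq0; apply/eqP/rho_faithful => E'.
  have eB w : (e - jone) w = e w - jone w by rewrite ffunE [X in _ + X]ffunE.
  rewrite rhoE; under eq_bigr => w _ do rewrite eB scalerBl.
  rewrite sumrB jrep1; apply/eqP; rewrite subr_eq0; apply/eqP.
  transitivity (\sum_E (jschur E)^-1 *: jcentral E E').
    under eq_bigr => w _ do rewrite ffunE scaler_suml.
    rewrite exchange_big; apply: eq_bigr => E _ /=.
    rewrite /jcentral scaler_sumr (reindex_inj invg_inj) /=.
    by apply: eq_bigr => w _; rewrite invgK scalerA.
  rewrite (bigD1 E') //= jcentral_diag scale_scalar_mx mulVf ?gt_eqF ?jschur_gt0 //.
  by rewrite big1 ?addr0 // => E nE; rewrite jcentral_eq0 // scaler0.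
by rewrite -jone_inv -e1 ffunE; apply: eq_bigr => E _; rewrite invgK.
Qed.

Lemma irrW_char_inj E E' :
  (forall w, \tr (rE E w) = \tr (rE E' w)) -> E = E'.
Proof.
move=> h; have hr z : \tr (jrep E z) = \tr (jrep E' z).
  rewrite /jrep /spade !raddf_sum; apply: eq_bigr => w _ /=.
  by rewrite !mxtraceZ h.
apply/eqP; apply: contraT => nEE'.
have := mxtrace_jcentral E E'; rewrite (jcentral_eq0 nEE') raddf0.
under eq_bigr => w _ do rewrite -hr.
move=> e; have := jschur_gt0 E; by rewrite /jschur -e mulr0 ltxx.
Qed.

End SchurElementsOfJ.

(** * Leading coefficients of characters *)

Section EvaluationAtZero.
Variable C : numClosedFieldType.
Local Notation K := (ratfun C).
Local Notation A := (laurent C).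
Local Notation vp := (vpow C).
Local Notation v := (rfv C).

Fact rfconst_is_zmod_morphism : zmod_morphism (@rfconst C).
Proof. by move=> x y; rewrite /rfconst !rmorphB. Qed.

Fact rfconst_is_monoid_morphism : monoid_morphism (@rfconst C).
Proof. by split=> [|x y]; rewrite /rfconst ?rmorph1 ?rmorphM. Qed.

HB.instance Definition _ := GRing.isZmodMorphism.Build C K (@rfconst C)
  rfconst_is_zmod_morphism.
HB.instance Definition _ := GRing.isMonoidMorphism.Build C K (@rfconst C)
  rfconst_is_monoid_morphism.

(** Reduction modulo [v], as a relation because it is defined only on the subring [C[v]] of
    [C(v)]. *)
Definition vpoly_at0 (x : K) (b : C) : Prop :=
  exists p : {poly C}, x = rfconst b + v * FracField.tofrac p.

Lemma vpoly_at0_uniq x b b' : vpoly_at0 x b -> vpoly_at0 x b' -> b = b'.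
Proof.
move=> [p ->] [q] /eqP; rewrite /rfconst /rfv -!rmorphM -!rmorphD tofrac_eq => /eqP.
move=> /(congr1 (fun r : {poly C} => r`_0)).
by rewrite !coefD !coefC !coefXM /= !addr0.
Qed.

Lemma vpoly_at0_poly (p : {poly C}) : vpoly_at0 (FracField.tofrac p) p`_0.
Proof.
exists (\poly_(i < size p) p`_i.+1); rewrite /rfconst /rfv -rmorphM -rmorphD.
congr FracField.tofrac; apply/polyP => i; rewrite coefD coefC coefXM coef_poly.
case: i => [|i] /=; first by rewrite addr0.
by rewrite add0r; case: ltnP => // le; rewrite nth_default // leqW.
Qed.

Lemma vpoly_at0_in_Cpoly x b : vpoly_at0 x b -> in_Cpoly x.
Proof.
by move=> [p ->]; exists (b%:P + 'X * p); rewrite /rfconst /rfv rmorphD rmorphM.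
Qed.

Lemma vpoly_at0D x y b b' :
  vpoly_at0 x b -> vpoly_at0 y b' -> vpoly_at0 (x + y) (b + b').
Proof.
by move=> [p ->] [q ->]; exists (p + q); rewrite !rmorphD /= mulrDr addrACA.
Qed.

Lemma vpoly_at0M x y b b' :
  vpoly_at0 x b -> vpoly_at0 y b' -> vpoly_at0 (x * y) (b * b').
Proof.
move=> [p ->] [q ->].
have -> : (rfconst b + v * FracField.tofrac p) * (rfconst b' + v * FracField.tofrac q) =
    FracField.tofrac ((b%:P + 'X * p) * (b'%:P + 'X * q)).
  by rewrite tofracM !tofracD !tofracM.
have := vpoly_at0_poly ((b%:P + 'X * p) * (b'%:P + 'X * q)).
by rewrite coef0M !coefD !coefC !coefXM /= !addr0.
Qed.

Lemma vpoly_at0_const b : vpoly_at0 (rfconst b) b.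
Proof. by exists 0; rewrite rmorph0 mulr0 addr0. Qed.

Lemma vpoly_at0_sum (I : Type) (r : seq I) (P : pred I) (F : I -> K) (f : I -> C) :
  (forall i, P i -> vpoly_at0 (F i) (f i)) ->
  vpoly_at0 (\sum_(i <- r | P i) F i) (\sum_(i <- r | P i) f i).
Proof.
move=> h; elim/big_rec2: _ => [|i y1 y2 Pi IH]; first by rewrite -(rmorph0 (@rfconst C)); apply: vpoly_at0_const.
by apply: vpoly_at0D => //; apply: h.
Qed.

Lemma vpoly_at0_zeval (p : {poly int}) : vpoly_at0 (val (zeval (vp 1) p)) (p`_0)%:~R.
Proof.
rewrite val_zeval zeval_rfv -(coef_map intr) /=.
exact: vpoly_at0_poly.
Qed.

Lemma vpoly_at0_lbar (b : A) : in_vZ (-1) b -> vpoly_at0 (val (lbar b)) 0.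
Proof.
move/in_vZ_zeval => [p ->].
have -> : lbar (vp (-1) * zeval (vp (-1)) p) = zeval (vp 1) ('X * p).
  by rewrite rmorphM rmorph_zeval /= lbar_vpow opprK rmorphM /= zevalX.
have := vpoly_at0_zeval ('X * p); by rewrite coefXM /=.
Qed.

(** Specialization at [v = 1] is only partially defined on [C(v)]: the powers of [v] are cleared
    first, and the resulting polynomial identity is evaluated at 1. *)
Lemma leval1_comb (I : finType) (b : I -> A) (x : I -> C) (p : {poly C}) (n : nat) :
  \sum_i val (b i) * rfconst (x i) = FracField.tofrac p / v ^+ n ->
  \sum_i leval1 (b i) * x i = p.[1].
Proof.
have [N [q hq]] := laurent_common_denominator b.
have vN0 (m : nat) : v ^+ m != 0 by rewrite expf_neq0 ?rfv_neq0.
pose Q := \sum_i map_poly intr (q i) * (x i)%:P.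
have -> : \sum_i val (b i) * rfconst (x i) = FracField.tofrac Q / v ^+ N.
  rewrite rmorph_sum mulr_suml; apply: eq_bigr => i _ /=.
  have valM (s t : A) : val (s * t) = val s * val t.
    exact: (rmorphM (val : A -> K)).
  by rewrite tofracM hq valM val_zeval zeval_rfv mulrAC /= -exprnN.
move=> /(congr1 (fun y => y * v ^+ N * v ^+ n)).
rewrite mulfVK // [X in _ = X]mulrAC mulfVK //.
rewrite /rfv -!rmorphXn -!rmorphM => /eqP; rewrite tofrac_eq => /eqP.
move=> /(congr1 (horner_eval 1)); rewrite /horner_eval !hornerE !expr1n !mulr1 => <-.
rewrite /Q horner_sum; apply: eq_bigr => i _; rewrite hornerM hornerC; congr (_ * _).
by rewrite hq /leval1 levalE ?unitr1 // expr1n divr1.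
Qed.

End EvaluationAtZero.

(** In a rank factorization [e = X Y], idempotency forces [Y X = 1], of size the rank. *)
Lemma mxtrace_idem (K : fieldType) (n : nat) (e : 'M[K]_n) :
  e *m e = e -> \tr e = (\rank e)%:R.
Proof.
move=> ee; have [Lc LcE] := row_fullP (col_base_full e).
have [Rr RrE] := row_freeP (row_base_free e).
have e1 : row_base e *m col_base e = 1%:M.
  move: (col_base e) (row_base e) (mulmx_base e) LcE RrE.
  move: (\rank e) Lc Rr => r Lc Rr X Y XY LX YR.
  have := congr1 (fun Z => Lc *m Z *m Rr) ee; rewrite -XY !mulmxA LX !mul1mx.
  by rewrite -!mulmxA YR mulmx1 => ->.
by rewrite -{1}(mulmx_base e) mxtrace_mulC e1 mxtrace1.
Qed.

Lemma mxtrace_isomorphic (K : fieldType) (B : algType K) (m n : nat)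
    (r : B -> 'M[K]_m) (s : B -> 'M[K]_n) :
  mx_isomorphic r s -> forall x, \tr (r x) = \tr (s x).
Proof.
move=> [P /andP[/row_freeP[Q PQ] /row_fullP[Q' Q'P]] h] x.
have QP : Q *m P = 1%:M.
  have eQ : Q = Q' by rewrite -[Q]mul1mx -Q'P -mulmxA PQ mulmx1.
  by rewrite eQ.
by rewrite -[r x]mulmx1 -PQ mulmxA h -mulmxA mxtrace_mulC -mulmxA QP mulmx1.
Qed.

(** * Representations of [J] over a field containing [C] *)

Section ExtendedScalars.
Variables (C : numClosedFieldType) (gT : finGroupType) (S : {set gT}) (L : gT -> int).
Hypothesis coxS : coxeter_system S.
Variables (H : hecke_algebra C S L) (c : kl_basis H).
Hypothesis hP : P1_15 c.
Variable dg : dagger_involution H.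
Implicit Types s t u w x y z d : gT.
Local Notation gam := (gam c).
Local Notation jmul := (jmul c).
Local Notation Irr := (IrrW C gT).
Local Notation jrep := (jrep c dg).
Implicit Types (E : Irr).
Variables (K : fieldType) (f : {rmorphism C -> K}).
Local Notation JK := {ffun gT -> K^o}.
Implicit Types i j : JK.

Definition jrepK E z : 'M[K]_(irr_degree E) := map_mx f (jrep E z).

Definition rhoK E (j : JK) : 'M[K]_(irr_degree E) := \sum_z j z *: jrepK E z.

Lemma jrepKM E x y : jrepK E x *m jrepK E y = \sum_z (gam x y z^-1%g)%:~R *: jrepK E z.
Proof.
rewrite -map_mxM (jrepM coxS hP) raddf_sum; apply: eq_bigr => z _ /=.
by rewrite map_mxZ /= rmorph_int.
Qed.

Fact rhoK_is_linear E : linear (rhoK E).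
Proof.
move=> b i j; rewrite /rhoK scaler_sumr -big_split; apply: eq_bigr => z _ /=.
by rewrite !ffunE scalerDl scalerA.
Qed.

HB.instance Definition _ E := GRing.isLinear.Build K JK _ _ (rhoK E) (rhoK_is_linear E).

Lemma rhoKZ E b j : rhoK E (b *: j) = b *: rhoK E j.
Proof. exact: linearZ_LR. Qed.

Lemma rhoK_sum E (I : Type) (r : seq I) (P : pred I) (F : I -> JK) :
  rhoK E (\sum_(i <- r | P i) F i) = \sum_(i <- r | P i) rhoK E (F i).
Proof. exact: raddf_sum. Qed.

Lemma rhoK_bas E z : rhoK E (jbas K z) = jrepK E z.
Proof.
rewrite /rhoK (bigD1 z) //= ffunE eqxx scale1r big1 ?addr0 // => u nu.
by rewrite ffunE eq_sym (negPf nu) scale0r.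
Qed.

Lemma rhoKM E i j : rhoK E (jmul i j) = rhoK E i *m rhoK E j.
Proof.
rewrite (jbasE i) jmul_suml !rhoK_sum mulmx_suml.
apply: eq_bigr => x _; rewrite jmulZl !rhoKZ -scalemxAl; congr (_ *: _).
rewrite (jbasE j) jmul_sumr !rhoK_sum mulmx_sumr.
apply: eq_bigr => y _; rewrite jmulZr !rhoKZ -scalemxAr.
congr (_ *: _); rewrite !rhoK_bas jrepKM; apply: eq_bigr => z _; congr (_ *: _).
rewrite jmul_basr (bigD1 x) //= ffunE eqxx big1 ?addr0 // => u nu.
by rewrite ffunE eq_sym (negPf nu) mul0rz.
Qed.

Lemma rhoK1 E : rhoK E (jone c K) = 1%:M.
Proof.
rewrite -(map_mx1 f) -(jrep1 coxS hP dg E) raddf_sum; apply: eq_bigr => z _ /=.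
rewrite map_mxZ !ffunE; congr (_ *: _).
by case: ifP; rewrite ?rmorph_int ?rmorph0.
Qed.

Lemma jtwist1 (B : comNzRingType) : jtwist c (jone c B) = jone c B.
Proof.
apply/ffunP => z; rewrite !ffunE; case: ifP => Dz; last by rewrite mul0rz.
by rewrite /jsign (calD_inv hP Dz) nhat_sqr.
Qed.

Section SimpleModule.
Variables (theta : {rmorphism laurent C -> K}) (HK : scalar_extension H theta).
Hypothesis unit_theta : forall r : {poly int},
  exists b, (1 + theta (vpow C 1) * zeval (theta (vpow C 1)) r) * b = 1.
Local Notation Psi := (psi_ext c dg (HB := HK)).

Definition sigmaK E (h : HK) : 'M[K]_(irr_degree E) := rhoK E (jtwist c (Psi h)).

Lemma sigmaK_onto E z : exists h, sigmaK E h = jrepK E z.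
Proof.
have [g gK _] := psi_ext_bijective coxS hP dg HK unit_theta.
exists (g (jtwist c (jbas K z))); rewrite /sigmaK gK (jtwistK hP).
exact: rhoK_bas.
Qed.

Lemma sigmaK_module E : mx_module_of (sigmaK E).
Proof.
split; last 1 first.
- by move=> g h; rewrite /sigmaK psi_extM // -(jtwistM hP) rhoKM.
- move=> b g h; rewrite /sigmaK linearP.
  have -> : jtwist c (b *: Psi g + Psi h) = b *: jtwist c (Psi g) + jtwist c (Psi h).
    by apply/ffunP => z; rewrite !ffunE mulrzDl scalerMzr.
  exact: linearP.
- by rewrite /sigmaK psi_ext1 // jtwist1 rhoK1.
Qed.

(** The image contains the matrices of all [t_z], hence those of [W], hence every matrix over [C] by
    absolute irreducibility; matrix units carry any nonzero vector to all basis vectors. *)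
Lemma sigmaK_simple E : mx_simple_module (sigmaK E).
Proof.
split; [exact: sigmaK_module | exact: irr_degree_gt0 |] => U stU nzU.
have st (X : 'M[C]_(irr_degree E)) : (U *m (map_mx f X)^T <= U)%MS.
  have [a_ ha] := irrW_span E; rewrite (ha X) 2!raddf_sum mulmx_sumr.
  apply: summx_sub => x _ /=; rewrite map_mxZ linearZ /= -scalemxAr scalemx_sub //.
  rewrite (rho_repr coxS hP dg) (rhoE coxS hP) 2!raddf_sum mulmx_sumr.
  apply: summx_sub => z _ /=; rewrite map_mxZ linearZ /= -scalemxAr scalemx_sub //.
  by have [h e] := sigmaK_onto E z; rewrite -[map_mx _ _]e; apply: stU.
have /matrix0Pn[k [l Ukl]] := nzU.
rewrite -sub1mx; apply/row_subP => i; rewrite row1.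
have := submx_trans (submxMl (delta_mx 0 k : 'rV_(irr_degree E)) _) (st (delta_mx i l)).
rewrite map_delta_mx trmx_delta mulmxA -rowE -[row k U]mulmx1.
have -> : row k U *m 1%:M *m delta_mx l i = U k l *: delta_mx 0 i.
  apply/rowP => j; rewrite mulmx1 !mxE (bigD1 l) //= big1 ?addr0 => [|t nt].
    by rewrite !mxE eqxx /=.
  by rewrite !mxE (negPf nt) mulr0.
move=> h; rewrite -(scalerK Ukl (delta_mx 0 i)); exact: scalemx_sub.
Qed.

Lemma mxtrace_sigmaK E h : \tr (sigmaK E (ext_in HK h)) =
  \sum_z theta (psi_dag c dg h z *~ jsign c z) * f (\tr (jrep E z)).
Proof.
rewrite raddf_sum; apply: eq_bigr => z _ /=; rewrite mxtraceZ ffunE psi_ext_in.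
congr (_ * _); first by rewrite rmorphMz.
by rewrite /mxtrace rmorph_sum; apply: eq_bigr => i _; rewrite !mxE.
Qed.

End SimpleModule.

Lemma rhoK_trace E j : \tr (rhoK E j) = \sum_z j z * f (\tr (jrep E z)).
Proof.
rewrite raddf_sum; apply: eq_bigr => z _ /=; rewrite mxtraceZ; congr (_ * _).
by rewrite /mxtrace rmorph_sum; apply: eq_bigr => i _; rewrite !mxE.
Qed.

(* The symmetrizing trace of J, for which t_x and t_{x^-1} are dual bases. *)
Definition jtau j : K := \sum_z j z * jone c K z.

Lemma jtau_rhoK j : jtau j = \sum_E f (jschur c dg E)^-1 * \tr (rhoK E j).
Proof.
have j1 z : jone c K z = f (jone c C z).
  by rewrite !ffunE; case: ifP; rewrite ?rmorph_int ?rmorph0.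
under [RHS]eq_bigr => E _ do rewrite rhoK_trace mulr_sumr.
rewrite exchange_big; apply: eq_bigr => z _ /=.
rewrite j1 -(sum_jschur coxS hP dg) rmorph_sum mulr_sumr; apply: eq_bigr => E _ /=.
by rewrite rmorphM mulrCA.
Qed.

Lemma jtau_jbas j x : jtau (jmul j (jbas K x^-1%g)) = j x.
Proof.
have key y : \sum_z jone c K z *~ gam y x^-1%g z^-1%g = (y == x)%:R.
  rewrite -[RHS](rmorph_nat (intr : int -> K)) -(sum_gam_calDl hP y x) rmorph_sum.
  rewrite [RHS]big_mkcond; apply: eq_bigr => z _; rewrite ffunE.
  case: ifP => Dz; last by rewrite mul0rz.
  by rewrite (gam_rot hP z) (calD_inv hP Dz) -mulrzr -intrM.
rewrite /jtau; under eq_bigr => z _ do rewrite jmul_basr mulr_suml.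
rewrite exchange_big /=.
have e y : \sum_z j y *~ gam y x^-1%g z^-1%g * jone c K z = j y * (y == x)%:R.
  by rewrite -key mulr_sumr; apply: eq_bigr => z _; rewrite mulrzAl mulrzAr.
under eq_bigr => y _ do rewrite e.
rewrite (bigD1 x) //= eqxx mulr1 big1 ?addr0 // => y ny.
by rewrite (negPf ny) mulr0.
Qed.

(** The coordinates of [j] are the values [tau (j t_{x^-1})], and [tau] is a combination of
    characters. *)
Lemma rhoK_faithful j : (forall E, rhoK E j = 0) -> j = 0.
Proof.
move=> h; apply/ffunP => x; rewrite -jtau_jbas jtau_rhoK [RHS]ffunE big1 // => E _.
by rewrite rhoKM h mul0mx raddf0 mulr0.
Qed.

End ExtendedScalars.


Lemma one_add_v_neq0 (C : numClosedFieldType) (r : {poly int}) :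
  1 + rfv C * zeval (rfv C) r != 0.
Proof.
have -> : 1 + rfv C * zeval (rfv C) r = zeval (rfv C) (1 + 'X * r).
  by rewrite rmorphD rmorph1 rmorphM /= zevalX.
apply/eqP; rewrite -(rmorph0 (zeval (rfv C))) => /zeval_rfv_inj.
by move=> /(congr1 (fun r : {poly int} => r`_0)); rewrite coefD coef1 coefXM coef0.
Qed.

Section LeadingCoefficients.
Variables (C : numClosedFieldType) (gT : finGroupType) (S : {set gT}) (L : gT -> int).
Hypothesis coxS : coxeter_system S.
Variables (H : hecke_algebra C S L) (c : kl_basis H).
Hypothesis hP : P1_15 c.
Variable dg : dagger_involution H.
Implicit Types s t u w x y z d : gT.
Local Notation K := (ratfun C).
Local Notation A := (laurent C).
Local Notation vp := (vpow C).
Local Notation v := (rfv C).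
Local Notation T := (hT H).
Local Notation hb := (@hT_basis _ _ _ _ H).
Local Notation a := (afun c).
Local Notation gam := (gam c).
Local Notation D := (calD c).
Local Notation n_ := (nz c).
Local Notation jmul := (jmul c).
Local Notation Irr := (IrrW C gT).
Local Notation jrep := (jrep c dg).
Implicit Types (E : Irr).

Let valM (b b' : A) : val (b * b') = val b * val b'.
Proof. exact: (rmorphM (val : A -> K)). Qed.

Let valD (b b' : A) : val (b + b') = val b + val b'.
Proof. exact: (rmorphD (val : A -> K)). Qed.

Let valMz (b : A) (k : int) : val (b *~ k) = val b *~ k.
Proof. exact: (raddfMz (val : A -> K)). Qed.

Section GenericModules.
Variable HK : scalar_extension H (val : A -> K).

Definition theta_char E (h : H) : K :=
  \sum_z val (psi_dag c dg h z *~ jsign c z) * rfconst (\tr (jrep E z)).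

Let unit_val (r : {poly int}) :
  exists b, (1 + val (vp 1) * zeval (val (vp 1)) r) * b = 1 :> K.
Proof. by exists (1 + v * zeval v r)^-1; apply/divff/one_add_v_neq0. Qed.

Variable Ev : generic_modules HK.

(** The extended [E_spade] is simple, so it is some [E'_v]. At [v = 1] its character is that of [E],
    and characters separate the simple modules of [W]. *)
Lemma chi_vE E w : chi_v Ev E w = theta_char E (T w).
Proof.
have [E' iso] := gmod_surj Ev
  (sigmaK_simple coxS hP dg (@rfconst C) HK unit_val E).
have trE x : chi_v Ev E' x = theta_char E (T x).
  rewrite /chi_v -(mxtrace_isomorphic iso); exact: mxtrace_sigmaK.
suff {1}-> : E = E' by [].
apply: (irrW_char_inj coxS hP dg) => x.
have [p [n [e <-]]] := gmod_spec Ev E' x.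
have {}e := etrans (esym (trE x)) e.
rewrite -(leval1_comb e) (rho_repr coxS hP dg) (rhoE coxS hP) raddf_sum.
apply: eq_bigr => z _ /=; rewrite mxtraceZ ffunE [jgroup c dg x z]ffunE.
by rewrite rmorphMz.
Qed.

(** * Characters attached to a two-sided cell, modulo [v] *)

Section Cell.
Variables (cc : {set gT}).
Hypothesis two_sided_cc : two_sided_cell c cc.
Variable E : Irr.

Lemma two_sided_cell_simLR x y : x \in cc -> simLR c x y = (y \in cc).
Proof.
case: two_sided_cc => x0 ->; rewrite !inE => h; apply/idP/idP => h'.
  exact: simLR_trans h h'.
by apply: simLR_trans h'; rewrite simLR_sym.
Qed.

Lemma two_sided_cell_simL x y : simL c x y -> (x \in cc) = (y \in cc).
Proof.
move/simL_simLR => xy; apply/idP/idP => h.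
  by rewrite -(two_sided_cell_simLR _ h).
by rewrite -(two_sided_cell_simLR _ h) simLR_sym.
Qed.

Lemma two_sided_cell_inv x : (x^-1%g \in cc) = (x \in cc).
Proof.
have := hP => -[_ _ [_ _ _ P14 _]]; have h := P14 x.
apply/idP/idP => hx; last by rewrite -(two_sided_cell_simLR _ hx).
by rewrite -(two_sided_cell_simLR _ hx) simLR_sym.
Qed.

Lemma jmul_bas_cell x :
  jmul (jbas C x) (t_cell c cc) = if x \in cc then jbas C x else 0.
Proof.
apply/ffunP => z; rewrite jmul_basl.
have -> : (if x \in cc then jbas C x else 0) z = (if x \in cc then (x == z)%:R else 0).
  by case: ifP; rewrite ffunE.
transitivity (\sum_(d in D) (if x \in cc then (n_ d * gam x d z^-1%g)%:~R else 0) : C).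
  rewrite [RHS]big_mkcond; apply: eq_bigr => d _; rewrite ffunE finset.in_setI.
  case: ifP => [/andP[Dd dc] | nDd].
    rewrite Dd (gam_calDr hP _ _ Dd); case: ifP => [/andP[_ dx]|_].
      by rewrite -(two_sided_cell_simL dx) dc -mulrzA.
    by rewrite mulr0 mulr0z if_same.
  rewrite mul0rz; case: ifP => // Dd; rewrite Dd /= in nDd.
  rewrite (gam_calDr hP _ _ Dd).
  case: ((x == z) && _) / andP => [[_ dx]|_]; last by rewrite mulr0 if_same.
  by rewrite -(two_sided_cell_simL dx) nDd.
case: ifP => _; last by rewrite big1.
by rewrite -rmorph_sum /= sum_gam_calDr // rmorph_nat.
Qed.

Lemma jmul_cell_bas x :
  jmul (t_cell c cc) (jbas C x) = if x \in cc then jbas C x else 0.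
Proof.
apply/ffunP => z; rewrite jmul_basr.
have -> : (if x \in cc then jbas C x else 0) z = (if x \in cc then (x == z)%:R else 0).
  by case: ifP; rewrite ffunE.
transitivity (\sum_(d in D) (if x \in cc then (n_ d * gam d x z^-1%g)%:~R else 0) : C).
  rewrite [RHS]big_mkcond; apply: eq_bigr => d _; rewrite ffunE finset.in_setI.
  case: ifP => [/andP[Dd dc] | nDd].
    rewrite Dd (gam_calDl hP _ _ Dd); case: ifP => [/andP[_ dx]|_].
      by rewrite -two_sided_cell_inv -(two_sided_cell_simL dx) dc -mulrzA.
    by rewrite mulr0 mulr0z if_same.
  rewrite mul0rz; case: ifP => // Dd; rewrite Dd /= in nDd.
  rewrite (gam_calDl hP _ _ Dd).
  case: ((x == z) && _) / andP => [[_ dx]|_]; last by rewrite mulr0 if_same.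
  by rewrite -two_sided_cell_inv -(two_sided_cell_simL dx) nDd.
case: ifP => _; last by rewrite big1.
by rewrite -rmorph_sum /= sum_gam_calDl // rmorph_nat.
Qed.

Local Notation rho := (spade c dg (irr_repr E)).

Lemma jrep_cell z : z \in cc -> jrep E z = jrep E z *m rho (t_cell c cc).
Proof. by move=> ccz; rewrite -(spadeM coxS hP) jmul_bas_cell ccz. Qed.

(** [t_cell] is central, so it acts on [E] by a scalar, nonzero by the choice of [E]; yet its
    product with [t_z] is zero. *)
Lemma jrep_notin_cell z : Irr_in c dg cc E -> z \notin cc -> jrep E z = 0.
Proof.
have spade0 : rho 0 = 0 by rewrite -(scale0r (0 : JC C gT)) (spadeZ coxS hP) scale0r.
move=> ccE nccz; rewrite /Irr_in in ccE.
have [|b eb] := irrW_scalar (E := E) (X := rho (t_cell c cc)).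
  move=> x; apply/esym; apply: (jrep_commute coxS hP (dg := dg)) x => x.
  rewrite -[jrep E x]/(rho (jbas C x)) -!(spadeM coxS hP).
  by rewrite jmul_bas_cell jmul_cell_bas.
have := jmul_cell_bas z; rewrite (negPf nccz) => /(congr1 (fun j => rho j)).
rewrite (spadeM coxS hP) spade0 eb mul_scalar_mx => /eqP.
rewrite scalemx_eq0 => /orP[/eqP b0|/eqP //].
by rewrite eb b0 raddf0 eqxx in ccE.
Qed.

Lemma jrep_notin_Irr z : ~~ Irr_in c dg cc E -> z \in cc -> jrep E z = 0.
Proof. by rewrite negbK => /eqP r0 /jrep_cell ->; rewrite r0 mulmx0. Qed.

Variable x0 : gT.
Hypothesis cc_x0 : x0 \in cc.
Hypothesis ccE : Irr_in c dg cc E.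

Lemma two_sided_cell_afun z : z \in cc -> a z = a x0.
Proof.
by rewrite -(two_sided_cell_simLR _ cc_x0) => /(afun_simLR hP).
Qed.

Local Notation va := (v ^+ a x0).

(** Only [z] in the cell contribute, and [a] is constant there, so a single power of [v] clears all
    denominators; by [psi_low] only [z = w] survives modulo [v]. *)
Lemma theta_char_dag w :
  vpoly_at0 (va * theta_char E (dg (c w))) ((\tr (jrep E w)) *~ jsign c w).
Proof.
have -> : (\tr (jrep E w)) *~ jsign c w =
    \sum_z ((w == z)%:R *~ jsign c z) * \tr (jrep E z).
  rewrite (bigD1 w) //= eqxx mulrzl big1 ?addr0 // => z nz.
  by rewrite eq_sym (negPf nz) mul0rz mul0r.
rewrite mulr_sumr; apply: vpoly_at0_sum => z _; rewrite mulrA.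
have [ccz|nccz] := boolP (z \in cc); last first.
  rewrite (jrep_notin_cell ccE nccz) raddf0 rmorph0 !mulr0.
  by rewrite -(rmorph0 (@rfconst C)); apply: vpoly_at0_const.
apply: vpoly_at0M; last exact: vpoly_at0_const.
have [p e p0] := psi_low coxS hP w z.
have -> : va * val (psi_dag c dg (dg (c w)) z *~ jsign c z) =
          val (zeval (vp 1) (p *~ jsign c z)).
  have -> : va = val (vp (a x0)%:Z) by [].
  rewrite -valM; congr (val _); rewrite psi_dag_kl e (two_sided_cell_afun ccz).
  by rewrite mulrzAr mulrA vpowVr mul1r rmorphMz.
have := vpoly_at0_zeval C (p *~ jsign c z).
have -> : (p *~ jsign c z)`_0 = p`_0 *~ jsign c z by exact: (raddfMz (coefp 0)).
by rewrite p0 mulrzz intrM mulrzr; case: (w == z).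
Qed.

Lemma theta_charD g h : theta_char E (g + h) = theta_char E g + theta_char E h.
Proof.
rewrite -big_split; apply: eq_bigr => z _ /=.
rewrite psi_dagD [X in X *~ _]ffunE mulrzDl.
by apply: etrans (mulrDl _ _ _); congr (_ * _); exact: valD.
Qed.

Lemma theta_charZ (b : A) h : theta_char E (b *: h) = val b * theta_char E h.
Proof.
rewrite mulr_sumr; apply: eq_bigr => z _.
rewrite psi_dagZ [X in X *~ _]ffunE mulrA -valM.
by congr (val _ * _); rewrite mulrzAr.
Qed.

(* Modulo v, T_w is (-1)^(len w) c_w^dag plus a combination of the T_y, y < w,
   with coefficients in v Z[v]; conclude by theta_char_dag. *)
Lemma theta_char_hT w :
  vpoly_at0 (va * theta_char E (T w)) ((-1) ^+ len S w * ((\tr (jrep E w)) *~ jsign c w)).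
Proof.
have [n] := ubnP (len S w); elim: n w => // n IH w lt_wn.
have klp1 : klp c w w = 1.
  have [p hp e] := kl_c_T c w.
  rewrite /klp e (coordsD hb) (coords_basis hb) eqxx (coords_bigsum hb) big1 ?addr0 //.
  move=> y /bruhat_lt_len; rewrite (coordsZ hb) (coords_basis hb).
  by case: eqP => [->|]; rewrite ?ltnn // mulr0.
pose q y : A := lbar (klp c y w) * (-1) ^+ len S y.
have eT : T w = (-1) ^+ len S w *: (dg (c w) - \sum_(y | y != w) q y *: T y).
  rewrite dag_kl // (bigD1 w) //= addrK klp1 rmorph1 mul1r scalerA -exprD.
  by rewrite addnn -mul2n exprM sqrrN !expr1n scale1r.
have signK (k : nat) : vpoly_at0 (val ((-1) ^+ k : A)) ((-1) ^+ k).
  have -> : val ((-1) ^+ k : A) = rfconst ((-1) ^+ k).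
    by rewrite (rmorphXn (val : A -> K)) /= rmorphXn rmorphN1.
  exact: vpoly_at0_const.
rewrite {1}eT theta_charZ mulrCA; apply: vpoly_at0M; first exact: signK.
rewrite -scaleN1r theta_charD theta_charZ mulrDr.
rewrite -[_ *~ _]addr0; apply: vpoly_at0D; first exact: theta_char_dag.
suff h0 : vpoly_at0 (va * theta_char E (\sum_(y | y != w) q y *: T y)) 0.
  by rewrite mulrCA; have := vpoly_at0M (signK 1%N) h0; rewrite mulr0 !expr1.
have theta0 : theta_char E 0 = 0 by rewrite -(scale0r 0) theta_charZ rmorph0 mul0r.
rewrite (big_morph _ theta_charD theta0) mulr_sumr.
have -> : 0 = \sum_(y | y != w) 0 :> C by rewrite big1.
apply: vpoly_at0_sum => y nyw; rewrite theta_charZ mulrCA.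
have [k0|/klp_len h] := eqVneq (klp c y w) 0.
  rewrite /q k0 rmorph0 mul0r rmorph0 mul0r -(rmorph0 (@rfconst C)).
  exact: vpoly_at0_const.
have ltyw : (len S y < len S w)%N by case: h => // e; rewrite e eqxx in nyw.
have hq : vpoly_at0 (val (q y)) 0.
  rewrite -(mul0r ((-1) ^+ len S y)) valM; apply: vpoly_at0M; last exact: signK.
  by apply: vpoly_at0_lbar; have := klp_sub c y w; rewrite eq_sym (negPf nyw) subr0.
have := vpoly_at0M hq (IH y (leq_trans ltyw lt_wn)); rewrite mul0r; exact.
Qed.

Lemma exists_char_neq0 : exists w, \tr (jrep E w) != 0.
Proof.
apply: contrapT => h; have := jschur_gt0 coxS hP dg E.
rewrite /jschur big1 ?mulr0 ?ltxx // => w _.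
by have [->|nz] := eqVneq (\tr (jrep E w)) 0; [rewrite mul0r | case: h; exists w].
Qed.

(** The constant terms from [theta_char_hT] are signs times the traces of the [t_w]; one of these is
    nonzero, so the exponent cannot be lowered. *)
Lemma a_EE : a_E Ev E = a x0.
Proof.
have polyM (r r' : K) : in_Cpoly r -> in_Cpoly r' -> in_Cpoly (r * r').
  by move=> [p ->] [q ->]; exists (p * q); rewrite tofracM.
have polyv (k : nat) : in_Cpoly (v ^+ k) by exists ('X^k); rewrite tofracXn.
have v0 := rfv_neq0 C.
have vz (k : int) : v * v ^ (k - 1) = v ^ k.
  by rewrite -[X in X * _]expr1z -expfzDr // addrC subrK.
have ha w : in_Cpoly (v ^ (a x0)%:Z * chi_v Ev E w).
  rewrite chi_vE; exact: vpoly_at0_in_Cpoly (theta_char_hT w).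
have [w0 nw0] := exists_char_neq0.
have hb' : ~ in_Cpoly (v ^ ((a x0)%:Z - 1) * chi_v Ev E w0).
  move=> [p e]; have := theta_char_hT w0.
  have -> : va * theta_char E (T w0) = FracField.tofrac ('X * p).
    rewrite tofracM -e -chi_vE mulrA -[FracField.tofrac 'X]/v; congr (_ * _).
    exact: esym (vz (a x0)).
  move/vpoly_at0_uniq => /(_ _ (vpoly_at0_poly _)); rewrite coefXM /= => /eqP.
  rewrite mulf_eq0 signr_eq0 /= => /eqP e0; case/eqP: nw0.
  by rewrite -[LHS](mulr1z) -(jsign_sqr hP w0) mulrzA e0 mul0rz.
rewrite /a_E; case: xgetP => [n _ [h1 [w1 h2]] | /(_ (a x0))]; last first.
  by case; split=> //; exists w0.
apply/eqP; rewrite eqn_leq; apply/andP; split; rewrite leqNgt; apply/negP => lt.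
  apply: h2; have -> : v ^ (n%:Z - 1) = v ^+ (n - 1 - a x0) * v ^ (a x0)%:Z.
    rewrite -[v ^+ _]/(v ^ (n - 1 - a x0)%N%:Z) -expfzDr // -subzn; last by rewrite subn1 -ltnS prednK ?(leq_ltn_trans _ lt).
    by rewrite subrK subzn // (leq_ltn_trans _ lt).
  by rewrite -mulrA; apply: polyM.
apply: hb'; have -> : v ^ ((a x0)%:Z - 1) = v ^+ (a x0 - 1 - n) * v ^ n%:Z.
  rewrite -[v ^+ _]/(v ^ (a x0 - 1 - n)%N%:Z) -expfzDr // -subzn; last by rewrite subn1 -ltnS prednK ?(leq_ltn_trans _ lt).
  by rewrite subrK subzn // (leq_ltn_trans _ lt).
by rewrite -mulrA; apply: polyM.
Qed.

(** The signs of [theta_char_hT] cancel in the product for [w] and [w^-1], since length and [jsign]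
    are invariant under inversion. What remains modulo [v] is the sum defining [jschur]. *)
Lemma f_EE : f_E Ev E = jschur c dg E.
Proof.
have v0 := rfv_neq0 C.
have hc : vpoly_at0 (v ^ (2 * a x0)%:Z * c_E Ev E) (jschur c dg E).
  have -> : v ^ (2 * a x0)%:Z * c_E Ev E = rfconst (irr_degree E)%:R^-1 *
      \sum_w (va * theta_char E (T w)) * (va * theta_char E (T w^-1%g)).
    rewrite /c_E fmorphV rmorph_nat mulrCA; congr (_ * _); rewrite mulr_sumr.
    apply: eq_bigr => w _; rewrite !chi_vE -[v ^ _]/(v ^+ (2 * a x0)).
    by rewrite mul2n -addnn exprD mulrACA.
  apply: vpoly_at0M; first exact: vpoly_at0_const.
  apply: vpoly_at0_sum => w _.
  have := vpoly_at0M (theta_char_hT w) (theta_char_hT w^-1%g).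
  rewrite (lenV coxS) jsign_inv [X in vpoly_at0 _ X]mulrACA -expr2 sqrr_sign mul1r.
  by rewrite mulrzAl mulrzAr -mulrzA jsign_sqr // mulr1z.
have cE f : (exists p : {poly C}, c_E Ev E =
    v ^ (- (2 * a x0)%:Z) * (rfconst f + v * FracField.tofrac p)) <->
    vpoly_at0 (v ^ (2 * a x0)%:Z * c_E Ev E) f.
  split=> -[p e]; exists p; first by rewrite e mulrA -expfzDr // subrr mul1r.
  by rewrite -e mulrA -expfzDr // addNr mul1r.
rewrite /f_E a_EE; case: xgetP => [f _ /cE hf | /(_ (jschur c dg E))].
  exact: vpoly_at0_uniq hf hc.
by case; apply/cE.
Qed.

End Cell.
End GenericModules.
End LeadingCoefficients.

(** * Indecomposability *)

Section CellIdempotents.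
Variables (C : numClosedFieldType) (gT : finGroupType) (S : {set gT}) (L : gT -> int).
Hypothesis coxS : coxeter_system S.
Variables (H : hecke_algebra C S L) (c : kl_basis H).
Hypothesis hP : P1_15 c.
Variable dg : dagger_involution H.
Implicit Types w x y z d : gT.
Local Notation K := (ratfun C).
Local Notation A := (laurent C).
Local Notation jmul := (jmul c).
Local Notation jrep := (jrep c dg).
Local Notation rhoF := (rhoK c dg (@rfconst C)).
Variables (R : subringClosed K) (hOR : {subset @calO C <= R}).
Local Notation B := (subring R).
Local Notation theta := (subring_incl (fun b hb => @hOR b (laurent_sub_calO hb))).
Local Notation JR := {ffun gT -> B^o}.
Local Notation JK := {ffun gT -> K^o}.

Let valM (b b' : B) : val (b * b') = val b * val b'.
Proof. exact: (rmorphM (val : B -> K)). Qed.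

Let valD (b b' : B) : val (b + b') = val b + val b'.
Proof. exact: (rmorphD (val : B -> K)). Qed.

Let valMz (b : B) (k : int) : val (b *~ k) = val b *~ k.
Proof. exact: (raddfMz (val : B -> K)). Qed.

Let val_sum (F : gT -> B) : val (\sum_z F z) = \sum_z val (F z).
Proof. exact: (raddf_sum (val : B -> K)). Qed.

Lemma one_add_v_unitR (r : {poly int}) :
  exists b : B, (1 + theta (vpow C 1) * zeval (theta (vpow C 1)) r) * b = 1.
Proof.
have hb : 1 / (1 + rfv C * zeval (rfv C) r) \in R.
  by apply: hOR; apply/asboolP; exists 1, r.
exists (Subring hb); apply: val_inj.
rewrite valM valD valM.
have -> : val (zeval (theta (vpow C 1)) r) = zeval (rfv C) r.
  exact: (rmorph_zeval (val : B -> K)).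
transitivity ((1 + rfv C * zeval (rfv C) r) * (1 / (1 + rfv C * zeval (rfv C) r))).
  by [].
by rewrite div1r divff // one_add_v_neq0.
Qed.

Definition jval (j : JR) : JK := [ffun z => val (j z)].

Lemma jvalM (i j : JR) : jmul (jval i) (jval j) = jval (jmul i j).
Proof.
apply/ffunP => z; rewrite !ffunE val_sum; apply: eq_bigr => x _.
rewrite val_sum; apply: eq_bigr => y _; rewrite valMz valM.
by congr ((_ * _) *~ _); rewrite ffunE.
Qed.

Lemma jtau_jval (j : JR) : jtau c (jval j) = val (\sum_z j z * jone c B z).
Proof.
rewrite val_sum; apply: eq_bigr => z _; rewrite valM; congr (_ * _).
  by rewrite ffunE.
by rewrite !ffunE; case: ifP => // _; rewrite valMz.
Qed.

Variables (HK : scalar_extension H (val : A -> K)) (Ev : generic_modules HK).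
Variables (cc Gamma : {set gT}).
Hypothesis two_sided_cc : two_sided_cell c cc.
Hypothesis cellGamma : left_cell c Gamma.
Hypothesis sub_cc : Gamma \subset cc.
Hypothesis adaptedR : adapted Ev c dg cc R.

(* tau(p) is the sum of rank_E(p) / f_E, hence an integer as R is adapted. *)
Lemma jtau_idem (p : JR) :
  jmul p p = p -> (forall x, x \notin Gamma -> p x = 0) ->
  exists k : int, [/\ jtau c (jval p) = rfconst k%:~R, 0 <= k & k = 0 -> p = 0].
Proof.
move=> pp p0; have [x0 Gx0] : exists x, x \in Gamma.
  by case: cellGamma => x ->; exists x; rewrite inE simL_refl.
have ccx0 : x0 \in cc := fintype.subsetP sub_cc _ Gx0.
pose e E := rhoF E (jval p).
have ee E : e E *m e E = e E by rewrite -(rhoKM coxS hP) jvalM pp.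
pose m E := \rank (e E).
have trE E : \tr (e E) = rfconst (m E)%:R by rewrite (mxtrace_idem (ee E)) rmorph_nat.
(* [p] is supported in the cell, whose [t_z] act by zero on such [E]; the sum over all [E] thus
   reduces to the one in [adapted]. *)
have e0 E : ~~ Irr_in c dg cc E -> e E = 0.
  move=> nE; rewrite /e /rhoK big1 // => z _.
  have [Gz|nGz] := boolP (z \in Gamma); last first.
    by rewrite ffunE p0 // -[val 0]/0 scale0r.
  rewrite /jrepK (jrep_notin_Irr coxS hP two_sided_cc nE) ?(fintype.subsetP sub_cc) //.
  by rewrite map_mx0 scaler0.
pose x := \sum_(E | Irr_in c dg cc E) (m E)%:~R / f_E Ev E.
have xE : x = \sum_E (m E)%:R / jschur c dg E.
  rewrite /x big_mkcond; apply: eq_bigr => E _; case: ifP => [ccE|/negbT nE].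
    by rewrite (f_EE coxS hP Ev two_sided_cc ccx0 ccE).
  by rewrite /m e0 // mxrank0 mul0r.
have tauE : jtau c (jval p) = rfconst x.
  rewrite (jtau_rhoK coxS hP dg (@rfconst C)) xE rmorph_sum; apply: eq_bigr => E _ /=.
  by rewrite -/(e E) trE -rmorphM mulrC.
(* The trace lies in [R] because the unit of [J] has integer coordinates. *)
have [|k xk] := adaptedR (n := fun E => (m E)%:Z).
  by rewrite -/x -tauE jtau_jval; exact: valP.
rewrite -/x in xk; exists k; split; first by rewrite tauE xk.
  rewrite -(ler0z C) -xk xE; apply: sumr_ge0 => E _.
  by rewrite divr_ge0 ?ler0n // ltW // jschur_gt0.
(* All terms are nonnegative with positive denominators, so every rank is zero and faithfulness
   applies. *)
move=> k0; rewrite k0 xE in xk; apply/ffunP => z; rewrite [RHS]ffunE.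
have jp0 : jval p = 0.
  apply: (rhoK_faithful coxS hP (dg := dg) (f := @rfconst C)) => E.
  apply/eqP; rewrite -mxrank_eq0 -/(e E) -/(m E) -(pnatr_eq0 C).
  have := psumr_eq0P _ xk => /(_ _ E isT) h.
  have /eqP : (m E)%:R / jschur c dg E = 0.
    by apply: h => E' _; rewrite divr_ge0 ?ler0n // ltW // jschur_gt0.
  by rewrite mulf_eq0 invr_eq0 (gt_eqF (jschur_gt0 coxS hP dg E)) orbF.
by apply: val_inj; have /ffunP/(_ z) := jp0; rewrite !ffunE.
Qed.

(** The component of the unit along [Gamma] is [n_d t_d], and its trace is [n_d^2]. *)
Lemma sum_jone_left_cell (F : comNzRingType) :
  \sum_z (if z \in Gamma then jone c F z else 0) * jone c F z = 1.
Proof.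
have [x0 eG] := cellGamma; have [d Dd dx] := simL_calD_ex hP x0.
have Gd : d \in Gamma by rewrite eG inE simL_sym.
rewrite (bigD1 d) //= Gd ffunE Dd -intrM nz_sqr // big1 ?addr0 // => z nz.
case: ifP => Gz; last by rewrite mul0r.
rewrite ffunE; case: ifP => Dz; last by rewrite mulr0.
rewrite eG inE simL_sym in Gz.
by rewrite (simL_calD_uniq hP Dz Dd Gz dx) eqxx in nz.
Qed.

Variables (HR : scalar_extension H theta) (M : cell_module c dg Gamma HR).

Lemma cell_indecomposable : indecomposable M.
Proof.
split.
  have [x0 eG] := cellGamma; have Gx0 : x0 \in Gamma by rewrite eG inE simL_refl.
  exists (cell_emb M (jbas B x0)); apply/eqP => e0.
  have /cell_emb_inj/(_ x0 Gx0) : cell_emb M (jbas B x0) = cell_emb M 0.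
    by rewrite e0 cell_emb0.
  by rewrite !ffunE eqxx => /eqP; rewrite oner_eq0.
move=> U V UV UV0.
have [p [q [pq [pp qq] pq0 pU qV]]] :=
  cell_direct_sum coxS hP one_add_v_unitR cellGamma UV UV0.
have [k [kE k_ge0 k0]] := jtau_idem pp (fun x Gx => (pq0 x Gx).1).
have [l [lE l_ge0 l0]] := jtau_idem qq (fun x Gx => (pq0 x Gx).2).
(* [p + q] is the component of the unit along [Gamma]; the identity holds in [R] and descends to
   integers, which embed in [C(v)]. *)
have kl : k + l = 1.
  apply: (@intr_inj C); apply: (fmorph_inj (@rfconst C)).
  rewrite !rmorphD rmorph1 /= -kE -lE !jtau_jval.
  rewrite -valD -big_split /=.
  have -> : \sum_z (p z * jone c B z + q z * jone c B z) = 1; last by [].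
  rewrite -(sum_jone_left_cell B); apply: eq_bigr => z _.
  rewrite -mulrDl; congr (_ * _); rewrite -(cell_sec_emb M) -pq ffunE //.
have [k00|nk] := eqVneq k 0; [left; exact/pU/k0 | right; apply/qV/l0].
have k1 : 1 <= k by rewrite -gtz0_ge1 lt_def nk.
by apply/eqP; rewrite eq_le l_ge0 andbT -(lerD2l k) kl addr0.
Qed.

End CellIdempotents.

Theorem corollary3p8 (Re : realType) (gT : finGroupType) (S : {set gT})
    (L : gT -> int)
    (H : hecke_algebra Re[i] S L) (c : kl_basis H) (dg : dagger_involution H)
    (R : subringClosed (ratfun Re[i]))
    (hOR : {subset @calO Re[i] <= R})
    (HR : scalar_extension H
            (subring_incl (fun x hx => hOR x (laurent_sub_calO hx))))
    (Gamma : {set gT}) (M : cell_module c dg Gamma HR) :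
  coxeter_system S ->
  weight_function S L ->
  (forall s, s \in S -> 0 < L s) ->
  P1_15 c ->
  noetherian (subring R) ->
  left_cell c Gamma ->
  projective M /\
  forall (HK : scalar_extension H (val : laurent Re[i] -> ratfun Re[i]))
         (Ev : generic_modules HK) (cc : {set gT}),
    two_sided_cell c cc ->
    Gamma \subset cc ->
    adapted Ev c dg cc R ->
    indecomposable M.
Proof.
move=> coxS _ _ hP _ cellGamma; split.
  exact: (cell_projective coxS hP (one_add_v_unitR hOR) cellGamma).
move=> HK Ev cc cell_cc sub_cc adR.
exact: (cell_indecomposable coxS hP cell_cc cellGamma sub_cc adR).
Qed.
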